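(* Let $(\Omega_i,\mathcal{M}_i,\mu_i)$ $(i=1,2)$ be $\sigma$-finite measure spaces. For each $i=1,2$, let $E_i$ be an essentially self-adjoint operator on $L^2(\mu_i)$ such that the spectrum of its closure consists of a sequence of discrete and strictly positive eigenvalues $0<\lambda_{1,i}\le\lambda_{2,i}\le\cdots$, whose eigenvectors are a basis of $L^2(\mu_i)$. Assume that for the eigenvalue counting function $N_i(\lambda)$ of $E_i$ $(i=1,2)$ there exist constants $C_i,p_i>0$ such that $$N_i(\lambda)\le C_i(1+\lambda)^{p_i}\quad\text{for all }\lambda>0.$$ Let $K\in L^2(\mu_2\otimes\mu_1)$ and let $T$ be the integral operator from $L^2(\mu_1)$ to $L^2(\mu_2)$ defined by $$(Tf)(x)=\int_{\Omega_1}K(x,y)f(y)\,d\mu_1(y).$$ Then the following holds: (i) If $(E_2)_x(E_1)_yK\in L^2(\mu_2\otimes\mu_1)$, then $T\in S_r(L^2(\mu_1),L^2(\mu_2))$ for all $0<r<\infty$ such that $$\frac1r<\frac12+\frac1{p_1}+\frac1{p_2},$$ and $$\|T\|_{S_r}\le\|E_1^{-1}\|_{S_{p_1}}\|E_2^{-1}\|_{S_{p_2}}\|(E_2)_x(E_1)_yK\|_{L^2(\mu_2\otimes\mu_1)}.$$ Moreover, the singular values of $T$ satisfy $$s_k(T)=o\Big(k^{-\left(\frac12+\frac1{p_1}+\frac1{p_2}\right)}\Big)\quad\text{as }k\to\infty.$$ (ii) Let $E$ be an essentially self-adjoint operator, on $L^2(\mu_1)$ or on $L^2(\mu_2)$,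 such that the spectrum of its closure consists of a sequence of discrete and strictly positive eigenvalues whose eigenvectors are a basis, and whose eigenvalue counting function satisfies $N(\lambda)\le C(1+\lambda)^p$ for all $\lambda>0$, for some $C,p>0$. If either $E_yK\in L^2(\mu_2\otimes\mu_1)$ ($E$ acting on $L^2(\mu_1)$) or $E_xK\in L^2(\mu_2\otimes\mu_1)$ ($E$ acting on $L^2(\mu_2)$), then $T\in S_r(L^2(\mu_1),L^2(\mu_2))$ for all $0<r<\infty$ such that $$\frac1r<\frac12+\frac1p,$$ and respectively $$\|T\|_{S_r}\le\|E^{-1}\|_{S_p}\|E_yK\|_{L^2(\mu_2\otimes\mu_1)}\quad\text{or}\quad\|T\|_{S_r}\le\|E^{-1}\|_{S_p}\|E_xK\|_{L^2(\mu_2\otimes\mu_1)}.$$ Moreover, the singular values of $T$ satisfy $$s_k(T)=o\Big(k^{-\left(\frac12+\frac1p\right)}\Big)\quad\text{as }k\to\infty.$$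
   Context: $L^2(\mu_i)=L^2(\Omega_i,\mu_i)$ is the complex Hilbert space of square integrable functions. The eigenvalue counting function of a self-adjoint operator with discrete spectrum $\{\lambda_j\}_j$ (here the closure of $E_i$, resp. $E$) is $N(\lambda):=\#\{j:\lambda_j\le\lambda\}$, with eigenvalues counted with multiplicity. $E_i^{-1}$, $E^{-1}$ denote the inverses of the closures. Schatten classes: for a compact operator $T:H_1\to H_2$ between complex Hilbert spaces, the singular values $s_1(T)\ge s_2(T)\ge\cdots\ge0$ are the eigenvalues, counted with multiplicity, of $|T|=(T^*T)^{1/2}$. For $0<p<\infty$, $S_p(H_1,H_2)$ is the set of compact $T$ with $\|T\|_{S_p}:=\big(\sum_k s_k(T)^p\big)^{1/p}<\infty$. In the norm estimates the right-hand side is read as $+\infty$ if one of the inverses does not belong to the indicated Schatten class. A kernel $K(x,y)$ has $x\in\Omega_2$ and $y\in\Omega_1$. $(E_2)_xK$ denotes the function obtained by applying $E_2$ to $K(\cdot,y)$ for almost every $y$, and $(E_1)_yK$ the one obtained by applying $E_1$ to $K(x,\cdot)$ for almost every $x$ (similarly for $E_x$, $E_y$); saying that such an expression belongs to a function space includes that it is well defined. *)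

(* Defs.v *)
From HB Require Import structures.
From mathcomp Require Import all_boot all_order all_algebra.
From mathcomp Require Import generic_quotient ring_quotient complex.
From mathcomp Require Import all_classical all_reals all_analysis measurable_realfun.
From mathcomp Require Import ring lra.

Set Implicit Arguments.
Unset Strict Implicit.
Unset Printing Implicit Defensive.

Import Order.TTheory GRing.Theory Num.Theory.
Import numFieldNormedType.Exports.

Local Open Scope classical_set_scope.
Local Open Scope card_scope.
Local Open Scope ring_scope.

(* Complex inner product spaces.  The inner product is linear in its first
   argument.  Completeness is not part of the structure: none of the notions
   below refers to it, and for [L2 mu] it is a theorem. *)
HB.mixin Record NormedModule_hasInner (C : numClosedFieldType) V
    & NormedModule C V := {
  inner : V -> V -> C ;
  inner_linear : forall (a : C) (u v w : V),
    inner (a *: u + v) w = a * inner u w + inner v w ;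
  inner_conj : forall u v : V, inner u v = Num.conj (inner v u) ;
  inner_norm : forall u : V, `|u| = sqrtC (inner u u)
}.

#[short(type="preHilbertType")]
HB.structure Definition PreHilbert (C : numClosedFieldType) :=
  {V of NormedModule C V & NormedModule_hasInner C V}.

HB.factory Record Lmodule_hasInner (C : numClosedFieldType) V
    & GRing.Lmodule C V := {
  inner : V -> V -> C ;
  inner_linear : forall (a : C) (u v w : V),
    inner (a *: u + v) w = a * inner u w + inner v w ;
  inner_conj : forall u v : V, inner u v = Num.conj (inner v u) ;
  inner_ge0 : forall u : V, 0 <= inner u u ;
  inner_eq0 : forall u : V, inner u u = 0 -> u = 0
}.

HB.builders Context C V & Lmodule_hasInner C V.

Let norm (u : V) : C := sqrtC (inner u u).

Let innerDl u v w : inner (u + v) w = inner u w + inner v w.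
Proof. by rewrite -[u]scale1r inner_linear mul1r scale1r. Qed.

Let inner0l w : inner 0 w = 0.
Proof. by apply: (addrI (inner 0 w)); rewrite -innerDl !addr0. Qed.

Let innerZl a u w : inner (a *: u) w = a * inner u w.
Proof. by rewrite -[a *: u]addr0 inner_linear inner0l addr0. Qed.

Let innerDr u v w : inner w (u + v) = inner w u + inner w v.
Proof. by rewrite inner_conj innerDl rmorphD /= -!inner_conj. Qed.

Let innerZr a u w : inner w (a *: u) = Num.conj a * inner w u.
Proof. by rewrite inner_conj innerZl rmorphM /= -inner_conj. Qed.

Let cauchy_schwarz u v : `|inner u v| ^+ 2 <= inner u u * inner v v.
Proof.
have [v0|v0] := eqVneq (inner v v) 0.
  by rewrite (inner_eq0 v0) inner_conj !inner0l rmorph0 normr0 expr0n /= mulr0.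
have vv : 0 < inner v v by rewrite lt_def v0 inner_ge0.
pose a := inner u v / inner v v.
have cvv : Num.conj (inner v v) = inner v v by rewrite -inner_conj.
have := inner_ge0 (u + (- a) *: v).
rewrite innerDl !innerDr !innerZl !innerZr rmorphN rmorphM fmorphV /= cvv.
rewrite [inner v u]inner_conj normCK.
set x := inner u v; set y := Num.conj x; set q := inner v v in v0 vv *.
have -> : inner u u + - (y / q) * x + (- a * y + - a * (- (y / q) * q)) =
  inner u u - x * y / q by rewrite /a -/x -/q; field; rewrite v0.
by rewrite subr_ge0 ler_pdivrMr.
Qed.

Let sqr_norm u : norm u ^+ 2 = inner u u.
Proof. exact: sqrtCK. Qed.

Let norm_ge0 u : 0 <= norm u.
Proof. by rewrite sqrtC_ge0 inner_ge0. Qed.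

Let normD u v : norm (u + v) <= norm u + norm v.
Proof.
rewrite -(@ler_pXn2r _ 2%N)// ?nnegrE ?addr_ge0// sqrrD !sqr_norm.
rewrite innerDl !innerDr.
have -> : inner u u + inner u v + (inner v u + inner v v) =
  inner u u + (inner u v + Num.conj (inner u v)) + inner v v.
  by rewrite [inner v u]inner_conj; ring.
rewrite lerD2r lerD2l.
have -> : inner u v + Num.conj (inner u v) = 'Re (inner u v) *+ 2.
  by rewrite ReE -mulr_natr divfK// pnatr_eq0.
rewrite lerMn2r /=; apply: (le_trans (leif_Re_Creal _)).
rewrite -(@ler_pXn2r _ 2%N)// ?nnegrE ?mulr_ge0// exprMn !sqr_norm.
exact: cauchy_schwarz.
Qed.

Let normZ a u : norm (a *: u) = `|a| * norm u.
Proof.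
rewrite /norm innerZl innerZr mulrA -normCK.
by rewrite sqrtCM ?nnegrE ?exprn_ge0 ?inner_ge0// sqrCK.
Qed.

Let norm0_eq0 u : norm u = 0 -> u = 0.
Proof. by move=> u0; apply: inner_eq0; rewrite -sqr_norm u0 expr0n. Qed.

HB.instance Definition _ :=
  Lmodule_isNormed.Build C V normD normZ norm0_eq0.

HB.instance Definition _ :=
  NormedModule_hasInner.Build C V inner_linear inner_conj (fun=> erefl).

HB.end.

Section inner_dot.
Context (C : numClosedFieldType) (V : preHilbertType C).

Let inner_bilinear : bilinear_for
  (GRing.Scale.Law.clone _ _ *%R _)
  (GRing.Scale.Law.clone _ _ (@Num.conj C \; *%R) _) (@inner C V).
Proof.
split=> [w a u v|w a u v] /=; first exact: inner_linear.
rewrite [LHS]inner_conj inner_linear rmorphD rmorphM /=.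
by rewrite -!inner_conj.
Qed.

HB.instance Definition _ := bilinear_isBilinear.Build C V V C
  *%R (@Num.conj C \; *%R) (@inner C V) inner_bilinear.

Let inner_hermitian (u v : V) :
  inner u v = (-1) ^+ false * Num.conj (inner v u).
Proof. by rewrite expr0 mul1r inner_conj. Qed.

HB.instance Definition _ := isHermitianSesquilinear.Build C V false
  (@Num.conj C) (@inner C V) inner_hermitian.

Let inner_gt0 (u : V) : u != 0 -> 0 < inner u u.
Proof.
rewrite -normr_eq0 inner_norm => u0; rewrite -sqrtC_gt0 lt_def u0 /=.
by rewrite -inner_norm.
Qed.

HB.instance Definition _ := isDotProduct.Build C V (@inner C V) inner_gt0.
End inner_dot.
Local Notation Re := (@complex.Re _).
Local Notation Im := (@complex.Im _).

Section square_integrable.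
Context d (T : measurableType d) (R : realType).
Variable mu : {measure set T -> \bar R}.
Implicit Types f g : T -> R[i].

Definition cmeasurable f :=
  measurable_fun setT (Re \o f) /\ measurable_fun setT (Im \o f).

(* |f x|^2 as a real number *)
Definition sqmod f (x : T) : R := Re (f x) ^+ 2 + Im (f x) ^+ 2.

Definition sqint f :=
  cmeasurable f /\ (\int[mu]_x (sqmod f x)%:E < +oo)%E.

Definition L2norm f : \bar R := ((\int[mu]_x (sqmod f x)%:E) `^ 2^-1)%E.

Definition cintegral f : R[i] :=
  Complex (\int[mu]_x Re (f x))%R (\int[mu]_x Im (f x))%R.

Let sqmod_ge0 f x : 0 <= sqmod f x.
Proof. by rewrite addr_ge0// sqr_ge0. Qed.

Let measurable_sqmod f : cmeasurable f -> measurable_fun setT (sqmod f).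
Proof.
by case=> mr mi; apply: measurable_funD; apply: measurable_funX.
Qed.

Let cmeasurableD f g : cmeasurable f -> cmeasurable g ->
  cmeasurable (fun x => f x + g x).
Proof.
move=> [fr fi] [gr gi]; split.
  rewrite (_ : _ \o _ = (Re \o f) \+ (Re \o g)); last first.
    by apply/funext => x /=; case: (f x) (g x) => a b [].
  exact: measurable_funD.
rewrite (_ : _ \o _ = (Im \o f) \+ (Im \o g)); last first.
  by apply/funext => x /=; case: (f x) (g x) => a b [].
exact: measurable_funD.
Qed.

Let cmeasurableM f g : cmeasurable f -> cmeasurable g ->
  cmeasurable (fun x => f x * g x).
Proof.
move=> [fr fi] [gr gi]; split.
  rewrite (_ : _ \o _ = (fun x => (Re \o f) x * (Re \o g) x -
      (Im \o f) x * (Im \o g) x)); last first.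
    by apply/funext => x /=; case: (f x) (g x) => a b [].
  by apply: measurable_funB; apply: measurable_funM.
rewrite (_ : _ \o _ = (fun x => (Re \o f) x * (Im \o g) x +
    (Im \o f) x * (Re \o g) x)); last first.
  by apply/funext => x /=; case: (f x) (g x) => a b [].
by apply: measurable_funD; apply: measurable_funM.
Qed.

Let cmeasurable_conj f : cmeasurable f ->
  cmeasurable (fun x => Num.conj (f x)).
Proof.
move=> [fr fi]; split.
  rewrite (_ : _ \o _ = Re \o f)//.
  by apply/funext => x /=; case: (f x).
rewrite (_ : _ \o _ = \- (Im \o f)); first exact: measurableT_comp.
by apply/funext => x /=; case: (f x).
Qed.

Let cmeasurable_cst a : cmeasurable (cst a).
Proof. by split; exact: measurable_cst. Qed.

Let sqmodM f g x : sqmod (fun x => f x * g x) x = sqmod f x * sqmod g x.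
Proof. by rewrite /sqmod; case: (f x) (g x) => a b [u v] /=; ring. Qed.

Let sqmodD_le f g x :
  sqmod (fun x => f x + g x) x <= 2 * (sqmod f x + sqmod g x).
Proof.
rewrite /sqmod; case: (f x) (g x) => a b [u v] /=.
by rewrite -subr_ge0; have := sqr_ge0 (a - u); have := sqr_ge0 (b - v); nra.
Qed.

Lemma ae0_sqmod f : cmeasurable f -> (\int[mu]_x (sqmod f x)%:E = 0)%E ->
  {ae mu, forall x, f x = 0}.
Proof.
move=> mf f0.
have mE : measurable_fun setT (fun x => (sqmod f x)%:E).
  by apply/measurable_EFinP; exact: measurable_sqmod.
have : (\int[mu]_x `|(sqmod f x)%:E| = 0)%E.
  by under eq_integral do rewrite gee0_abs ?lee_fin//.
move/(ae_eq_integral_abs mu measurableT mE).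
apply: filterS => x /(_ I) [] /eqP.
rewrite /sqmod paddr_eq0 ?sqr_ge0// !sqrf_eq0 => /andP[/eqP a0 /eqP b0].
by case: (f x) a0 b0 => a b /= -> ->.
Qed.

Let sqmodC a f x : sqmod (fun x => a * f x) x =
  (Re a ^+ 2 + Im a ^+ 2) * sqmod f x.
Proof. exact: (sqmodM (cst a)). Qed.

Let sqintZ a f : sqint f -> sqint (fun x => a * f x).
Proof.
move=> [mf lf]; split; first exact: cmeasurableM (cmeasurable_cst a) mf.
under eq_integral do rewrite sqmodC EFinM.
rewrite ge0_integralZl//.
- by rewrite lte_mul_pinfty// lee_fin addr_ge0// sqr_ge0.
- by apply/measurable_EFinP; exact: measurable_sqmod.
- by move=> x _; rewrite lee_fin.
- by rewrite lee_fin addr_ge0// sqr_ge0.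
Qed.

Let sqintD f g : sqint f -> sqint g -> sqint (fun x => f x + g x).
Proof.
move=> [mf lf] [mg lg]; split; first exact: cmeasurableD.
have mE h : cmeasurable h -> measurable_fun setT (fun x => (sqmod h x)%:E).
  by move=> mh; apply/measurable_EFinP; exact: measurable_sqmod.
apply: (@le_lt_trans _ _
  (\int[mu]_x (2%:E * ((sqmod f x)%:E + (sqmod g x)%:E)))%E).
  apply: ge0_le_integral => //.
  - by move=> x _; rewrite lee_fin.
  - by apply: mE; exact: cmeasurableD.
  - by apply: measurable_funeM; apply: emeasurable_funD; exact: mE.
  - by move=> x _; rewrite -EFinD -EFinM lee_fin.
rewrite ge0_integralZl//; last 2 first.
  - by apply: emeasurable_funD; exact: mE.
  - by move=> x _; rewrite adde_ge0 ?lee_fin.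
rewrite ge0_integralD//; last 4 first.
  - by move=> x _; rewrite lee_fin.
  - exact: mE.
  - by move=> x _; rewrite lee_fin.
  - exact: mE.
by rewrite lte_mul_pinfty ?lee_fin// lte_add_pinfty.
Qed.

Definition sqint_pred : {pred T -> R[i]} := mem [set f | sqint f].

Let sqint_submod_closed : submod_closed sqint_pred.
Proof.
split=> [|a f g].
  rewrite inE /=; split; first exact: cmeasurable_cst.
  rewrite [ltLHS](_ : _ = 0%E)// integral0_eq// => x _.
  by rewrite /sqmod /= expr0n /= addr0.
rewrite !inE /= => lf lg.
have -> : a *: f + g = (fun x => (fun x => a * f x) x + g x) by apply/funext.
by apply: sqintD => //; exact: sqintZ.
Qed.

HB.instance Definition _ :=
  GRing.isSubmodClosed.Build _ _ sqint_pred sqint_submod_closed.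

Record sqfun := Sqfun { sqfun_val :> T -> R[i]; _ : sqfun_val \in sqint_pred }.

HB.instance Definition _ := [isSub for sqfun_val].
HB.instance Definition _ := [Choice of sqfun by <:].
HB.instance Definition _ := [SubChoice_isSubLmodule of sqfun by <:].

Lemma sqfunP (f : sqfun) : sqint f.
Proof. by case: f => f /=; rewrite inE. Qed.

Definition null_pred : {pred sqfun} :=
  mem [set f : sqfun | {ae mu, forall x, f x = 0}].

Let null_submod_closed : submod_closed null_pred.
Proof.
split=> [|a f g].
  by rewrite inE /=; apply: aeW.
rewrite !inE /= => f0 g0; apply: filterS2 f0 g0 => x f0 g0.
by rewrite [LHS](_ : _ = a * f x + g x)// f0 g0 mulr0 addr0.
Qed.

HB.instance Definition _ :=
  GRing.isSubmodClosed.Build _ _ null_pred null_submod_closed.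

Definition L2 : Type := {ideal_quot null_pred}.
HB.instance Definition _ := GRing.Zmodule.on L2.
HB.instance Definition _ := EqQuotient.on L2.

End square_integrable.
Arguments null_pred {d T R} mu.
Local Open Scope quotient_scope.

Section L2_inner.
Context d (T : measurableType d) (R : realType).
Variable mu : {measure set T -> \bar R}.

Lemma L2_eqP (f g : sqfun mu) :
  \pi_(L2 mu) f = \pi_(L2 mu) g <-> {ae mu, forall x, f x = g x}.
Proof.
have -> : (\pi_(L2 mu) f = \pi_(L2 mu) g) = (f - g \in null_pred mu) :> Prop.
  have E := Quotient.idealrBE (null_pred mu) f g.
  by apply/propext; split=> [/eqP|H]; [rewrite -E | apply/eqP; rewrite -E].
by rewrite inE /=; split; apply: filterS => x; [move/subr0_eq | move=> fg];
  rewrite // [LHS](_ : _ = f x - g x)// fg subrr.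
Qed.

Lemma L2_reprK (f : sqfun mu) : {ae mu, forall x, repr (\pi_(L2 mu) f) x = f x}.
Proof. by apply/L2_eqP; rewrite reprK. Qed.

Definition L2_scale (a : R[i]) (u : L2 mu) : L2 mu := \pi_(L2 mu) (a *: repr u).

Let pi_scale a f : L2_scale a (\pi_(L2 mu) f) = \pi_(L2 mu) (a *: f).
Proof.
apply/L2_eqP; have := L2_reprK f; apply: filterS => x fx.
by rewrite [LHS](_ : _ = a * repr (\pi_(L2 mu) f) x)// fx.
Qed.

Let L2_scalerA a b u : L2_scale a (L2_scale b u) = L2_scale (a * b) u.
Proof. by elim/quotW: u => f; rewrite (pi_scale b f) !pi_scale scalerA. Qed.

Let L2_scale1r : left_id 1 L2_scale.
Proof. by elim/quotW => f; rewrite pi_scale scale1r. Qed.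

Let pi_add (f g : sqfun mu) :
  \pi_(L2 mu) f + \pi_(L2 mu) g = \pi_(L2 mu) (f + g).
Proof. by rewrite -raddfD. Qed.

Let L2_scalerDr : right_distributive L2_scale +%R.
Proof.
move=> a u v; elim/quotW: u => f; elim/quotW: v => g.
by rewrite pi_add !pi_scale pi_add scalerDr.
Qed.

Let L2_scalerDl u : {morph L2_scale^~ u : a b / a + b}.
Proof.
by move=> a b; elim/quotW: u => f; rewrite !pi_scale pi_add scalerDl.
Qed.

HB.instance Definition _ := GRing.Zmodule_isLmodule.Build R[i] (L2 mu)
  L2_scalerA L2_scale1r L2_scalerDr L2_scalerDl.


Definition L2_inner (u v : L2 mu) : R[i] :=
  cintegral mu (fun x => repr u x * Num.conj (repr v x)).

Let cintegrable (h : T -> R[i]) := mu.-integrable setT (EFin \o (Re \o h)) /\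
  mu.-integrable setT (EFin \o (Im \o h)).

Let cintegralP (a : R[i]) h1 h2 : cintegrable h1 -> cintegrable h2 ->
  cintegral mu (fun x => a * h1 x + h2 x) =
  a * cintegral mu h1 + cintegral mu h2.
Proof.
move=> [r1 i1] [r2 i2]; rewrite /cintegral.
have Z (c : R) (h : T -> R) : mu.-integrable setT (EFin \o h) ->
    mu.-integrable setT (EFin \o (fun x => c * h x)).
  move=> ih; rewrite (_ : _ \o _ = fun x => (c%:E * (h x)%:E)%E).
    exact: integrableZl.
  by apply/funext => x /=; rewrite EFinM.
have P (c e : R) (g1 g2 g3 : T -> R) : mu.-integrable setT (EFin \o g1) ->
    mu.-integrable setT (EFin \o g2) -> mu.-integrable setT (EFin \o g3) ->
    (\int[mu]_x (c * g1 x + e * g2 x + g3 x) =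
     c * \int[mu]_x g1 x + e * \int[mu]_x g2 x + \int[mu]_x g3 x)%R.
  move=> ih1 ih2 ih3.
  have D : mu.-integrable setT (EFin \o (fun x => c * g1 x + e * g2 x)).
    rewrite (_ : _ \o _ = (EFin \o (fun x => (c * g1 x)%R)) \+
      (EFin \o (fun x => (e * g2 x)%R)))%E//.
    by apply: integrableD => //; exact: Z.
  rewrite RintegralD//; congr (_ + _).
  by rewrite RintegralD//; [rewrite !RintegralZl | exact: Z | exact: Z].
case: a => a b /=.
have -> : (\int[mu]_x Re (Complex a b * h1 x + h2 x) =
    \int[mu]_x (a * Re (h1 x) + (- b) * Im (h1 x) + Re (h2 x)))%R.
  by apply: eq_Rintegral => x _; case: (h1 x) (h2 x) => p q [p' q'] /=; ring.
have -> : (\int[mu]_x Im (Complex a b * h1 x + h2 x) =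
    \int[mu]_x (a * Im (h1 x) + b * Re (h1 x) + Im (h2 x)))%R.
  by apply: eq_Rintegral => x _; case: (h1 x) (h2 x) => p q [p' q'] /=; ring.
rewrite (P _ _ (Re \o h1) (Im \o h1) (Re \o h2))//.
rewrite (P _ _ (Im \o h1) (Re \o h1) (Im \o h2))//.
by apply/eqP; rewrite eq_complex /=; apply/andP; split; apply/eqP; ring.
Qed.

Let ae_eq_cintegral h1 h2 : cmeasurable h1 -> cmeasurable h2 ->
  {ae mu, forall x, h1 x = h2 x} -> cintegral mu h1 = cintegral mu h2.
Proof.
move=> [r1 i1] [r2 i2] h12.
rewrite /cintegral; congr Complex; congr fine; apply: ae_eq_integral => //;
  try (by apply/measurable_EFinP);
  by move: h12; apply: filterS => x -> _.
Qed.

Let cmeasurable_sub (f g : sqfun mu) :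
  cmeasurable (fun x => f x * Num.conj (g x)).
Proof.
have [[fr fi] _] := sqfunP f; have [[gr gi] _] := sqfunP g; split.
  rewrite (_ : _ \o _ = (fun x => (Re \o f) x * (Re \o g) x +
      (Im \o f) x * (Im \o g) x)); last first.
    by apply/funext => x /=; case: (f x) (g x) => a b [a' b'] /=; ring.
  by apply: measurable_funD; apply: measurable_funM.
rewrite (_ : _ \o _ = (fun x => (Im \o f) x * (Re \o g) x -
    (Re \o f) x * (Im \o g) x)); last first.
  by apply/funext => x /=; case: (f x) (g x) => a b [a' b'] /=; ring.
by apply: measurable_funB; apply: measurable_funM.
Qed.

Let integrable_sqmod (f : sqfun mu) :
  mu.-integrable setT (EFin \o sqmod f).
Proof.
have [[fr fi] lf] := sqfunP f; apply/integrableP; split.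
  apply/measurable_EFinP.
  by apply: measurable_funD; apply: measurable_funX.
under eq_integral do rewrite gee0_abs ?lee_fin ?addr_ge0 ?sqr_ge0//.
exact: lf.
Qed.

Let cintegrable_sub (f g : sqfun mu) :
  cintegrable (fun x => f x * Num.conj (g x)).
Proof.
have [mr mi] := cmeasurable_sub f g.
have D : mu.-integrable setT
    (fun x => (sqmod f x)%:E + (sqmod g x)%:E)%E.
  by apply: integrableD => //; exact: integrable_sqmod.
split; apply: (le_integrable measurableT _ _ D);
  try (by apply/measurable_EFinP);
  move=> x _; rewrite -EFinD /= lee_fin [leRHS]ger0_norm
    ?addr_ge0 ?sqr_ge0// /sqmod;
  case: (f x) (g x) => a b [a' b'] /=; rewrite ler_norml.
- have := sqr_ge0 (a - a'); have := sqr_ge0 (b - b').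
  have := sqr_ge0 (a + a'); have := sqr_ge0 (b + b').
  by move=> *; apply/andP; split; nra.
- have := sqr_ge0 (a - b'); have := sqr_ge0 (b - a').
  have := sqr_ge0 (a + b'); have := sqr_ge0 (b + a').
  by move=> *; apply/andP; split; nra.
Qed.

Let L2_inner_linear a u v w :
  L2_inner (a *: u + v) w = a * L2_inner u w + L2_inner v w.
Proof.
rewrite -cintegralP; [|exact: cintegrable_sub|exact: cintegrable_sub].
have E : {ae mu, forall x, repr (a *: u + v) x = a * repr u x + repr v x}.
  have -> : a *: u + v = \pi_(L2 mu) (a *: repr u + repr v).
    by rewrite -pi_add reprK.
  exact: L2_reprK.
have -> : (fun x => a * (repr u x * Num.conj (repr w x)) +
     repr v x * Num.conj (repr w x)) =
   (fun x => (a *: repr u + repr v : sqfun mu) x * Num.conj (repr w x)).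
  apply/funext => x; rewrite mulrA -mulrDl; by [].
apply: ae_eq_cintegral; [exact: cmeasurable_sub|exact: cmeasurable_sub|].
by move: E; apply: filterS => x ->.
Qed.

Let L2_inner_conj u v : L2_inner u v = Num.conj (L2_inner v u).
Proof.
rewrite /L2_inner /cintegral /=; congr Complex.
  apply: eq_Rintegral => x _.
  by case: (repr u x) (repr v x) => a b [a' b'] /=; ring.
rewrite -mulN1r -RintegralZl//; last by have [] := cintegrable_sub (repr v) (repr u).
apply: eq_Rintegral => x _.
by case: (repr u x) (repr v x) => a b [a' b'] /=; ring.
Qed.

Let L2_innerxx u :
  L2_inner u u = Complex (fine (\int[mu]_x (sqmod (repr u) x)%:E)) 0.
Proof.
rewrite /L2_inner /cintegral; congr Complex.
  apply: eq_Rintegral => x _; rewrite /sqmod.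
  by case: (repr u x) => a b /=; ring.
rewrite /Rintegral integral0_eq// => x _; congr EFin.
by case: (repr u x) => a b /=; ring.
Qed.

Let L2_inner_ge0 u : 0 <= L2_inner u u.
Proof.
rewrite L2_innerxx lecE /= eqxx /= fine_ge0// integral_ge0// => x _.
by rewrite lee_fin addr_ge0// sqr_ge0.
Qed.

Let L2_inner_eq0 u : L2_inner u u = 0 -> u = 0.
Proof.
rewrite L2_innerxx => -[/eqP]; rewrite fine_eq0; last first.
  by have /integrable_fin_num := integrable_sqmod (repr u); exact.
move=> /eqP u0; have [mu_ _] := sqfunP (repr u).
rewrite -[u]reprK -[RHS](raddf0 (\pi_(L2 mu))); apply/L2_eqP.
exact: ae0_sqmod u0.
Qed.

HB.instance Definition _ := Lmodule_hasInner.Build R[i] (L2 mu)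
  L2_inner_linear L2_inner_conj L2_inner_ge0 L2_inner_eq0.

(* The class of [f]; it is 0 when [f] is not square integrable. *)
Definition toL2 (f : T -> R[i]) : L2 mu := \pi_(L2 mu) (insubd 0 f).

End L2_inner.

(* An unbounded operator from H to H is represented by its graph. *)
Section unbounded_operators.
Context (R : realType) (H : preHilbertType R[i]).
Implicit Types (A : set (H * H)) (u v w : H) (z : R[i]).

Definition op_domain A : set H := [set u | exists v, A (u, v)].

Definition is_operator A :=
  [/\ A (0, 0),
      forall z p q, A p -> A q -> A (z *: p + q) &
      forall u v w, A (u, v) -> A (u, w) -> v = w].

Definition op_adjoint A : set (H * H) :=
  [set p | forall q, A q -> inner q.2 p.1 = inner q.1 p.2].

Definition self_adjoint A :=
  [/\ is_operator A, dense (op_domain A) & A = op_adjoint A].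

(* [closure] is the topological closure of the graph in H * H. *)
Definition essentially_self_adjoint A :=
  [/\ is_operator A, dense (op_domain A) & self_adjoint (closure A)].

(* z is in the resolvent set when A - z is a bijection from its domain onto H
   with a bounded inverse S. *)
Definition resolvent_set A : set R[i] :=
  [set z | exists S : H -> H, [/\ linear S, continuous S &
    forall u v, A (u, v) <-> u = S (v - z *: u)]].

Definition spectrum A : set R[i] := ~` resolvent_set A.

Definition op_eigenspace A z : set H := [set u | A (u, z *: u)].

(* [V] is the span of n linearly independent vectors. *)
Definition has_dim (V : set H) (n : nat) := exists e : 'I_n -> H,
  (forall a : 'I_n -> R[i], \sum_i a i *: e i = 0 -> forall i, a i = 0) /\
  V = [set \sum_i a i *: e i | a in [set: 'I_n -> R[i]]].

Definition discrete_spectrum A :=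
  spectrum A `<=` isolated (spectrum A : set (R[i] : numClosedFieldType)) /\
  forall z, spectrum A z -> exists n, (0 < n)%N /\ has_dim (op_eigenspace A z) n.

Definition orthonormal_basis (e : nat -> H) :=
  (forall m n, inner (e m) (e n) = (m == n)%:R) /\
  (forall u, (fun n => \sum_(0 <= k < n) inner u (e k) *: e k) @ \oo --> u).

(* As the eigenvectors form a basis, [lam] repeats every eigenvalue according to
   its multiplicity. *)
Definition positive_eigenvalues A (lam : nat -> R) :=
  [/\ (forall n, 0 < lam n) /\ {homo lam : m n / (m <= n)%N >-> m <= n},
      spectrum A = [set (lam n)%:C%C | n in setT],
      discrete_spectrum A &
      exists e, orthonormal_basis e /\ forall n, A (e n, (lam n)%:C%C *: e n)].

(* The inverse as a total function, meaningful when A is injective and onto. *)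
Definition op_inv A : H -> H := fun v => xget 0 [set u | A (u, v)].

End unbounded_operators.

Definition eigen_count (R : realType) (lam : nat -> R) (x : R) : \bar R :=
  counting [set j | lam j <= x].

Definition counting_bound (R : realType) (lam : nat -> R) (C p : R) :=
  forall x, 0 < x -> (eigen_count lam x <= (C * (1 + x) `^ p)%:E)%E.

Section schatten.
Context (R : realType) (H1 H2 : preHilbertType R[i]).
Implicit Types (T : H1 -> H2).

Definition compact_op T :=
  linear T /\ compact (closure (T @` [set u | `|u| <= 1])).

Definition adjoint T : H2 -> H1 :=
  xget (fun=> 0) [set S | forall u v, inner (T u) v = inner u (S v)].

(* |T| = (T^* T)^(1/2) *)
Definition modulus T : H1 -> H1 :=
  xget (fun=> 0) [set P | [/\ linear P, continuous P,
    forall u, 0 <= inner (P u) u & forall u, P (P u) = adjoint T (T u)]].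

(* A nonincreasing enumeration of the eigenvalues of |T| with multiplicity,
   completed by zeros when there are finitely many positive ones. *)
Definition is_singular_values T (s : nat -> R) :=
  [/\ {homo s : m n / (m <= n)%N >-> n <= m}, forall k, 0 <= s k &
      forall c, 0 < c -> exists n,
        has_dim [set u | modulus T u = c%:C%C *: u] n /\
        [set k | s k = c] #= `I_n].

(* [singular_value T k] is the (k+1)-st singular value s_(k+1)(T). *)
Definition singular_value T : nat -> R := xget (fun=> 0) [set s | is_singular_values T s].

Definition schatten_norm (p : R) T : \bar R :=
  ((\sum_(0 <= k <oo) ((singular_value T k) `^ p)%:E) `^ p^-1)%E.

Definition schatten_class (p : R) T :=
  compact_op T /\ (schatten_norm p T < +oo)%E.

End schatten.

Section kernels.
Context d1 d2 (X1 : measurableType d1) (X2 : measurableType d2) (R : realType).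
Variables (mu1 : {measure set X1 -> \bar R}) (mu2 : {measure set X2 -> \bar R}).
Implicit Types K F : X2 * X1 -> R[i].

(* When K is square integrable, so is x |-> \int K(x, y) f(y) dmu1(y). *)
Definition integral_op K (f : L2 mu1) : L2 mu2 :=
  toL2 mu2 (fun x => cintegral mu1 (fun y => K (x, y) * repr f y)).

(* [F] is a version of E_y K.  It is unique up to a null set of the product,
   being jointly measurable. *)
Definition apply_y (E : set (L2 mu1 * L2 mu1)) K F :=
  cmeasurable F /\ {ae mu2, forall x,
    [/\ sqint mu1 (fun y => K (x, y)), sqint mu1 (fun y => F (x, y)) &
        E (toL2 mu1 (fun y => K (x, y)), toL2 mu1 (fun y => F (x, y)))]}.

(* [F] is a version of E_x K. *)
Definition apply_x (E : set (L2 mu2 * L2 mu2)) K F :=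
  cmeasurable F /\ {ae mu1, forall y,
    [/\ sqint mu2 (fun x => K (x, y)), sqint mu2 (fun x => F (x, y)) &
        E (toL2 mu2 (fun x => K (x, y)), toL2 mu2 (fun x => F (x, y)))]}.

End kernels.

(* Main.v *)
(* Write [e_k], [f_j] for eigenbases of [E1], [E2] and [a_k], [b_j] for the
   inverses of their eigenvalues.  Self-adjointness moves [E1] and [E2] onto the
   basis vectors, so the matrix of [T] in the bases [conj e_k], [f_j] is
   [a_k b_j t_kj], with [t] the square summable matrix of the Hilbert-Schmidt
   operator of kernel [(E2)_x (E1)_y K].

   For the little-o, a subspace of dimension [n + 1] of the span of the first
   [3 n + 1] singular vectors avoids the first [n] basis vectors on both sides;
   comparing Hilbert-Schmidt norms on it bounds [(n + 1) s_(3 n) ^ 2] by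
   [(a_n b_n) ^ 2] times a tail of [t].

   The constant in the norm inequality must be exactly 1.  For [k <= 1],
   concavity bounds [sum_i s_i ^ (2 k)] by [sum_l |T g_l| ^ (2 k)] for every
   orthonormal basis [g].  The factor [a] is handled by Hölder's inequality on the
   columns; the factor [b] is applied in small powers, the columns being
   rotated after each power to become orthogonal, which keeps every step within
   Hölder's and Jensen's inequalities on finite sums.  A part with one operator
   is the case where the other factor is absent. *)
Require Import Defs.
From HB Require Import structures.
From mathcomp Require Import all_boot all_order all_algebra.
From mathcomp Require Import complex.
From mathcomp Require Import all_classical all_reals all_analysis.
From mathcomp Require Import measurable_realfun generic_quotient ring_quotient spectral ring lra.

Set Implicit Arguments.
Unset Strict Implicit.
Unset Printing Implicit Defensive.

Import Order.TTheory GRing.Theory Num.Theory.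
Import numFieldNormedType.Exports.

Local Open Scope classical_set_scope.
Local Open Scope ring_scope.

Local Notation Re := (@complex.Re _).
Local Notation Im := (@complex.Im _).

(** * Inner products *)

(** The counting bound only yields [(lam n)^-1 = O(n^(-1/p))], so an inverse may fail to lie in its
    Schatten class. Membership of [T] in S_r is therefore read off the little-o, where the strict
    inequality on [1/r] makes the series converge; the norm inequality is a separate argument, valid
    at the endpoint too.

    The classical source of the constant 1 is Horn's inequality for singular values of products,
    which rests on exterior powers. Two finite facts take its place: among the unitary rotations of
    a finite family, an orthogonal one minimises the sum of [|y_l| ^ (2 k)] when [k <= 1]; and the
    squared cosines between two orthogonal families form a substochastic matrix. Jensen's inequality
    uses the latter only for exponents at least 1, whence the small powers.

    [singular_value] and [modulus] are choices; all that is used of those of [T] is that the values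
    are nonnegative, nonincreasing and, as long as they are positive, come with orthonormal
    eigenvectors of [S T], where [S] is the adjoint. Completeness of L2 enters only through
    compactness. *)

Definition csq (R : realType) (z : R[i]) : R := Re z ^+ 2 + Im z ^+ 2.

Section squared_modulus.
Context (R : realType).
Implicit Types (z w : R[i]) (r : R).

Lemma csq_ge0 z : 0 <= csq z.
Proof. by rewrite addr_ge0// sqr_ge0. Qed.

Lemma csq0 : csq (0 : R[i]) = 0.
Proof. by rewrite /csq /= expr0n addr0. Qed.

Lemma csqM z w : csq (z * w) = csq z * csq w.
Proof. by rewrite /csq; case: z w => a b [c d] /=; ring. Qed.

Lemma csq_conj z : csq (Num.conj z) = csq z.
Proof. by rewrite /csq; case: z => a b /=; ring. Qed.

Lemma csqN z : csq (- z) = csq z.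
Proof. by rewrite /csq; case: z => a b /=; ring. Qed.

Lemma csq_real r : csq r%:C%C = r ^+ 2.
Proof. by rewrite /csq /= expr0n addr0. Qed.

Lemma csqE z : z * Num.conj z = (csq z)%:C%C.
Proof.
by rewrite /csq; case: z => a b; apply/eqP; rewrite eq_complex /=; apply/andP; split;
  apply/eqP; ring.
Qed.

Lemma conj_real r : Num.conj (r%:C%C : R[i]) = r%:C%C.
Proof. by apply/eqP; rewrite eq_complex /= oppr0 !eqxx. Qed.

Lemma csqV r z : csq (z / r%:C%C) = csq z / r ^+ 2.
Proof.
have [->|r0] := eqVneq r 0; first by rewrite expr0n /= !invr0 !mulr0 csq0.
apply: (mulIf (x := r ^+ 2)); first by rewrite expf_neq0.
rewrite -{1}csq_real -csqM !divfK ?expf_neq0//.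
by apply/eqP => -[/eqP]; rewrite (negPf r0).
Qed.

Lemma csq_eq0 z : csq z = 0 -> z = 0.
Proof.
move=> /eqP; rewrite /csq paddr_eq0 ?sqr_ge0// !sqrf_eq0 => /andP[/eqP a0 /eqP b0].
by case: z a0 b0 => a b /= -> ->.
Qed.

Lemma csqD_le z w : csq (z + w) <= 2 * (csq z + csq w).
Proof.
rewrite /csq; case: z w => a b [c d] /=.
by rewrite -subr_ge0; have := sqr_ge0 (a - c); have := sqr_ge0 (b - d); nra.
Qed.

(** The difference of the two sides is [r^-1] times the squared modulus of [r * z - w]. The factor
    of [csq z] tends to 1 with [r], as a sharp constant requires. *)
Lemma csqD_le_eps z w r : 0 < r -> csq (z + w) <= (1 + r) * csq z + (1 + r^-1) * csq w.
Proof.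
move=> r0; rewrite /csq; case: z w => a b [c d] /=.
rewrite -subr_ge0.
have -> : (1 + r) * (a ^+ 2 + b ^+ 2) + (1 + r^-1) * (c ^+ 2 + d ^+ 2) -
    ((a + c) ^+ 2 + (b + d) ^+ 2) = r^-1 * ((r * a - c) ^+ 2 + (r * b - d) ^+ 2).
  by field; rewrite gt_eqF.
by rewrite mulr_ge0 ?invr_ge0 ?(ltW r0) ?addr_ge0 ?sqr_ge0.
Qed.

End squared_modulus.

Definition sqn (R : realType) (H : preHilbertType R[i]) (u : H) : R := Re (inner u u).

Definition orthonormal (R : realType) (H : preHilbertType R[i]) (n : nat) (e : nat -> H) :=
  forall i j, (i < n)%N -> (j < n)%N -> inner (e i) (e j) = (i == j)%:R.

Section inner_product.
Context (R : realType) (H : preHilbertType R[i]).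
Implicit Types (u v w : H) (a : R[i]) (r : R).

Lemma innerDl u v w : inner (u + v) w = inner u w + inner v w.
Proof. exact: linearDl. Qed.

Lemma innerDr u v w : inner w (u + v) = inner w u + inner w v.
Proof. exact: linearDr. Qed.

Lemma innerZl a u w : inner (a *: u) w = a * inner u w.
Proof. exact: linearZl_LR. Qed.

Lemma innerZr a u w : inner w (a *: u) = Num.conj a * inner w u.
Proof. by rewrite inner_conj innerZl rmorphM /= -inner_conj. Qed.

Lemma inner0l w : inner 0 w = 0.
Proof. exact: linear0l. Qed.

Lemma inner0r w : inner w 0 = 0.
Proof. exact: linear0r. Qed.

Lemma innerNl u w : inner (- u) w = - inner u w.
Proof. exact: linearNl. Qed.

Lemma innerNr u w : inner w (- u) = - inner w u.
Proof. exact: linearNr. Qed.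

Lemma innerBl u v w : inner (u - v) w = inner u w - inner v w.
Proof. by rewrite innerDl innerNl. Qed.

Lemma innerBr u v w : inner w (u - v) = inner w u - inner w v.
Proof. by rewrite innerDr innerNr. Qed.

Lemma inner_suml (I : Type) (r : seq I) (P : pred I) (F : I -> H) w :
  inner (\sum_(i <- r | P i) F i) w = \sum_(i <- r | P i) inner (F i) w.
Proof. exact: (big_morph (fun u => inner u w) (fun u v => innerDl u v w) (inner0l w)). Qed.

Lemma inner_sumr (I : Type) (r : seq I) (P : pred I) (F : I -> H) w :
  inner w (\sum_(i <- r | P i) F i) = \sum_(i <- r | P i) inner w (F i).
Proof. exact: (big_morph (fun u => inner w u) (fun u v => innerDr u v w) (inner0r w)). Qed.

Lemma csq_innerC u v : csq (inner u v) = csq (inner v u).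
Proof. by rewrite inner_conj csq_conj. Qed.

Lemma innerxx_ge0 u : 0 <= inner u u.
Proof.
have [->|u0] := eqVneq u 0; first by rewrite inner0l.
rewrite -sqrtC_ge0 -inner_norm; exact: normr_ge0.
Qed.

Lemma innerxx u : inner u u = (sqn u)%:C%C.
Proof.
rewrite /sqn; have := innerxx_ge0 u; case: (inner u u) => a b.
by rewrite lecE /= => /andP[/eqP -> _].
Qed.

Lemma sqn_ge0 u : 0 <= sqn u.
Proof. by have := innerxx_ge0 u; rewrite innerxx lecE /= => /andP[]. Qed.

Lemma normr_sqn u : `|u| ^+ 2 = (sqn u)%:C%C.
Proof. by rewrite inner_norm sqrtCK innerxx. Qed.

Lemma sqn_eq0 u : sqn u = 0 -> u = 0.
Proof.
move=> u0; apply/eqP; rewrite -normr_eq0 -sqrf_eq0 normr_sqn u0.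
by rewrite raddf0.
Qed.

Lemma sqn0 : sqn (0 : H) = 0.
Proof. by rewrite /sqn inner0l. Qed.

Lemma sqnZ a u : sqn (a *: u) = csq a * sqn u.
Proof.
by rewrite /sqn innerZl innerZr mulrA csqE innerxx -rmorphM.
Qed.

Lemma sqnN u : sqn (- u) = sqn u.
Proof. by rewrite /sqn innerNl innerNr opprK. Qed.

Lemma sqnD u v : sqn (u + v) = sqn u + sqn v + 2 * Re (inner u v).
Proof.
rewrite /sqn innerDl !innerDr [inner v u]inner_conj.
by case: (inner u u) (inner v v) (inner u v) => a b [c d] [e f] /=; ring.
Qed.

Lemma sqnD_orth u v : inner u v = 0 -> sqn (u + v) = sqn u + sqn v.
Proof. by move=> uv; rewrite sqnD uv /= mulr0 addr0. Qed.

Lemma sqn_sum_orth n (a : nat -> R[i]) (x : nat -> H) :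
  (forall i j, (i < n)%N -> (j < n)%N -> i != j -> inner (x i) (x j) = 0) ->
  sqn (\sum_(i < n) a i *: x i) = \sum_(i < n) csq (a i) * sqn (x i).
Proof.
elim: n => [|n ih] xo; first by rewrite !big_ord0 sqn0.
rewrite !big_ord_recr /= sqnD_orth ?sqnZ ?ih//.
  by move=> i j ilt jlt; apply: xo; rewrite ltnS ltnW.
rewrite inner_suml big1// => i _; rewrite innerZl innerZr xo ?mulr0//.
  by rewrite ltnS ltnW.
by rewrite ltn_eqF.
Qed.

Section orthonormal_family.
Variables (n : nat) (e : nat -> H).
Hypothesis oe : orthonormal n e.

Lemma sqn_orthonormal i : (i < n)%N -> sqn (e i) = 1.
Proof. by move=> ni; rewrite /sqn oe// eqxx. Qed.

Lemma sqn_sum_orthonormal (a : nat -> R[i]) :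
  sqn (\sum_(i < n) a i *: e i) = \sum_(i < n) csq (a i).
Proof.
rewrite sqn_sum_orth; last by move=> i j ni nj ij; rewrite oe// (negPf ij).
by apply: eq_bigr => i _; rewrite sqn_orthonormal// mulr1.
Qed.

Lemma inner_sum_orthonormal (a : nat -> R[i]) j : (j < n)%N ->
  inner (\sum_(i < n) a i *: e i) (e j) = a j.
Proof.
move=> nj; rewrite inner_suml (bigD1 (Ordinal nj))//= innerZl oe// eqxx mulr1.
rewrite big1 ?addr0// => i ij; rewrite innerZl oe//.
by rewrite -val_eqE /= in ij; rewrite (negPf ij) mulr0.
Qed.

Lemma sqn_sub_proj u :
  sqn (u - \sum_(i < n) inner u (e i) *: e i) = sqn u - \sum_(i < n) csq (inner u (e i)).
Proof.
set p := \sum_(i < n) _.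
have pe j : (j < n)%N -> inner p (e j) = inner u (e j) by exact: (inner_sum_orthonormal (fun i => inner u (e i))).
have o : inner (u - p) p = 0.
  rewrite {2}/p inner_sumr big1// => j _.
  by rewrite innerZr innerBl pe// subrr mulr0.
have := sqnD_orth o; rewrite subrK => ->.
by rewrite /p (sqn_sum_orthonormal (fun i => inner u (e i))) addrK.
Qed.

Lemma bessel u : \sum_(i < n) csq (inner u (e i)) <= sqn u.
Proof. by rewrite -subr_ge0 -sqn_sub_proj sqn_ge0. Qed.

End orthonormal_family.

(** Bessel's inequality for the single vector [v] divided by its norm. *)
Lemma cauchy_schwarz u v : csq (inner u v) <= sqn u * sqn v.
Proof.
have [v0|v0] := eqVneq (sqn v) 0.
  by rewrite (sqn_eq0 v0) inner0r sqn0 csq0 mulr0.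
have vp : 0 < sqn v by rewrite lt_def v0 sqn_ge0.
pose e (_ : nat) := ((Num.sqrt (sqn v))^-1)%:C%C *: v.
have oe : orthonormal 1 e.
  move=> [|//] [|//] _ _; rewrite eqxx innerZl innerZr innerxx.
  apply/eqP; rewrite eq_complex /=; apply/andP; split; apply/eqP; last by ring.
  have := sqr_sqrtr (ltW vp); set s := Num.sqrt _ => <-.
  have s0 : s != 0 by rewrite sqrtr_eq0 -ltNge.
  by field.
have := bessel oe u; rewrite big_ord1 innerZr csqM csq_conj csq_real exprVn.
by rewrite sqr_sqrtr ?(ltW vp)// mulrC ler_pdivrMr.
Qed.

End inner_product.

(** Parseval's identity stands in for convergence of the expansion in [H], so that all limits are
    limits of real sequences. *)
Definition hilbert_basis (R : realType) (H : preHilbertType R[i]) (e : nat -> H) :=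
  (forall n, orthonormal n e) /\
  forall u, (fun n => \sum_(k < n) csq (inner u (e k))) @ \oo --> sqn u.

Section hilbert_basis.
Context (R : realType) (H : preHilbertType R[i]) (e : nat -> H).
Hypothesis he : hilbert_basis e.

Lemma hb_orthonormal n : orthonormal n e.
Proof. by have [] := he. Qed.

Lemma hb_parseval u : (fun n => \sum_(k < n) csq (inner u (e k))) @ \oo --> sqn u.
Proof. by have [] := he. Qed.

Lemma hb_ext u v : (forall k, inner u (e k) = inner v (e k)) -> u = v.
Proof.
move=> uv; apply/eqP; rewrite -subr_eq0; apply/eqP/sqn_eq0.
have := @hb_parseval (u - v).
rewrite (_ : (fun n => _) = fun=> 0); last first.
  by apply/funext => n; rewrite big1// => k _; rewrite innerBl uv subrr csq0.
by move/cvg_lim => <-//; rewrite lim_cst.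
Qed.

Lemma hb_tail u : (fun n => sqn (u - \sum_(k < n) inner u (e k) *: e k)) @ \oo --> (0 : R).
Proof.
have -> : (fun n => sqn (u - \sum_(k < n) inner u (e k) *: e k)) =
    cst (sqn u) - (fun n => \sum_(k < n) csq (inner u (e k))).
  by apply/funext => n; rewrite sqn_sub_proj//; exact: hb_orthonormal.
have := cvgB (cvg_cst (sqn u)) (@hb_parseval u); rewrite subrr; exact.
Qed.

Lemma hb_le u r : (forall n, \sum_(k < n) csq (inner u (e k)) <= r) -> sqn u <= r.
Proof.
move=> h; have := @hb_parseval u => c; rewrite -(cvg_lim _ c)//.
by apply: limr_le; [apply/cvg_ex; exists (sqn u)|near=> n; exact: h].
Unshelve. all: by end_near. Qed.

End hilbert_basis.

Arguments hb_orthonormal {R H e} he n.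
Arguments hb_parseval {R H e} he u.
Arguments hb_tail {R H e} he u.

(** * Power sums *)

Section power_sums.
Context (R : realType).
Implicit Types (t x y A B : R).

Lemma young_powR t x y : 0 < t -> t < 1 -> 0 <= x -> 0 <= y ->
  x `^ t * y `^ (1 - t) <= t * x + (1 - t) * y.
Proof.
move=> t0 t1 x0 y0.
have t1' : 0 < 1 - t by rewrite subr_gt0.
have := @conjugate_powR _ (x `^ t) (y `^ (1 - t)) t^-1 (1 - t)^-1
  (powR_ge0 _ _) (powR_ge0 _ _).
rewrite !invr_gt0 !invrK [t + (1 - t)]addrC subrK -!powRrM !divff ?gt_eqF// !powRr1//.
by rewrite [x * t]mulrC [y * _]mulrC; apply.
Qed.

(** Young's inequality term by term, after division by the two sums. The endpoints are included
    because the exponent [k = 1] occurs later. *)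
Lemma hoelder_sum (I : finType) t (a b : I -> R) : 0 <= t -> t <= 1 ->
  (forall i, 0 <= a i) -> (forall i, 0 <= b i) ->
  \sum_i a i `^ t * b i `^ (1 - t) <= (\sum_i a i) `^ t * (\sum_i b i) `^ (1 - t).
Proof.
move=> t0 t1 a0 b0.
have sa0 : 0 <= \sum_i a i by exact: sumr_ge0.
have sb0 : 0 <= \sum_i b i by exact: sumr_ge0.
have [->|tn0] := eqVneq t 0.
  rewrite subr0 powRr0 mul1r powRr1//; apply: ler_sum => i _.
  by rewrite powRr0 mul1r powRr1.
have [->|tn1] := eqVneq t 1.
  rewrite subrr powRr0 mulr1 powRr1//; apply: ler_sum => i _.
  by rewrite powRr0 mulr1 powRr1.
have tp : 0 < t by rewrite lt_def tn0.
have tl : t < 1 by rewrite lt_def eq_sym tn1.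
set A := \sum_i a i in sa0 *; set B := \sum_i b i in sb0 *.
have [A0|A0] := eqVneq A 0.
  rewrite A0 powR0// mul0r big1// => i _.
  have /(_ i isT) -> := psumr_eq0P (fun j _ => a0 j) A0.
  by rewrite powR0// mul0r.
have [B0|B0] := eqVneq B 0.
  rewrite B0 (powR0 (x := 1 - t)) ?mulr0 ?subr_eq0 1?eq_sym// big1// => i _.
  have /(_ i isT) -> := psumr_eq0P (fun j _ => b0 j) B0.
  by rewrite (powR0 (x := 1 - t)) ?mulr0 ?subr_eq0 1?eq_sym.
have Ap : 0 < A by rewrite lt_def A0.
have Bp : 0 < B by rewrite lt_def B0.
have key i : a i `^ t * b i `^ (1 - t) <=
    (A `^ t * B `^ (1 - t)) * (t * (a i / A) + (1 - t) * (b i / B)).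
  have -> : a i `^ t * b i `^ (1 - t) =
      (A `^ t * B `^ (1 - t)) * ((a i / A) `^ t * (b i / B) `^ (1 - t)).
    rewrite mulrACA -!powRM ?divr_ge0// ![_ * (_ / _)]mulrC.
    by rewrite !divfK.
  by rewrite ler_wpM2l ?mulr_ge0 ?powR_ge0// young_powR ?divr_ge0.
apply: (le_trans (ler_sum _ (fun i _ => key i))).
rewrite -mulr_sumr big_split/= -!mulr_sumr -!mulr_suml -/A -/B !divff//.
by rewrite !mulr1 addrC subrK mulr1.
Qed.

(** Hölder's inequality for [s^t w = (s w)^t w^(1-t)]. The total mass may be any [A], since almost
    orthonormal vectors only give weights of mass close to 1. *)
Lemma jensen_concave (I : finType) t (s w : I -> R) A : 0 < t -> t <= 1 ->
  (forall i, 0 <= s i) -> (forall i, 0 <= w i) -> \sum_i w i <= A ->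
  \sum_i s i `^ t * w i <= (\sum_i s i * w i) `^ t * A `^ (1 - t).
Proof.
move=> t0 t1 s0 w0 wA.
have sw0 i : 0 <= s i * w i by rewrite mulr_ge0.
have W0 : 0 <= \sum_i w i by exact: sumr_ge0.
apply: (@le_trans _ _ (\sum_i (s i * w i) `^ t * w i `^ (1 - t))).
  apply: ler_sum => i _; have [->|wi0] := eqVneq (w i) 0.
    by rewrite !mulr0 mulr_ge0// powR_ge0.
  rewrite powRM// -mulrA -powRD; last by rewrite wi0 implybT.
  by rewrite addrC subrK powRr1.
apply: le_trans (hoelder_sum (ltW t0) t1 sw0 w0) _.
rewrite ler_wpM2l ?powR_ge0// ge0_ler_powR ?nnegrE ?subr_ge0//.
exact: le_trans wA.
Qed.

(** The concave case with exponent [t^-1], applied to the numbers [s i ^ t]. *)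
Lemma jensen_convex (I : finType) t (s w : I -> R) : 1 <= t ->
  (forall i, 0 <= s i) -> (forall i, 0 <= w i) -> \sum_i w i <= 1 ->
  (\sum_i s i * w i) `^ t <= \sum_i s i `^ t * w i.
Proof.
move=> t1 s0 w0 w1.
have t0 : 0 < t by apply: lt_le_trans t1.
have st0 i : 0 <= s i `^ t by rewrite powR_ge0.
have ti0 : 0 < t^-1 by rewrite invr_gt0.
have ti1 : t^-1 <= 1 by rewrite invf_le1.
have := jensen_concave ti0 ti1 st0 w0 w1.
rewrite powR1 mulr1.
under eq_bigr do rewrite -powRrM divff ?gt_eqF// powRr1//.
have S0 : 0 <= \sum_i s i * w i by apply: sumr_ge0 => i _; rewrite mulr_ge0.
have S1 : 0 <= \sum_i s i `^ t * w i.
  by apply: sumr_ge0 => i _; rewrite mulr_ge0// powR_ge0.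
move=> /(ge0_ler_powR (ltW t0)); rewrite !nnegrE powR_ge0 => /(_ S0 isT).
by rewrite -powRrM mulVf ?gt_eqF// powRr1.
Qed.

(** The concavity argument for a nearly doubly stochastic matrix [w]: each [a j] dominates an
    average of the [s i]. It is used with [A = B = 1] for exact rotations, and with [A], [B] near 1
    for truncated singular vectors. *)
Lemma weighted_power_sum (I J : finType) t (s : I -> R) (a : J -> R)
    (w : J -> I -> R) A B :
  0 < t -> t <= 1 -> (forall i, 0 <= s i) -> (forall j i, 0 <= w j i) ->
  (forall j, \sum_i s i * w j i <= a j) ->
  (forall j, \sum_i w j i <= A) -> (forall i, B <= \sum_j w j i) -> 1 <= A ->
  B * \sum_i s i `^ t <= A * \sum_j a j `^ t.
Proof.
move=> t0 t1 s0 w0 sa wA wB A1.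
have A0 : 0 <= A by apply: le_trans A1.
have ws0 j : 0 <= \sum_i s i * w j i.
  by apply: sumr_ge0 => i _; rewrite mulr_ge0.
apply: (@le_trans _ _ (\sum_j \sum_i s i `^ t * w j i)).
  rewrite exchange_big/= mulr_sumr; apply: ler_sum => i _.
  by rewrite -mulr_sumr mulrC ler_wpM2l ?powR_ge0.
rewrite mulr_sumr; apply: ler_sum => j _.
apply: le_trans (jensen_concave t0 t1 s0 (w0 j) (wA j)) _.
rewrite mulrC ler_pM ?powR_ge0//.
  by rewrite ler1_powR// lerBlDr lerDl ltW.
by rewrite ge0_ler_powR ?nnegrE ?(ltW t0)//; exact: le_trans (sa j).
Qed.

(** Every [s k] is at most [A], as a single term of the sum, so [s^r = s^q s^(r-q)] is at most
    [s^q A^(r-q)]. *)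
Lemma power_sum_le (s : nat -> R) q r A n : 0 < q -> q <= r -> 0 <= A ->
  (forall k, 0 <= s k) -> (forall n, \sum_(k < n) s k `^ q <= A `^ q) ->
  \sum_(k < n) s k `^ r <= A `^ r.
Proof.
move=> q0 qr A0 s0 sq.
have r0 : 0 < r := lt_le_trans q0 qr.
have sA k : s k <= A.
  have : s k `^ q <= A `^ q.
    apply: le_trans (sq k.+1); rewrite big_ord_recr/= lerDr.
    by apply: sumr_ge0 => i _; rewrite powR_ge0.
  have qi : 0 <= q^-1 by rewrite invr_ge0 ltW.
  move=> /(ge0_ler_powR qi); rewrite !nnegrE !powR_ge0 => /(_ isT isT).
  by rewrite -!powRrM divff ?gt_eqF// !powRr1.
have -> : r = q + (r - q) by rewrite addrC subrK.
have q' : 0 <= r - q by rewrite subr_ge0.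
rewrite (powRD (x := A)); last by rewrite addrC subrK gt_eqF.
apply: (@le_trans _ _ (\sum_(k < n) s k `^ q * A `^ (r - q))).
  apply: ler_sum => k _; rewrite powRD; last by rewrite addrC subrK gt_eqF.
  by rewrite ler_wpM2l ?powR_ge0// ge0_ler_powR ?nnegrE.
by rewrite -mulr_suml ler_wpM2r ?powR_ge0.
Qed.

End power_sums.

(** * Linear families and unitary mixing *)

Lemma row_kernel_neq0 (F : fieldType) m n (M : 'M[F]_(m, n)) : (n < m)%N ->
  exists a : 'rV_m, a != 0 /\ a *m M = 0.
Proof.
move=> nm; have : kermx M != 0.
  rewrite kermx_eq0; apply/negP => /eqP rM.
  by have := rank_leq_col M; rewrite rM leqNgt nm.
by move=> /rowV0Pn[a /sub_kermxP aM a0]; exists a.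
Qed.

Definition lin_indep (R : realType) (H : preHilbertType R[i]) n (e : 'I_n -> H) :=
  forall a : 'I_n -> R[i], \sum_i a i *: e i = 0 -> forall i, a i = 0.

Section linear_families.
Context (R : realType) (H : preHilbertType R[i]).

Lemma has_dim_leq (V : set H) m n : has_dim V m -> has_dim V n -> (m <= n)%N.
Proof.
move=> [e [le Ve]] [f [lf Vf]]; rewrite leqNgt; apply/negP => nm.
have eV i : V (e i).
  rewrite Ve; exists (fun j => (i == j)%:R) => //.
  rewrite (bigD1 i)//= eqxx scale1r big1 ?addr0// => j ji.
  by rewrite eq_sym (negPf ji) scale0r.
have /choice[M eM] : forall i, exists a : 'I_n -> R[i], \sum_j a j *: f j = e i.
  by move=> i; have := eV i; rewrite Vf => -[a _ <-]; exists a.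
have [a [a0 aM]] := row_kernel_neq0 (\matrix_(i, j) M i j) nm.
case/negP: a0; apply/eqP/rowP => i; rewrite mxE.
apply: (le (fun i => a 0 i)) => {i}.
under eq_bigr => i _ do rewrite -eM scaler_sumr.
rewrite exchange_big/= big1// => j _.
under eq_bigr => i _ do rewrite scalerA.
rewrite -scaler_suml (_ : \sum_i _ = 0) ?scale0r//.
have := congr1 (fun v : 'rV_n => v 0 j) aM; rewrite !mxE => aMj.
by rewrite -[RHS]aMj; apply: eq_bigr => i _; rewrite mxE.
Qed.

Lemma has_dim_uniq (V : set H) m n : has_dim V m -> has_dim V n -> m = n.
Proof. by move=> hm hn; apply/eqP; rewrite eqn_leq !(has_dim_leq (V := V)). Qed.

Lemma unit_vector_orth m q (e : 'I_m -> H) (x : 'I_q -> H) : lin_indep e -> (q < m)%N ->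
  exists a : 'I_m -> R[i], sqn (\sum_i a i *: e i) = 1 /\
    forall j, inner (\sum_i a i *: e i) (x j) = 0.
Proof.
move=> le qm.
have [a [a0 aM]] := row_kernel_neq0 (\matrix_(i, j) inner (e i) (x j)) qm.
set w := \sum_i a 0 i *: e i.
have w0 : w != 0.
  apply/eqP => /le a0'; case/negP: a0; apply/eqP/rowP => i.
  by rewrite mxE a0'.
have sw : 0 < sqn w.
  by rewrite lt_def sqn_ge0 andbT; apply: contra_neq w0 => /sqn_eq0.
pose c := ((Num.sqrt (sqn w))^-1)%:C%C.
exists (fun i => c * a 0 i).
have -> : \sum_i (c * a 0 i) *: e i = c *: w.
  by rewrite scaler_sumr; apply: eq_bigr => i _; rewrite scalerA.
split.
  by rewrite sqnZ csq_real exprVn sqr_sqrtr ?mulVf ?gt_eqF// ltW.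
move=> j; rewrite innerZl (_ : inner w _ = 0) ?mulr0// inner_suml.
have := congr1 (fun v : 'rV_q => v 0 j) aM; rewrite !mxE => aMj.
by rewrite -[RHS]aMj; apply: eq_bigr => i _; rewrite mxE innerZl.
Qed.

Lemma orthonormal_lin_indep m (u : nat -> H) : orthonormal m u ->
  lin_indep (fun i : 'I_m => u i).
Proof.
move=> ou a a0 i.
have := congr1 (fun v => inner v (u i)) a0; rewrite inner0l inner_suml.
rewrite (bigD1 i)//= big1 => [|j ji]; rewrite innerZl ou//.
  by rewrite eqxx mulr1 addr0.
by rewrite (inj_eq val_inj) (negPf ji) mulr0.
Qed.

Lemma orthonormal_extend n (w : nat -> H) v : orthonormal n w -> sqn v = 1 ->
  (forall j, (j < n)%N -> inner v (w j) = 0) ->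
  orthonormal n.+1 (fun j => if j == n then v else w j).
Proof.
move=> ow v1 vw i j; rewrite !ltnS => iN jN.
case: (eqVneq i n) iN => [->|iN'] iN; case: (eqVneq j n) jN => [->|jN'] jN.
- by rewrite innerxx v1.
- have jn : (j < n)%N by rewrite ltn_neqAle jN'.
  by rewrite vw.
- have im : (i < n)%N by rewrite ltn_neqAle iN'.
  by rewrite inner_conj vw// rmorph0 ?(negPf iN').
- by rewrite ow// ltn_neqAle ?iN' ?jN'.
Qed.

(** The vectors are found one at a time: each must satisfy the [q] given conditions and be
    orthogonal to those already found, fewer than [m] linear conditions on [m] coefficients. *)
Lemma orthonormal_subframe m q l (u x : nat -> H) : orthonormal m u -> (q + l <= m)%N ->
  exists w : nat -> H, orthonormal l w /\ forall i, (i < l)%N ->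
    (exists a : 'I_m -> R[i], w i = \sum_k a k *: u k) /\
    forall j, (j < q)%N -> inner (w i) (x j) = 0.
Proof.
move=> ou; elim: l => [|l ih] qlm; first by exists (fun=> 0).
have [|w [ow wP]] := ih; first by rewrite (leq_trans _ qlm)// addnS.
pose y (j : 'I_(q + l)) := match fintype.split j with inl i => x i | inr i => w i end.
have [|a [a1 ay]] := unit_vector_orth y (orthonormal_lin_indep ou).
  by rewrite -addnS.
set v := \sum_i _ in a1 ay.
have vx j : (j < q)%N -> inner v (x j) = 0.
  move=> jq; have := ay (lshift l (Ordinal jq)); rewrite /y.
  by rewrite -[lshift _ _]/(unsplit (inl _)) unsplitK.
have vw j : (j < l)%N -> inner v (w j) = 0.
  move=> jl; have := ay (rshift q (Ordinal jl)); rewrite /y.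
  by rewrite -[rshift _ _]/(unsplit (inr _)) unsplitK.
exists (fun j => if j == l then v else w j); split; first exact: orthonormal_extend.
move=> i; rewrite ltnS => il; case: (eqVneq i l) => [_|il'].
  by split=> //; exists a.
by apply: wP; rewrite ltn_neqAle il'.
Qed.

End linear_families.

Section unitary_mixing.
Context (R : realType) (H : preHilbertType R[i]) (N : nat).
Implicit Types (V : 'M[R[i]]_N) (y : 'I_N -> H).

Local Open Scope sesquilinear_scope.

(** The matrix acts on the index of the family and not on [H], so it commutes with linear operators
    applied to the members. *)
Definition mix V y (i : 'I_N) : H := \sum_l V i l *: y l.

Lemma mix_mul V W y i : mix V (mix W y) i = mix (V *m W) y i.
Proof.
rewrite /mix; under eq_bigr => l _ do rewrite scaler_sumr.
rewrite exchange_big/=; apply: eq_bigr => k _.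
rewrite mxE scaler_suml; apply: eq_bigr => l _; by rewrite scalerA.
Qed.

Lemma mix1 y i : mix 1%:M y i = y i.
Proof.
rewrite /mix (bigD1 i)//= mxE eqxx scale1r big1 ?addr0// => j ji.
by rewrite mxE eq_sym (negPf ji) scale0r.
Qed.

Lemma unitarymx_row_csq V i : V \is unitarymx -> \sum_l csq (V i l) = 1.
Proof.
move=> /unitarymxP VV; have := congr1 (fun M : 'M[R[i]]_N => M i i) VV.
rewrite !mxE eqxx; under eq_bigr do rewrite !mxE csqE.
by rewrite -raddf_sum => -[].
Qed.

Lemma unitarymx_col_csq V l : V \is unitarymx -> \sum_i csq (V i l) = 1.
Proof.
rewrite -trmx_unitary => /(unitarymx_row_csq l) <-.
by apply: eq_bigr => i _; rewrite mxE.
Qed.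

Lemma mixVK V y l : V \is unitarymx -> mix (V ^t* ) (mix V y) l = y l.
Proof.
move=> uV; have : V ^t* *m V = 1%:M by rewrite -invmx_unitary// mulVmx// unitarymx_unit.
by rewrite mix_mul => ->; rewrite mix1.
Qed.

Lemma inner_mix V y z i : inner (mix V y i) z = \sum_l V i l * inner (y l) z.
Proof. by rewrite inner_suml; apply: eq_bigr => l _; rewrite innerZl. Qed.

Lemma sum_csq_mix V (a : 'I_N -> R[i]) : V \is unitarymx ->
  \sum_i csq (\sum_l V i l * a l) = \sum_l csq (a l).
Proof.
move=> uV; pose A : 'cV_N := \col_l a l.
have E (B : 'cV[R[i]]_N) : (B ^t* *m B) 0 0 = (\sum_l csq (B l 0))%:C%C.
  rewrite mxE raddf_sum; apply: eq_bigr => l _.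
  by rewrite !mxE mulrC csqE.
have VA : (V *m A) ^t* *m (V *m A) = A ^t* *m A.
  rewrite trmx_mul map_mxM/= -mulmxA [_ ^t* *m (V *m A)]mulmxA.
  by rewrite -invmx_unitary// mulVmx ?unitarymx_unit// mul1mx.
have := congr1 (fun M : 'M[R[i]]_1 => M 0 0) VA; rewrite !E => -[].
under eq_bigr do rewrite mxE.
under [in X in _ = X -> _]eq_bigr do rewrite mxE.
move=> <-; apply: eq_bigr => i _; congr csq; apply: eq_bigr => l _.
by rewrite mxE.
Qed.

(** A unitary matrix diagonalising the Gram matrix of [y], by the spectral theorem. The resulting
    vectors are not normalised and some may vanish. *)
Lemma unitary_orthogonalization y : exists V, V \is unitarymx /\
  forall i j, i != j -> inner (mix V y i) (mix V y j) = 0.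
Proof.
pose A : 'M[R[i]]_N := \matrix_(i, j) inner (y i) (y j).
have hA : A \is normalmx.
  apply: hermitian_normalmx; rewrite is_hermitianmxE expr0 scale1r; apply/eqP.
  by apply/matrixP => i j; rewrite !mxE inner_conj.
exists (spectralmx A); split; first exact: spectral_unitarymx.
have uP := spectral_unitarymx A; set P := spectralmx A in uP *.
have PA : P *m A *m P ^t* = diag_mx (spectral_diag A).
  have /orthomx_spectralP E := hA.
  rewrite {1}E -/P -invmx_unitary// !mulmxA mulmxV ?mul1mx ?unitarymx_unit//.
  by rewrite mulmxK ?unitarymx_unit.
move=> i j ij; have := congr1 (fun M : 'M[R[i]]_N => M i j) PA.
rewrite [RHS]mxE (negPf ij) mulr0n => <-; rewrite !mxE.
rewrite [X in inner _ X]/mix inner_sumr; apply: eq_bigr => k _.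
rewrite innerZr inner_mix !mxE mulrC; congr (_ * _).
by apply: eq_bigr => l _; rewrite mxE.
Qed.

Lemma sqn_sum_orthogonal (a : 'I_N -> R[i]) (x : 'I_N -> H) :
  (forall i j, i != j -> inner (x i) (x j) = 0) ->
  sqn (\sum_i a i *: x i) = \sum_i csq (a i) * sqn (x i).
Proof.
move=> xo; rewrite {1}/sqn inner_suml raddf_sum; apply: eq_bigr => i _ /=.
rewrite innerZl inner_sumr (bigD1 i)//= big1 => [|j ji]; last first.
  by rewrite innerZr xo ?mulr0// eq_sym.
by rewrite addr0 innerZr mulrA csqE innerxx -rmorphM.
Qed.

(** With the convention that division by 0 gives 0, vanishing members of the family drop out of the
    sum. *)
Lemma bessel_orthogonal (x : 'I_N -> H) z :
  (forall i j, i != j -> inner (x i) (x j) = 0) ->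
  \sum_i csq (inner z (x i)) / sqn (x i) <= sqn z.
Proof.
move=> xo; pose c i := inner z (x i) / (sqn (x i))%:C%C.
pose p := \sum_i c i *: x i.
have E : inner z p = (\sum_i csq (inner z (x i)) / sqn (x i))%:C%C.
  rewrite inner_sumr raddf_sum; apply: eq_bigr => i _ /=.
  rewrite innerZr; have -> : Num.conj (c i) = Num.conj (inner z (x i)) / (sqn (x i))%:C%C.
    by rewrite /c -innerxx rmorphM fmorphV /= -!inner_conj.
  rewrite mulrAC [_ * inner z _]mulrC csqE.
  by rewrite rmorphM/= fmorphV.
have P : sqn p = \sum_i csq (inner z (x i)) / sqn (x i).
  rewrite sqn_sum_orthogonal//; apply: eq_bigr => i _.
  rewrite csqV; have [->|x0] := eqVneq (sqn (x i)) 0; first by rewrite mulr0 invr0 mulr0.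
  by field.
have := sqn_ge0 (z - p); rewrite sqnD sqnN innerNr E/= P; lra.
Qed.

End unitary_mixing.

(** * Singular values *)

Section singular_vectors.
Local Open Scope card_scope.
Context (R : realType) (H1 H2 : preHilbertType R[i]).

Lemma inner_ext (H : preHilbertType R[i]) (v w : H) :
  (forall u, inner u v = inner u w) -> v = w.
Proof.
move=> vw; apply/eqP; rewrite -subr_eq0; apply/eqP/sqn_eq0.
by rewrite /sqn innerBr vw subrr.
Qed.

Lemma adjoint_eq (T : H1 -> H2) (S : H2 -> H1) :
  (forall u v, inner (T u) v = inner u (S v)) -> adjoint T = S.
Proof.
move=> TS; apply: xget_unique => // S' TS'; apply/funext => v.
by apply: inner_ext => u; rewrite -TS TS'.
Qed.

(** Polarization: the quadratic form is real at [u + v] and at [u + i v], which settles the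
    imaginary and the real part of the difference. *)
Lemma positive_symmetric (H : preHilbertType R[i]) (P : H -> H) : linear P ->
  (forall u, 0 <= inner (P u) u) -> forall u v, inner (P u) v = inner u (P v).
Proof.
move=> lP P0 u v.
have PD w w' : P (w + w') = P w + P w' by rewrite -[w in LHS]scale1r lP scale1r.
have PZ a w : P (a *: w) = a *: P w.
  have P00 : P 0 = 0 by apply: (addrI (P 0)); rewrite -PD !addr0.
  by rewrite -[a *: w]addr0 lP P00 addr0.
have im w : Im (inner (P w) w) = 0.
  by have := P0 w; rewrite lecE /= => /andP[/eqP].
have i1 := im (u + v); have i2 := im (u + 'i%C *: v); move: i1 i2.
rewrite !PD !PZ !innerDl !innerDr !innerZl !innerZr !raddfD/=.
have := im u; have := im v; rewrite [inner u (P v)]inner_conj.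
move: (inner (P u) u) (inner (P v) v) (inner (P u) v) (inner (P v) u).
move=> [a b] [c d] [e f] [g h] /= -> -> i1 i2.
by apply/eqP; rewrite eq_complex /=; apply/andP; split; apply/eqP; lra.
Qed.

(** The index [n] itself belongs to the level set, hence the strict inequality: the eigenspace still
    has room for a vector orthogonal to those already chosen in it. *)
Lemma level_set_size (s : nat -> R) n d : [set k | s k = s n] #= `I_d ->
  (size [seq i <- iota 0 n | s i == s n] < d)%N.
Proof.
move=> sd; rewrite -(card_fset_set sd).
have fA : finite_set [set k | s k = s n] by apply/finite_setP; exists d.
set L := [seq _ <- _ | _].
have uL : uniq (n :: L).
  rewrite /= filter_uniq ?iota_uniq// andbT mem_filter mem_iota add0n ltnn.
  by rewrite !andbF.
apply: (uniq_leq_size uL) => i; rewrite inE => /orP[/eqP ->|].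
  by rewrite in_fset_set// inE.
by rewrite mem_filter => /andP[/eqP si _]; rewrite in_fset_set// inE.
Qed.

(* [singular_value] and [modulus] are choices with default 0: when there is
   nothing to choose, the hypothesis of the last conjunct fails for [n > 0]. *)
Lemma singular_value_vectors (T : H1 -> H2) (S : H2 -> H1) :
  (forall u v, inner (T u) v = inner u (S v)) -> let s := singular_value T in
  [/\ {homo s : m n / (m <= n)%N >-> n <= m}, forall k, 0 <= s k &
   forall n, (forall k, (k < n)%N -> 0 < s k) -> exists u, orthonormal n u /\
     forall k, (k < n)%N -> S (T (u k)) = (s k ^+ 2)%:C%C *: u k].
Proof.
move=> TS s; have [ex|nex] := pselect (exists s', is_singular_values T s'); last first.
  have -> : s = fun=> 0 by apply: xgetPN => s' s'P; apply: nex; exists s'.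
  split=> // -[|n] n0; first by exists (fun=> 0).
  by have := n0 0%N isT; rewrite ltxx.
have [hs s0 sP] : is_singular_values T s := xgetPex _ ex.
split=> //; have [exP|nexP] := pselect (exists P : H1 -> H1, [/\ linear P, continuous P,
    forall u, 0 <= inner (P u) u & forall u, P (P u) = adjoint T (T u)]); last first.
  have P0 : modulus T = fun=> 0 by apply: xgetPN => P' PP; apply: nexP; exists P'.
  move=> [|n] n0; first by exists (fun=> 0).
  have [[|d] [[e [le Ve]] sd]] := sP _ (n0 0%N isT).
    by have := level_set_size sd.
  have [] : [set u | modulus T u = (s 0%N)%:C%C *: u] (e ord0) -> False.
    rewrite P0 /= => /esym/eqP; rewrite scaler_eq0 => /orP[/eqP[s00]|/eqP e0].
      by have := n0 0%N isT; rewrite s00 ltxx.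
    have := le (fun j => (j == ord0)%:R); rewrite (bigD1 ord0)//= e0 scaler0 add0r.
    rewrite big1 => [/(_ erefl ord0)/eqP|j /negPf ->]; last by rewrite scale0r.
    by rewrite eqxx oner_eq0.
  rewrite Ve; exists (fun j => (j == ord0)%:R) => //.
  rewrite (bigD1 ord0)//= scale1r big1 ?addr0// => j /negPf ->.
  by rewrite scale0r.
have [lP _ P0 PP] : [/\ linear (modulus T), continuous (modulus T),
    forall u, 0 <= inner (modulus T u) u & forall u, modulus T (modulus T u) = adjoint T (T u)] :=
  xgetPex _ exP.
set P := modulus T in lP P0 PP sP.
have symP := positive_symmetric lP P0.
have PZ a w : P (a *: w) = a *: P w.
  have P00 : P 0 = 0.
    have := lP 1 0 0; rewrite !scale1r !addr0 => /esym/eqP.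
    by rewrite -subr_eq0 addrK => /eqP.
  by rewrite -[a *: w]addr0 lP P00 addr0.
suff main : forall n, (forall k, (k < n)%N -> 0 < s k) -> exists u, orthonormal n u /\
    forall k, (k < n)%N -> P (u k) = (s k)%:C%C *: u k.
  move=> n n0; have [u [ou uP]] := main n n0; exists u; split=> // k kn.
  rewrite -(adjoint_eq TS) -PP uP// PZ uP// scalerA -rmorphM.
  by rewrite expr2.
elim=> [|n ih] n0; first by exists (fun=> 0).
have [|u [ou uP]] := ih; first by move=> k kn; rewrite n0// ltnW.
have [d [[e [le Ve]] sd]] := sP _ (n0 n (ltnSn n)).
set L := [seq i <- iota 0 n | s i == s n].
(* Only the earlier eigenvectors with the same eigenvalue impose conditions here; orthogonality to
   the others follows from the symmetry of [P]. *)
have [a [a1 au]] := unit_vector_orth (fun j : 'I_(size L) => u (nth 0%N L j)) le (level_set_size sd).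
set v := \sum_i _ in a1 au.
have Pv : P v = (s n)%:C%C *: v.
  have : [set u | P u = (s n)%:C%C *: u] v by rewrite Ve; exists a.
  by [].
exists (fun j => if j == n then v else u j); split; last first.
  move=> k; rewrite ltnS => kn; case: (eqVneq k n) kn => [->//|kn' kn].
  by rewrite uP// ltn_neqAle kn'.
apply: orthonormal_extend => // j jn.
have [sj|sj] := eqVneq (s j) (s n).
  have jL : j \in L by rewrite mem_filter sj eqxx mem_iota.
  have jL' : (index j L < size L)%N by rewrite index_mem.
  by have := au (Ordinal jL'); rewrite /= nth_index.
have E : (s n)%:C%C * inner v (u j) = (s j)%:C%C * inner v (u j).
  rewrite -innerZl -Pv symP uP// innerZr; congr (_ * _).
  by rewrite conj_real.
move/eqP: E; rewrite -subr_eq0 -mulrBl mulf_eq0 => /orP[|/eqP//].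
by rewrite -rmorphB => /eqP[/eqP]; rewrite subr_eq0 eq_sym (negPf sj).
Qed.

End singular_vectors.

Section adjoint_pair.
Context (R : realType) (H1 H2 : preHilbertType R[i]).
Variables (T : H1 -> H2) (S : H2 -> H1).
Hypothesis TS : forall u v, inner (T u) v = inner u (S v).

(** A formal adjoint makes a map linear, because inner products separate vectors. *)
Lemma adjoint_linear : linear T.
Proof.
move=> a u v; apply: inner_ext => w.
by rewrite [LHS]inner_conj TS inner_linear -!TS -innerZl -innerDl -inner_conj.
Qed.

Lemma adjoint_sym u v : inner (S v) u = inner v (T u).
Proof. by rewrite inner_conj -TS -inner_conj. Qed.

Lemma adjointZ a u : T (a *: u) = a *: T u.
Proof.
by apply: inner_ext => w; rewrite -adjoint_sym innerZr adjoint_sym innerZr.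
Qed.

Lemma adjoint_sum n (a : 'I_n -> R[i]) (u : 'I_n -> H1) :
  T (\sum_i a i *: u i) = \sum_i a i *: T (u i).
Proof.
apply: inner_ext => w; rewrite -adjoint_sym !inner_sumr.
by apply: eq_bigr => i _; rewrite !innerZr adjoint_sym.
Qed.

End adjoint_pair.

Lemma cvg_sum_ord (R : realType) n (F : nat -> nat -> R) (l : nat -> R) :
  (forall i, F i @ \oo --> l i) ->
  (fun J => \sum_(i < n) F i J) @ \oo --> \sum_(i < n) l i.
Proof.
move=> Fl; elim: n => [|n ih].
  by under eq_fun do rewrite big_ord0; rewrite big_ord0; exact: cvg_cst.
under eq_fun do rewrite big_ord_recr; rewrite big_ord_recr/=.
exact: cvgD.
Qed.

Section sums_of_coordinates.
Context (R : realType) (H : preHilbertType R[i]) (f : nat -> H).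
Hypothesis hf : hilbert_basis f.

(** Reduces Hilbert-Schmidt sums to finite double sums, where the order of summation can be
    exchanged. *)
Lemma hb_sum_le n (x : nat -> H) A :
  (forall J, \sum_(i < n) \sum_(j < J) csq (inner (x i) (f j)) <= A) ->
  \sum_(i < n) sqn (x i) <= A.
Proof.
move=> h.
have c : (fun J => \sum_(i < n) \sum_(j < J) csq (inner (x i) (f j))) @ \oo -->
    \sum_(i < n) sqn (x i).
  by apply: (cvg_sum_ord (F := fun i J => \sum_(j < J) csq (inner (x i) (f j))) (l := fun i => sqn (x i))) => i; exact: hb_parseval.
rewrite -(cvg_lim _ c)//.
by apply: limr_le; [apply/cvg_ex; eexists; exact: c|near=> J; exact: h].
Unshelve. all: by end_near. Qed.

End sums_of_coordinates.

Section hilbert_schmidt.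
Context (R : realType) (H1 H2 : preHilbertType R[i]).
Variables (T : H1 -> H2) (S : H2 -> H1) (g : nat -> H1) (f : nat -> H2).
Hypothesis TS : forall u v, inner (T u) v = inner u (S v).
Hypothesis hg : hilbert_basis g.
Hypothesis hf : hilbert_basis f.

Local Notation s := (singular_value T).

Lemma singular_value_ninc m n : (m <= n)%N -> s n <= s m.
Proof. by have [h _ _] := singular_value_vectors TS; exact: h. Qed.

Lemma singular_value_ge0 k : 0 <= s k.
Proof. by have [_ h _] := singular_value_vectors TS; exact: h. Qed.

(** On this span [S T] is diagonal with entries at least [s n ^ 2]. *)
Lemma singular_span_lower n u w (a : 'I_n.+1 -> R[i]) : orthonormal n.+1 u ->
  (forall k, (k < n.+1)%N -> S (T (u k)) = (s k ^+ 2)%:C%C *: u k) ->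
  w = \sum_k a k *: u k -> sqn w = 1 -> s n ^+ 2 <= sqn (T w).
Proof.
move=> ou uP wE w1.
have a1 : \sum_k csq (a k) = 1.
  rewrite -w1 wE sqn_sum_orthogonal => [|i j ij]; last first.
    by rewrite ou// (inj_eq val_inj) (negPf ij).
  by apply: eq_bigr => k _; rewrite (sqn_orthonormal ou)// mulr1.
have -> : sqn (T w) = \sum_(k < n.+1) s k ^+ 2 * csq (a k).
  rewrite /sqn TS wE (adjoint_sum TS) (adjoint_sum (fun u v => adjoint_sym TS v u)).
  rewrite inner_suml raddf_sum; apply: eq_bigr => k _ /=.
  rewrite innerZl inner_sumr (bigD1 k)//= big1 => [|j jk].
    rewrite addr0 uP// !innerZr conj_real innerxx (sqn_orthonormal ou)// mulr1.
    by rewrite mulrA csqE -rmorphM/= mulrC.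
  by rewrite uP// !innerZr ou// (inj_eq val_inj) eq_sym (negPf jk) !mulr0.
rewrite -[leLHS]mulr1 -a1 mulr_sumr; apply: ler_sum => k _.
rewrite ler_wpM2r ?csq_ge0// lerXn2r ?nnegrE ?singular_value_ge0//.
by rewrite singular_value_ninc// -ltnS.
Qed.

(* On a subspace of dimension [n + 1] of the span of the first [3 n + 1]
   singular vectors, orthogonal to [g k] and mapped into the complement of
   [f k] for [k < n], [T] is bounded below by [s (3 n)], whereas its
   Hilbert-Schmidt norm only sees the entries [t_jk] with [j, k >= n]. *)
Lemma singular_value_tail (b : nat -> H2) (alpha beta : nat -> R) n A :
  (forall k, 0 <= alpha k) -> {homo alpha : i j / (i <= j)%N >-> j <= i} ->
  (forall k, 0 <= beta k) -> {homo beta : i j / (i <= j)%N >-> j <= i} ->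
  (forall k j, inner (T (g k)) (f j) = (alpha k * beta j)%:C%C * inner (b k) (f j)) ->
  (forall m, \sum_(k < m | (n <= k)%N) sqn (b k) <= A) ->
  n.+1%:R * s (3 * n) ^+ 2 <= (alpha n * beta n) ^+ 2 * A.
Proof.
move=> a0 ha b0 hb tE bA.
have A0 : 0 <= A by have := bA 0%N; rewrite big_ord0.
have [->|sn0] := eqVneq (s (3 * n)) 0.
  by rewrite expr0n mulr0 mulr_ge0 ?sqr_ge0.
have sp k : (k < (3 * n).+1)%N -> 0 < s k.
  move=> kn; apply: lt_le_trans (singular_value_ninc (m := k) (n := 3 * n) kn).
  by rewrite lt_def sn0 singular_value_ge0.
have [_ _ /(_ (3 * n).+1 sp)[u [ou uP]]] := singular_value_vectors TS.
(* The [2 n] conditions: [n] of them against the [g k], and [n] against the [S (f j)], which say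
   that the image under [T] is orthogonal to [f j]. *)
pose x j := if (j < n)%N then g j else S (f (j - n)).
have [|w [ow wP]] := @orthonormal_subframe _ _ _ (2 * n) n.+1 u x ou.
  by rewrite addnS (mulSn 2 n) addnC.
have wg i k : (i < n.+1)%N -> (k < n)%N -> inner (w i) (g k) = 0.
  move=> iN kn; have [_ /(_ k)] := wP i iN; rewrite /x kn; apply.
  by rewrite (leq_trans kn)// leq_pmull.
have wS i j : (i < n.+1)%N -> (j < n)%N -> inner (w i) (S (f j)) = 0.
  move=> iN jn; have [_ /(_ (n + j)%N)] := wP i iN.
  rewrite [x (n + j)%N]/x [(n + j < n)%N]ltnNge leq_addr/= addKn; apply.
  by rewrite mul2n -addnn ltn_add2l.
(* The part of [S (f j)] visible from the [w i]: it pairs with them as [S (f j)] does, but its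
   coordinates vanish as soon as one index is below [n]. *)
pose y j := if (j < n)%N then 0 else
  S (f j) - \sum_(k < n) inner (S (f j)) (g k) *: g k.
have wy i j : (i < n.+1)%N -> inner (w i) (S (f j)) = inner (w i) (y j).
  move=> iN; rewrite /y; case: ifPn => jn; first by rewrite wS// inner0r.
  rewrite innerBr inner_sumr big1 ?subr0// => k _.
  by rewrite innerZr wg ?mulr0.
have yg j k : inner (y j) (g k) =
    if (j < n)%N || (k < n)%N then 0 else inner (S (f j)) (g k).
  rewrite /y; case: ifPn => jn /=; first by rewrite inner0l.
  rewrite innerBl; case: ifPn => kn.
    rewrite (inner_sum_orthonormal (hb_orthonormal hg n) (fun k => inner (S (f j)) (g k)))//.
    by rewrite subrr.
  rewrite inner_suml big1 ?subr0// => l _; rewrite innerZl.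
  rewrite (hb_orthonormal hg (maxn n k).+1)//.
  - by case: eqP kn => [<-|]; rewrite ?ltn_ord ?mulr0.
  - by rewrite (leq_trans (ltn_ord l))// (leq_trans (leq_maxl _ k)).
  - by rewrite ltnS leq_maxr.
apply: (@le_trans _ _ (\sum_(i < n.+1) sqn (T (w i)))).
  rewrite -[leLHS]/(_ * _) mulr_natl -[X in _ *+ X]card_ord -sumr_const.
  apply: ler_sum => i _; have [[a wE] _] := wP i (ltn_ord i).
  by apply: singular_span_lower ou uP wE _; exact: (sqn_orthonormal ow).
apply: (hb_sum_le hf (x := T \o w)) => J; rewrite exchange_big/=.
apply: (@le_trans _ _ (\sum_(j < J) sqn (y j))).
  apply: ler_sum => j _; apply: le_trans (bessel ow (y j)).
  by apply: ler_sum => i _; rewrite TS wy// csq_innerC.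
(* The vectors [w i] are gone; what remains is the square sum of the matrix over indices at least
   [n], where both factors are bounded by their values at [n]. *)
apply: (hb_sum_le hg) => m; rewrite exchange_big/=.
apply: (@le_trans _ _ (\sum_(k < m | (n <= k)%N) (alpha n * beta n) ^+ 2 * sqn (b k))).
  rewrite [leRHS]big_mkcond; apply: ler_sum => k _; case: leqP => kn; last first.
    by rewrite big1// => j _; rewrite yg kn orbT csq0.
  apply: (@le_trans _ _ (\sum_(j < J) (alpha n * beta n) ^+ 2 * csq (inner (b k) (f j)))).
    apply: ler_sum => j _; rewrite yg [(k < n)%N]ltnNge kn orbF.
    case: ltnP => jn; first by rewrite csq0 mulr_ge0 ?sqr_ge0 ?csq_ge0.
    rewrite csq_innerC -TS tE csqM csq_real ler_wpM2r ?csq_ge0//.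
    by rewrite lerXn2r ?nnegrE ?mulr_ge0// ler_pM ?ha ?hb.
  rewrite -mulr_sumr ler_wpM2l ?sqr_ge0//.
  exact: bessel (hb_orthonormal hf J) _.
by rewrite -mulr_sumr ler_wpM2l ?sqr_ge0.
Qed.

End hilbert_schmidt.

(** * Schatten estimates for products with diagonal operators *)

Section diagonal_action.
Context (R : realType) (H : preHilbertType R[i]) (f : nat -> H) (J N : nat).
Hypothesis of_ : orthonormal J f.
Implicit Types (c : nat -> R) (y : 'I_N -> H) (V : 'M[R[i]]_N).

(** Truncated to the first [J] basis vectors; [c = 1] gives the orthogonal projection onto their
    span. *)
Definition diag_op c (z : H) : H := \sum_(j < J) ((c j)%:C%C * inner z (f j)) *: f j.

Lemma diag_op_coord c z j : (j < J)%N -> inner (diag_op c z) (f j) = (c j)%:C%C * inner z (f j).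
Proof. exact: (inner_sum_orthonormal of_ (fun j => (c j)%:C%C * inner z (f j))). Qed.

Lemma diag_op_comp c d z : diag_op c (diag_op d z) = diag_op (fun j => c j * d j) z.
Proof.
apply: eq_bigr => j _; rewrite diag_op_coord// mulrA; congr ((_ * _) *: _).
by rewrite rmorphM.
Qed.

Lemma diag_op_mix c V y i : diag_op c (mix V y i) = mix V (diag_op c \o y) i.
Proof.
rewrite /mix /diag_op; under [RHS]eq_bigr => l _ do rewrite scaler_sumr.
rewrite exchange_big/=; apply: eq_bigr => j _.
rewrite inner_suml mulr_sumr scaler_suml; apply: eq_bigr => l _.
by rewrite innerZl scalerA mulrCA.
Qed.

Lemma sqn_diag_op c z : sqn (diag_op c z) = \sum_(j < J) c j ^+ 2 * csq (inner z (f j)).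
Proof.
rewrite /diag_op (sqn_sum_orthonormal of_ (fun j => (c j)%:C%C * inner z (f j))).
by apply: eq_bigr => j _; rewrite csqM csq_real.
Qed.

(** The squared moduli of the entries of [V] are doubly stochastic, and orthogonality of the rotated
    family writes each [sqn (y l)] as the corresponding average of its squared norms. *)
Lemma mix_power_sum V y k : V \is unitarymx -> 0 < k -> k <= 1 ->
  (forall i j, i != j -> inner (mix V y i) (mix V y j) = 0) ->
  \sum_i sqn (mix V y i) `^ k <= \sum_l sqn (y l) `^ k.
Proof.
move=> uV k0 k1 oV; rewrite -[leLHS]mul1r -[leRHS]mul1r.
apply: (weighted_power_sum (w := fun l i => csq (V i l))) => //.
- by move=> i; exact: sqn_ge0.
- by move=> l i; exact: csq_ge0.
- move=> l; rewrite -[y l](mixVK y l uV) sqn_sum_orthogonal//.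
  by apply: ler_sum => i _; rewrite !mxE csq_conj mulrC.
- by move=> l; rewrite unitarymx_col_csq.
- by move=> i; rewrite unitarymx_row_csq.
Qed.

(* Hölder's inequality for [diag_op c] with exponents [1/k' = 1/k + 1/p], the
   sums running over squared norms.  The orthogonality of the family before
   [diag_op c] is applied gives [sqn (diag_op c x) `^ p] the weights of a
   substochastic matrix, which needs [p >= 1]; the one after it needs [k' <= 1]. *)
Lemma diag_op_hoelder c y V k p k' A B :
  0 < k -> 1 <= p -> 0 < k' -> k' <= 1 -> k'^-1 = k^-1 + p^-1 -> 0 <= A -> 0 <= B ->
  V \is unitarymx -> (forall i j, i != j -> inner (mix V y i) (mix V y j) = 0) ->
  \sum_i sqn (mix V y i) `^ k <= A `^ k ->
  \sum_(j < J) (c j ^+ 2) `^ p <= B `^ p ->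
  exists W, [/\ W \is unitarymx,
    forall i j, i != j -> inner (mix W (diag_op c \o y) i) (mix W (diag_op c \o y) j) = 0 &
    \sum_i sqn (mix W (diag_op c \o y) i) `^ k' <= (A * B) `^ k'].
Proof.
move=> k0 p1 k'0 k'1 kE A0 B0 uV oV VA cB.
have p0 : 0 < p by apply: lt_le_trans p1.
have [W [uW oW]] := unitary_orthogonalization (diag_op c \o mix V y).
have WV i : mix (W *m V) (diag_op c \o y) i = mix W (diag_op c \o mix V y) i.
  by rewrite -mix_mul; apply: eq_bigr => l _; rewrite /= diag_op_mix.
exists (W *m V); split; first exact: mul_unitarymx.
  by move=> i j ij; rewrite !WV oW.
under eq_bigr do rewrite WV.
apply: le_trans (mix_power_sum uW k'0 k'1 oW) _ => /=.
set x := mix V y in oV VA *.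
(* Squared cosines between [x l] and the unit vector [f j]: sums over [j] are at most 1 by Bessel's
   inequality for [f], sums over [l] by Bessel's inequality for the orthogonal family [x]. *)
pose w l j := csq (inner (x l) (f j)) / sqn (x l).
have w0 l j : 0 <= w l j by rewrite divr_ge0 ?csq_ge0 ?sqn_ge0.
pose eta l := \sum_(j < J) c j ^+ 2 * w l j.
have eta0 l : 0 <= eta l by apply: sumr_ge0 => j _; rewrite mulr_ge0 ?sqr_ge0.
have xE l : sqn (diag_op c (x l)) = sqn (x l) * eta l.
  rewrite sqn_diag_op mulr_sumr; apply: eq_bigr => j _.
  have [x0|x0] := eqVneq (sqn (x l)) 0; last by rewrite /w; field.
  by rewrite (sqn_eq0 x0) sqn0 inner0l csq0 mulr0 mul0r.
have etaB : \sum_l eta l `^ p <= B `^ p.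
  apply: (@le_trans _ _ (\sum_l \sum_(j < J) (c j ^+ 2) `^ p * w l j)).
    apply: ler_sum => l _; apply: (@jensen_convex _ _ p (fun j : 'I_J => c j ^+ 2) (w l)) => //.
      by move=> j; exact: sqr_ge0.
    rewrite -mulr_suml; have [x0|x0] := eqVneq (sqn (x l)) 0.
      by rewrite x0 invr0 mulr0 ler01.
    by rewrite ler_pdivrMr ?mul1r ?lt_def ?x0 ?sqn_ge0//; exact: bessel.
  rewrite exchange_big/=; apply: le_trans cB; apply: ler_sum => j _.
  rewrite -mulr_sumr ler_piMr ?powR_ge0//.
  apply: le_trans (_ : sqn (f j) <= 1); last by rewrite (sqn_orthonormal of_).
  apply: le_trans (bessel_orthogonal (f j) oV).
  by apply: ler_sum => l _; rewrite /w csq_innerC.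
have kk : k' / k + k' / p = 1 by rewrite -mulrDr -kE divff ?gt_eqF.
have kp : 1 - k' / k = k' / p by rewrite -kk addrC addKr.
have t0 : 0 <= k' / k by rewrite divr_ge0// ltW.
have t1 : k' / k <= 1 by rewrite -kk lerDl divr_ge0// ltW.
have a0 l : 0 <= sqn (x l) `^ k by exact: powR_ge0.
have b0 l : 0 <= eta l `^ p by exact: powR_ge0.
have := hoelder_sum t0 t1 a0 b0.
rewrite kp; under [leLHS]eq_bigr do rewrite -!powRrM ![_ * (_ / _)]mulrC !divfK ?gt_eqF//
  -powRM ?sqn_ge0// -xE.
move=> /le_trans; apply.
rewrite powRM//.
have -> : A `^ k' = (A `^ k) `^ (k' / k) by rewrite -powRrM mulrC divfK ?gt_eqF.
have -> : B `^ k' = (B `^ p) `^ (k' / p) by rewrite -powRrM mulrC divfK ?gt_eqF.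
rewrite ler_pM ?powR_ge0// ge0_ler_powR ?nnegrE ?powR_ge0//.
- by apply: sumr_ge0.
- by rewrite divr_ge0// ltW.
- by apply: sumr_ge0.
Qed.

(* For [p < 1], split [beta] into [m] equal powers with [m p >= 1] and apply
   [diag_op_hoelder] to them one after the other. *)
Lemma diag_op_schatten (beta : nat -> R) (a : 'I_N -> H) k p k' A B :
  0 < k -> k <= 1 -> 0 < p -> 0 < k' -> k'^-1 = k^-1 + p^-1 -> 0 <= A -> 0 <= B ->
  (forall j, 0 <= beta j) ->
  \sum_l sqn (a l) `^ k <= A `^ k ->
  \sum_(j < J) (beta j ^+ 2) `^ p <= B `^ p ->
  exists W, W \is unitarymx /\
    \sum_i sqn (mix W (diag_op beta \o a) i) `^ k' <= (A * B) `^ k'.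
Proof.
move=> k0 k1 p0 k'0 kE A0 B0 b0 aA bB.
have [m' m'p] : exists m' : nat, p^-1 <= m'.+1%:R.
  exists (Num.truncn p^-1); rewrite ltW// truncnS_gt//.
set m := m'.+1 in m'p.
have m0 : 0 < m%:R :> R by rewrite ltr0n.
have mp : 1 <= m%:R * p by rewrite -ler_pdivrMr// mul1r.
pose d j := beta j `^ m%:R^-1.
pose b := B `^ m%:R^-1.
have dm j : d j ^+ m = beta j.
  by rewrite -powR_mulrn ?powR_ge0// -powRrM mulVf ?gt_eqF// powRr1.
have bm : b ^+ m = B.
  by rewrite -powR_mulrn ?powR_ge0// -powRrM mulVf ?gt_eqF// powRr1.
have dB : \sum_(j < J) (d j ^+ 2) `^ (m%:R * p) <= b `^ (m%:R * p).
  rewrite [leRHS]powRrM powR_mulrn ?powR_ge0// bm.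
  under eq_bigr do rewrite powRrM powR_mulrn ?sqr_ge0// -exprM mulnC exprM dm.
  exact: bB.
(* The exponent after [i] of the [m] steps: it starts at [k], each step adds [1 / (m p)] to its
   inverse, and [e m = k']. *)
pose e i := (k^-1 + i%:R / (m%:R * p))^-1.
have e0 i : 0 < e i.
  by rewrite invr_gt0 ltr_wpDr ?invr_gt0// divr_ge0// mulr_ge0// ltW.
have e1 i : e i <= 1.
  have kV : 1 <= k^-1 by rewrite invf_ge1.
  rewrite invf_le1 ?ler_wpDr// ?divr_ge0 ?mulr_ge0 ?(ltW m0) ?(ltW p0)//.
  by rewrite ltr_wpDr ?invr_gt0// divr_ge0// mulr_ge0// ltW.
have main i : exists W, [/\ W \is unitarymx,
    forall l l', l != l' -> inner (mix W (diag_op (fun j => d j ^+ i) \o a) l)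
       (mix W (diag_op (fun j => d j ^+ i) \o a) l') = 0 &
    \sum_l sqn (mix W (diag_op (fun j => d j ^+ i) \o a) l) `^ e i <= (A * b ^+ i) `^ e i].
  elim: i => [|i [V [uV oV VA]]].
    (* The power 0 is the truncation alone, which decreases norms; the first rotation makes the
       truncated columns orthogonal. *)
    have [W [uW oW]] := unitary_orthogonalization (diag_op (fun j => d j ^+ 0) \o a).
    exists W; split => //; apply: le_trans (mix_power_sum uW _ _ oW) _ => //.
    rewrite /e mul0r addr0 invrK expr0 mulr1; apply: le_trans aA.
    apply: ler_sum => l _; rewrite ge0_ler_powR ?nnegrE ?sqn_ge0 ?(ltW k0)//.
    rewrite sqn_diag_op; apply: le_trans (bessel of_ (a l)).
    by apply: ler_sum => j _; rewrite expr0 expr1n mul1r.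
  have eE : (e i.+1)^-1 = (e i)^-1 + (m%:R * p)^-1.
    by rewrite /e !invrK -addrA -natr1 mulrDl mul1r.
  have Ab0 : 0 <= A * b ^+ i by rewrite mulr_ge0// exprn_ge0// powR_ge0.
  have [W [uW oW WA]] := diag_op_hoelder (e0 i) mp (e0 i.+1) (e1 i.+1) eE Ab0
    (powR_ge0 _ _) uV oV VA dB.
  have E : diag_op d \o (diag_op (fun j => d j ^+ i) \o a) =
      diag_op (fun j => d j ^+ i.+1) \o a.
    apply/funext => l /=; rewrite diag_op_comp; congr diag_op.
    by apply/funext => j; rewrite exprS.
  by exists W; rewrite -E exprSr mulrA.
have [W [uW _ WA]] := main m; exists W; split=> //; move: WA; rewrite bm.
have -> : e m = k'.
  by rewrite /e -[RHS]invrK kE invfM mulrA divff ?gt_eqF// mul1r.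
by under [X in diag_op X]funext do rewrite dm.
Qed.

End diagonal_action.

(** * From power sums of rotated columns to power sums of singular values *)

Section schatten_estimate.
Context (R : realType) (H1 H2 : preHilbertType R[i]).
Variables (T : H1 -> H2) (S : H2 -> H1) (g : nat -> H1) (f : nat -> H2).
Hypothesis TS : forall u v, inner (T u) v = inner u (S v).
Hypothesis hg : hilbert_basis g.
Hypothesis hf : hilbert_basis f.

Local Notation s := (singular_value T).

Lemma sqnD_le_eps (H : preHilbertType R[i]) (u v : H) (r : R) : 0 < r ->
  sqn (u + v) <= (1 + r) * sqn u + (1 + r^-1) * sqn v.
Proof.
move=> r0; rewrite sqnD -subr_ge0.
have := sqn_ge0 (r%:C%C *: u - v); rewrite sqnD sqnN sqnZ csq_real innerNr innerZl.
have -> : Re (- (r%:C%C * inner u v)) = - (r * Re (inner u v)).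
  by case: (inner u v) => x y /=; ring.
move=> h; rewrite (_ : _ - _ = r^-1 * (r ^+ 2 * sqn u + sqn v + 2 * - (r * Re (inner u v)))).
  by rewrite mulr_ge0// invr_ge0 ltW.
by field; rewrite gt_eqF.
Qed.

(** The Hilbert-Schmidt norm dominates the operator norm, here that of the adjoint. *)
Lemma hilbert_schmidt_adjoint_bound M w : (forall N, \sum_(l < N) sqn (T (g l)) <= M) ->
  sqn (S w) <= M * sqn w.
Proof.
move=> TM; apply: (hb_le hg) => N.
apply: (@le_trans _ _ (\sum_(l < N) sqn (T (g l)) * sqn w)).
  by apply: ler_sum => l _; rewrite csq_innerC -TS cauchy_schwarz.
by rewrite -mulr_suml ler_wpM2r ?sqn_ge0.
Qed.

Local Notation Q J := (@diag_op R H2 f J (fun=> 1)).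

Lemma diag_op1 J z : Q J z = \sum_(j < J) inner z (f j) *: f j.
Proof. by apply: eq_bigr => j _; rewrite mul1r. Qed.

Lemma diag_op1_sym J z z' : inner (Q J z) z' = inner z (Q J z').
Proof.
rewrite !diag_op1 inner_suml inner_sumr; apply: eq_bigr => j _.
by rewrite innerZl innerZr mulrC [inner z' _]inner_conj conjCK.
Qed.

Lemma finite_eventually n (P : nat -> nat -> Prop) :
  (forall i, (i < n)%N -> \forall k \near \oo, P i k) ->
  exists k, forall i, (i < n)%N -> P i k.
Proof.
move=> h; have : \forall k \near \oo, forall i, (i < n)%N -> P i k.
  elim: n h => [|n ih] h; first by near=> k.
  have := h n (ltnSn n); have := ih (fun i ilt => h i (ltnW ilt)).
  apply: filterS2 => k h1 h2 i; rewrite ltnS leq_eqVlt => /predU1P[->//|].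
  exact: h1.
by case=> k _ /(_ k (leqnn k)); exists k.
Unshelve. all: by end_near. Qed.

Section one_epsilon.
Variables (n : nat) (u : nat -> H1) (M k A r : R).
Hypothesis sp : forall i, (i < n)%N -> 0 < s i.
Hypothesis ou : orthonormal n u.
Hypothesis uP : forall i, (i < n)%N -> S (T (u i)) = (s i ^+ 2)%:C%C *: u i.
Hypothesis TM : forall N, \sum_(l < N) sqn (T (g l)) <= M.
Hypothesis k0 : 0 < k.
Hypothesis k1 : k <= 1.
Hypothesis TA : forall J N, exists V : 'M[R[i]]_N, V \is unitarymx /\
  \sum_i sqn (mix V (fun l => Q J (T (g l))) i) `^ k <= A.

(* Truncating at a large [J], [z i := S (Q J v) / s i], where [v] is the left
   singular vector, differs little from [u i]; the [z i] are therefore almost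
   orthonormal, which is what [weighted_power_sum] asks for. *)
Lemma schatten_estimate_eps : 0 < r -> r < 1 ->
  (1 - 3 * r) * \sum_(i < n) (s i ^+ 2) `^ k <= (1 + 2 * r) * A.
Proof.
move=> r0 r1.
have M0 : 0 <= M by have := TM 0%N; rewrite big_ord0.
have M1 : 0 < M + 1 by rewrite ltr_wpDl.
pose v i := (s i)^-1%:C%C *: T (u i).
have Sv i : (i < n)%N -> S (v i) = (s i)%:C%C *: u i.
  move=> ilt; rewrite /v (adjointZ (fun u v => adjoint_sym TS v u)) uP// scalerA -rmorphM/=.
  by rewrite expr2 mulKf// gt_eqF// sp.
have ov : orthonormal n v.
  move=> i j ilt jlt; rewrite {1}/v innerZl TS Sv// innerZr conj_real ou//.
  have [->|_] := eqVneq i j; last by rewrite !mulr0.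
  by rewrite mulr1 -rmorphM/= mulVf ?gt_eqF// sp.
pose eta J i := (s i)^-1%:C%C *: S (Q J (v i) - v i).
(* Chosen so that the [n] errors, weighted by the factor [1 + r^-1] of [csqD_le_eps], add up to at
   most [r]; [n + 1] covers [n = 0]. *)
pose e := r / ((1 + r^-1) * (n%:R + 1)).
have c0 : 0 < (1 + r^-1) * (n%:R + 1).
  by apply: mulr_gt0; [rewrite addr_gt0 ?invr_gt0 | rewrite natr1 ltr0n].
have e0 : 0 < e by rewrite divr_gt0.
have [J etaJ] : exists J, forall i, (i < n)%N -> sqn (eta J i) <= e.
  apply: (finite_eventually (P := fun i J => sqn (eta J i) <= e)) => i ilt.
  (* The division by [s i] in [eta] and the norm of [S] are compensated here; [M + 1] covers
     [M = 0]. *)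
  pose d := e * s i ^+ 2 / (M + 1).
  have d0 : 0 < d by apply: divr_gt0 => //; apply: mulr_gt0 => //; rewrite exprn_gt0 ?sp.
  have := hb_tail hf (v i) => /cvgr_lt /(_ _ d0); apply: filterS => J hJ.
  rewrite /eta sqnZ csq_real exprVn mulrC ler_pdivrMr ?exprn_gt0 ?sp//.
  apply: le_trans (hilbert_schmidt_adjoint_bound _ TM) _.
  rewrite -sqnN opprB diag_op1.
  apply: (@le_trans _ _ ((M + 1) * d)).
    by rewrite ler_pM ?sqn_ge0 ?(ltW hJ)// lerDl.
  by rewrite /d mulrC divfK ?gt_eqF// ltr_wpDl.
pose z i := u i + eta J i.
have zE i : (i < n)%N -> S (Q J (v i)) = (s i)%:C%C *: z i.
  move=> ilt; rewrite /z /eta scalerDr scalerA -rmorphM/= mulfV ?gt_eqF ?sp//.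
  have SD w w' : S (w - w') = S w - S w'.
    by apply: inner_ext => x; rewrite -TS !innerBr !TS.
  by rewrite scale1r SD Sv// addrC subrK.
have etaS : (1 + r^-1) * \sum_(i < n) sqn (eta J i) <= r.
  apply: (@le_trans _ _ ((1 + r^-1) * (n%:R * e))).
    rewrite ler_wpM2l ?addr_ge0 ?invr_ge0 ?(ltW r0)//.
    rewrite mulr_natl -[X in _ *+ X]card_ord -sumr_const.
    by apply: ler_sum => i _; exact: etaJ.
  have {2}-> : r = (1 + r^-1) * ((n%:R + 1) * e) by rewrite mulrA /e mulrC divfK// gt_eqF.
  rewrite ler_wpM2l ?addr_ge0 ?invr_ge0 ?(ltW r0)//.
  by rewrite ler_wpM2r ?(ltW e0)// lerDl.
have z1 i : (i < n)%N -> 1 - 2 * r <= sqn (z i).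
  move=> ilt; have := sqnD_le_eps (z i) (- eta J i) r0.
  rewrite addrK (sqn_orthonormal ou)// sqnN.
  have : (1 + r^-1) * sqn (eta J i) <= r.
    apply: le_trans etaS; rewrite ler_wpM2l ?addr_ge0 ?invr_ge0 ?(ltW r0)//.
    rewrite (bigD1 (Ordinal ilt))//= lerDl; apply: sumr_ge0 => j _; exact: sqn_ge0.
  have := sqn_ge0 (z i); nra.
(* Truncating to [N] coordinates costs one more [r] below the norm bound [1 - 2 r]. *)
have [N zN] : exists N, forall i, (i < n)%N ->
    1 - 3 * r <= \sum_(l < N) csq (inner (z i) (g l)).
  apply: (finite_eventually (P := fun i N => 1 - 3 * r <= \sum_(l < N) csq (inner (z i) (g l)))).
  move=> i ilt; have lt : 1 - 3 * r < sqn (z i) by have := z1 i ilt; lra.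
  by have := hb_parseval hg (z i) => /cvgr_gt /(_ _ lt); apply: filterS => N /ltW.
have [V [uV VA]] := TA J N.
pose h i := mix V (fun l => g l) i.
suff /le_trans : (1 - 3 * r) * \sum_(i < n) (s i ^+ 2) `^ k <=
    (1 + 2 * r) * \sum_i sqn (mix V (fun l => Q J (T (g l))) i) `^ k.
  by apply; rewrite ler_wpM2l// addr_ge0// mulr_ge0// ltW.
apply: (@weighted_power_sum _ _ _ k (fun i : 'I_n => s i ^+ 2) _
  (fun l i => csq (inner (h l) (z i)))) => //.
- by move=> i; exact: sqr_ge0.
- by move=> l i; exact: csq_ge0.
(* Moving [Q J T] across the inner product turns [s i * inner (h l) (z i)] into the coefficient of
   the truncated column along the left singular vector [v i]. *)
- move=> l; apply: le_trans (bessel ov _); apply: ler_sum => i _.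
  rewrite -csq_real -csqM le_eqVlt; apply/orP; left; apply/eqP; congr csq.
  rewrite !inner_mix mulr_sumr; apply: eq_bigr => j _.
  rewrite mulrCA; congr (_ * _).
  by rewrite diag_op1_sym TS zE// innerZr conj_real.
- move=> l.
  have h1 : sqn (h l) = 1.
    rewrite sqn_sum_orthogonal => [|i j ij]; last first.
      by rewrite (hb_orthonormal hg N)// (inj_eq val_inj) (negPf ij).
    rewrite -(unitarymx_row_csq l uV); apply: eq_bigr => i _.
    by rewrite (sqn_orthonormal (hb_orthonormal hg N))// mulr1.
  apply: (@le_trans _ _ (\sum_(i < n) ((1 + r) * csq (inner (h l) (u i)) +
      (1 + r^-1) * csq (inner (h l) (eta J i))))).
    by apply: ler_sum => i _; rewrite innerDr; exact: csqD_le_eps.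
  rewrite big_split/= -!mulr_sumr.
  have b1 : \sum_(i < n) csq (inner (h l) (u i)) <= 1 by rewrite -h1; exact: bessel ou _.
  have b2 : (1 + r^-1) * \sum_(i < n) csq (inner (h l) (eta J i)) <= r.
    apply: le_trans etaS; rewrite ler_wpM2l ?addr_ge0 ?invr_ge0 ?(ltW r0)//.
    apply: ler_sum => i _; rewrite -[leRHS]mul1r -h1; exact: cauchy_schwarz.
  nra.
- move=> i; apply: le_trans (zN i (ltn_ord i)) _.
  rewrite le_eqVlt; apply/orP; left; apply/eqP.
  under [RHS]eq_bigr do rewrite inner_mix.
  rewrite (sum_csq_mix (fun l : 'I_N => inner (g l) (z i)))//.
  by apply: eq_bigr => l _; rewrite csq_innerC.
- by rewrite lerDl mulr_ge0// ltW.
Qed.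

End one_epsilon.

Lemma schatten_estimate (M k A : R) n :
  (forall N, \sum_(l < N) sqn (T (g l)) <= M) -> 0 < k -> k <= 1 ->
  (forall J N, exists V : 'M[R[i]]_N, V \is unitarymx /\
    \sum_i sqn (mix V (fun l => Q J (T (g l))) i) `^ k <= A) ->
  \sum_(i < n) (s i ^+ 2) `^ k <= A.
Proof.
move=> TM k0 k1 TA; elim: n => [|n ih].
  have [V [_]] := TA 0%N 0%N; by rewrite !big_ord0.
(* Singular vectors are available only for positive singular values; a vanishing last value adds
   nothing, since [k > 0]. *)
have [sn|sn] := eqVneq (s n) 0.
  by rewrite big_ord_recr/= sn expr0n/= powR0 ?gt_eqF// addr0.
have sp i : (i < n.+1)%N -> 0 < s i.
  move=> ilt; apply: lt_le_trans (singular_value_ninc TS (m := i) (n := n) ilt).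
  by rewrite lt_def sn (singular_value_ge0 TS).
have [_ _ /(_ n.+1 sp)[u [ou uP]]] := singular_value_vectors TS.
have A0 : 0 <= A.
  by have [V [_]] := TA 0%N 0%N; rewrite !big_ord0.
set X := \sum_(i < n.+1) _.
have X0 : 0 <= X by apply: sumr_ge0 => i _; exact: powR_ge0.
apply/ler_addgt0Pr => e e0.
(* With [r = e / c] the error [r * (3 X + 2 A)] is at most [e], and [r < 1]. *)
pose c := 3 * X + 2 * A + e + 1.
have c0 : 0 < c by rewrite /c; lra.
have r0 : 0 < e / c by rewrite divr_gt0.
have r1 : e / c < 1 by rewrite ltr_pdivrMr// mul1r /c; lra.
have := schatten_estimate_eps sp ou uP TM k0 k1 TA r0 r1; rewrite -/X.
have : e / c * c = e by rewrite divfK// gt_eqF.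
move: r0; set r := e / c; rewrite /c; nra.
Qed.

End schatten_estimate.

(** * Inverses of operators with positive discrete spectrum *)

Section norm_topology.
Context (R : realType) (H : preHilbertType R[i]).

Lemma normr_le_sqn (u : H) (r : R) : 0 <= r -> (`|u| <= r%:C%C) = (sqn u <= r ^+ 2).
Proof.
move=> r0; rewrite -(@ler_pXn2r _ 2)// ?nnegrE ?lecR// normr_sqn -rmorphXn lecR.
by [].
Qed.

Lemma normr_lt_sqn (u : H) (r : R) : 0 <= r -> (`|u| < r%:C%C) = (sqn u < r ^+ 2).
Proof.
move=> r0; rewrite -(@ltr_pXn2r _ 2)// ?nnegrE ?lecR// normr_sqn -rmorphXn ltcR.
by [].
Qed.

Lemma cvg_sqnP (F : set_system H) (FF : Filter F) (a : H) :
  F --> a <-> forall e : R, 0 < e -> F [set v | sqn (a - v) < e].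
Proof.
split=> [/cvgrPdist_lt Fa e e0|h].
  have s0 : (0 : R[i]) < (Num.sqrt e)%:C%C by rewrite ltcR sqrtr_gt0.
  have := Fa _ s0; apply: filterS => v /=.
  by rewrite normr_lt_sqn// sqr_sqrtr// ltW.
apply/cvgrPdist_lt => -[x y]; rewrite ltcE /= => /andP[/eqP -> x0].
have := h (x ^+ 2) (exprn_gt0 _ x0); apply: filterS => v /=.
by rewrite -normr_lt_sqn// ltW.
Qed.

Lemma orthonormal_basis_hb (e : nat -> H) : orthonormal_basis e -> hilbert_basis e.
Proof.
move=> [oe ce]; have on n : orthonormal n e by move=> i j _ _; exact: oe.
split=> // u; apply/cvgrPdist_lt => r r0.
have /cvg_sqnP/(_ r r0) cu := ce u.
have : \forall n \near \oo, sqn (u - \sum_(0 <= k < n) inner u (e k) *: e k) < r by exact: cu.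
apply: filterS => n /=.
rewrite big_mkord sqn_sub_proj// => h.
by rewrite ger0_norm// subr_ge0; exact: bessel.
Qed.

End norm_topology.

Section singular_value_uniqueness.
Local Open Scope card_scope.
Context (R : realType) (H1 H2 : preHilbertType R[i]) (T : H1 -> H2).

(** Two enumerations give the value [t k] the same finite multiplicity. If they agree before [k] and
    [s k < t k], the indices where [s] takes that value all lie before [k], hence also belong to the
    level set of [t], which has [k] in addition. *)
Let singular_values_lt (s t : nat -> R) k : is_singular_values T s ->
  is_singular_values T t -> (forall j, (j < k)%N -> s j = t j) -> ~ s k < t k.
Proof.
move=> [hs s0 sP] [ht t0 tP] st stk.
have tk0 : 0 < t k by apply: le_lt_trans stk.
have [n [sd sn]] := sP _ tk0; have [m [td tm]] := tP _ tk0.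
have nm := has_dim_uniq sd td; rewrite -{}nm in tm.
have fs : finite_set [set j | s j = t k] by apply/finite_setP; exists n.
have ft : finite_set [set j | t j = t k] by apply/finite_setP; exists n.
have uk : uniq (k :: finmap.enum_fset (fset_set [set j | s j = t k])).
  rewrite /= finmap.fset_uniq andbT in_fset_set// notin_setE/= => E.
  by move: stk; rewrite E ltxx.
have := @uniq_leq_size _ _ (finmap.enum_fset (fset_set [set j | t j = t k])) uk.
rewrite /= (card_fset_set sn) (card_fset_set tm) ltnn => h; apply/notF/h => j.
rewrite inE => /orP[/eqP ->|]; rewrite !in_fset_set// !inE//= => sj.
rewrite -st//; rewrite ltnNge; apply/negP => /hs; rewrite sj.
by rewrite leNgt stk.
Qed.

Lemma singular_values_uniq (s t : nat -> R) : is_singular_values T s ->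
  is_singular_values T t -> s = t.
Proof.
move=> sP tP; apply/funext => k; elim/ltn_ind: k => k ih.
case: (ltgtP (s k) (t k)) => // st; exfalso.
  exact: singular_values_lt sP tP ih st.
by apply: singular_values_lt tP sP _ st => j jk; rewrite ih.
Qed.

End singular_value_uniqueness.

Section inverse_of_positive_operator.
Local Open Scope card_scope.
Context (R : realType) (H : preHilbertType R[i]) (E : set (H * H)) (lam : nat -> R).
Hypothesis sE : essentially_self_adjoint E.
Hypothesis pE : positive_eigenvalues (closure E) lam.
Hypothesis fl : forall x, finite_set [set j | lam j <= x].

Let A := closure E.

(** The eigenvalue relation is stated weakly, against the basis, which is how it acts on slices of a
    kernel. The inverse is positive, hence its own modulus on the basis. *)
Lemma eigenbasis_inverse : exists e : nat -> H, [/\ hilbert_basis e,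
  forall u v, E (u, v) -> forall k, inner v (e k) = (lam k)%:C%C * inner u (e k) &
  singular_value (op_inv (closure E)) = fun k => (lam k)^-1].
Proof.
have [_ _ [_ _ AA]] := sE.
have [[lam0 lamh] spE _ [e [/orthonormal_basis_hb he eA]]] := pE.
have Asym q p : A q -> A p -> inner q.2 p.1 = inner q.1 p.2.
  by move=> Aq; rewrite /A AA; exact.
exists e; split=> // [u v Euv k|].
  have := Asym (u, v) _ (subset_closure Euv) (eA k).
  by rewrite /= innerZr conj_real.
have [S [lS cS SA]] : resolvent_set A 0.
  apply: contrapT => r0; have : spectrum A 0 by [].
  rewrite spE => -[n _ [/eqP]]; by rewrite gt_eqF.
have {}SA u v : A (u, v) <-> u = S v by rewrite SA scale0r subr0.
have -> : op_inv (closure E) = S.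
  apply/funext => v; apply: xget_unique; first exact/SA.
  by move=> u /SA.
pose d k := (lam k)^-1.
have d0 k : 0 < d k by rewrite invr_gt0.
have SD w w' : S (w + w') = S w + S w' by rewrite -[w in LHS]scale1r lS scale1r.
have SZ a w : S (a *: w) = a *: S w.
  have S00 : S 0 = 0 by apply: (addrI (S 0)); rewrite -SD !addr0.
  by rewrite -[a *: w]addr0 lS S00 addr0.
have symS u v : inner (S u) v = inner u (S v).
  have ASu w : A (S w, w) by apply/SA.
  by have := Asym _ _ (ASu u) (ASu v).
have Se k : S (e k) = (d k)%:C%C *: e k.
  have /SA := eA k; rewrite SZ => {2}->.
  by rewrite scalerA -rmorphM/= mulVf ?scale1r ?gt_eqF.
have Ske u k : inner (S u) (e k) = (d k)%:C%C * inner u (e k).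
  by rewrite symS Se innerZr conj_real.
have posS u : 0 <= inner (S u) u.
  have i0 : Im (inner (S u) u) = 0.
    have : inner (S u) u = Num.conj (inner (S u) u) by rewrite {1}symS inner_conj.
    by case: (inner (S u) u) => x y /= [] /=; lra.
  (* Positivity of [inner (S u) u] from Parseval's identity for norms alone: the inequality holds
     coordinate by coordinate, and expanding the right side leaves twice the real part. *)
  have : sqn (S u) + sqn u <= sqn (S u + u).
    apply: (ler_cvg_to (cvgD (hb_parseval he (S u)) (hb_parseval he u)) (hb_parseval he (S u + u))).
    apply: nearW => n; rewrite -[leLHS]/(_ + _) -big_split/=; apply: ler_sum => k _.
    rewrite innerDl Ske -{4}[inner u _]mul1r -mulrDl !csqM -(rmorphD _ _ 1) !csq_real.
    rewrite -{2}[csq (inner u _)]mul1r -mulrDl ler_wpM2r ?csq_ge0//.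
    by have := d0 k; nra.
  rewrite sqnD lecE i0 eqxx/=; lra.
have adjS : adjoint S = S by exact: adjoint_eq.
have exP : exists P : H -> H, [/\ linear P, continuous P,
    forall u, 0 <= inner (P u) u & forall u, P (P u) = adjoint S (S u)].
  by exists S; split=> // u; rewrite adjS.
have [lP _ P0 PP] : [/\ linear (modulus S), continuous (modulus S),
    forall u, 0 <= inner (modulus S u) u & forall u, modulus S (modulus S u) = adjoint S (S u)] :=
  xgetPex _ exP.
set P := modulus S in lP P0 PP.
have symP := positive_symmetric lP P0.
have PZ a w : P (a *: w) = a *: P w by exact: (adjointZ symP).
have PD w w' : P (w + w') = P w + P w' by rewrite -[w in LHS]scale1r lP scale1r.
have Pe k : P (e k) = (d k)%:C%C *: e k.
  (* Uniqueness of the positive square root: [P (P (e k)) = d ^ 2 e_k] gives [P w = - d w], which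
     positivity forbids unless [w = 0]. *)
  pose w := P (e k) + (- (d k)%:C%C) *: e k.
  have Pw : P w = (- (d k)%:C%C) *: w.
    rewrite /w PD PZ PP adjS Se SZ Se scalerDr addrC !scalerA; congr (_ + _).
    by congr (_ *: _); ring.
  have := P0 w; rewrite Pw innerZl innerxx -rmorphN -rmorphM lecR mulNr oppr_ge0.
  have := sqn_ge0 w; rewrite le_eqVlt => /predU1P[/esym/sqn_eq0/eqP|w0].
    by rewrite /w scaleNr subr_eq0 => /eqP.
  by rewrite leNgt mulr_gt0.
have Pke u k : inner (P u) (e k) = (d k)%:C%C * inner u (e k).
  by rewrite symP Pe innerZr conj_real.
have dS : is_singular_values S d.
  split=> [m n mn|k|c c0]; [by rewrite lef_pV2 ?posrE// lamh|exact: ltW|].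
  have fL : finite_set [set k | d k = c].
    apply: sub_finite_set (fl c^-1) => k /= <-.
    by rewrite /d invrK.
  set L : seq nat := finmap.enum_fset (fset_set [set k | d k = c]).
  have LP k : (k \in L) = (d k == c).
    by rewrite in_fset_set//; apply/idP/eqP; rewrite inE.
  exists (size L); split; last first.
    rewrite -[X in X #= _](fset_setK fL); exact/card_eq_fsetP.
  pose eps (i : 'I_(size L)) := e (nth 0%N L i).
  have oeps i j : inner (eps i) (eps j) = (i == j)%:R.
    rewrite /eps (hb_orthonormal he (maxn (nth 0%N L i) (nth 0%N L j)).+1) ?ltnS ?leq_maxl ?leq_maxr//.
    by rewrite nth_uniq// finmap.fset_uniq.
  have sum_eps (a : 'I_(size L) -> R[i]) i : inner (\sum_j a j *: eps j) (eps i) = a i.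
    rewrite inner_suml (bigD1 i)//= innerZl oeps eqxx mulr1 big1 ?addr0// => j ji.
    by rewrite innerZl oeps (negPf ji) mulr0.
  exists eps; split=> [a a0 i|]; first by rewrite -(sum_eps a i) a0 inner0l.
  apply/seteqP; split=> [u /= Pu|_ /= [a _ <-]].
    exists (fun i => inner u (eps i)) => //; apply: (hb_ext he) => k.
    have [kL|kL] := boolP (k \in L).
      have kL' : (index k L < size L)%N by rewrite index_mem.
      have -> : e k = eps (Ordinal kL') by rewrite /eps /= nth_index.
      exact: (sum_eps (fun i => inner u (eps i))).
    rewrite inner_suml big1 => [|i _]; last first.
      rewrite innerZl /eps (hb_orthonormal he (maxn (nth 0%N L i) k).+1) ?ltnS ?leq_maxl ?leq_maxr//.
      case: eqP => [ik|_]; last by rewrite mulr0.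
      by move: kL; rewrite -ik mem_nth.
    have := Pke u k; rewrite /P Pu innerZl => /eqP.
    rewrite -subr_eq0 -mulrBl mulf_eq0 -rmorphB => /orP[/eqP[/eqP]|/eqP //].
    by rewrite subr_eq0 eq_sym -LP (negPf kL).
  rewrite -/P (adjoint_sum symP) scaler_sumr; apply: eq_bigr => i _.
  rewrite Pe scalerA mulrC -scalerA; congr (_%:C%C *: _).
  by apply/eqP; rewrite -LP mem_nth.
by apply: xget_unique => // t tS; exact: singular_values_uniq tS dS.
Qed.

End inverse_of_positive_operator.

(** * Decay of eigenvalues and singular values *)

Section eigenvalue_growth.
Context (R : realType) (lam : nat -> R) (C p : R).
Hypothesis C0 : 0 < C.
Hypothesis p0 : 0 < p.
Hypothesis lamp : forall n, 0 < lam n.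
Hypothesis lamh : {homo lam : m n / (m <= n)%N >-> m <= n}.
Hypothesis lamC : counting_bound lam C p.

(** The bound is assumed at positive arguments only, hence the comparison with [|x| + 1]. *)
Lemma counting_bound_finite x : finite_set [set j | lam j <= x].
Proof.
have y0 : 0 < `|x| + 1 by rewrite ltr_wpDl.
have fy : finite_set [set j | lam j <= `|x| + 1].
  apply: contrapT => nf; have := lamC y0.
  by rewrite /eigen_count /counting asboolF// leye_eq.
apply: sub_finite_set fy => j /= /le_trans; apply.
by rewrite (le_trans (ler_norm x))// lerDl.
Qed.

(** At [x = lam n] at least [n + 1] eigenvalues are counted. The factor [1 + (lam 0)^-1] absorbs the
    1 in [1 + lam n]. *)
Lemma counting_bound_decay : exists c : R, 0 <= c /\
  forall n, (lam n)^-1 <= c * n.+1%:R `^ (- p^-1).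
Proof.
exists ((1 + (lam 0)^-1) * C `^ p^-1); split.
  by rewrite mulr_ge0 ?powR_ge0// addr_ge0// invr_ge0 ltW.
move=> n; have fn := counting_bound_finite (lam n).
have cn : n.+1%:R <= C * (1 + lam n) `^ p.
  have := lamC (lamp n); rewrite /eigen_count /counting asboolT// lee_fin.
  apply: le_trans; rewrite ler_nat -[leqLHS](size_iota 0).
  apply: uniq_leq_size (iota_uniq 0 n.+1) _ => j.
  rewrite mem_iota /= add0n ltnS => jn.
  by rewrite in_fset_set// inE /=; exact: lamh.
have l1 : 0 <= 1 + lam n by rewrite addr_ge0// ltW.
have pi0 : 0 <= p^-1 by rewrite invr_ge0 ltW.
have : n.+1%:R `^ p^-1 <= C `^ p^-1 * (1 + lam n).
  have := ge0_ler_powR pi0 (ler0n _ _ : n.+1%:R \is Num.nneg) _ cn.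
  rewrite nnegrE mulr_ge0 ?powR_ge0 ?(ltW C0)// => /(_ isT).
  by rewrite powRM ?powR_ge0 ?(ltW C0)// -powRrM divff ?gt_eqF// powRr1.
have n0 : 0 < n.+1%:R `^ p^-1 :> R by rewrite powR_gt0.
rewrite powRN => h; rewrite ler_pdivlMr// mulrC ler_pdivrMr//.
apply: le_trans h _; rewrite -mulrA mulrCA ler_wpM2l ?powR_ge0// mulrDl mul1r addrC lerD2l mulrC ler_pdivlMr// mul1r.
exact: lamh.
Qed.

End eigenvalue_growth.

Section power_series_tails.
Context (R : realType).

Lemma bounded_sum_tail (x : nat -> R) M d : (forall k, 0 <= x k) ->
  (forall m, \sum_(k < m) x k <= M) -> 0 < d ->
  exists N, forall n m, (N <= n)%N -> \sum_(k < m | (n <= k)%N) x k <= d.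
Proof.
move=> x0 xM d0; pose u m := \sum_(k < m) x k.
have und : nondecreasing_seq u.
  apply/nondecreasing_seqP => n; by rewrite /u big_ord_recr/= lerDl.
have cu : cvgn u.
  by apply: nondecreasing_is_cvgn => //; exists M => _ [m _ <-]; exact: xM.
have uL m : u m <= limn u by exact: nondecreasing_cvgn_le.
have : limn u - d < limn u by rewrite ltrBlDr ltrDl.
move=> /(cvgr_gt _ cu) [N _ /(_ N (leqnn N)) uN].
exists N => n m Nn.
have h : u n + \sum_(k < m | (n <= k)%N) x k <= limn u.
  apply: le_trans (uL (n + m)%N).
  rewrite [in leRHS]/u (bigID (fun k : 'I_(n + m) => (k < n)%N))/= lerD//.
    by rewrite /u (big_ord_widen (n + m) x) ?leq_addr.
  under [leRHS]eq_bigl do rewrite -leqNgt.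
  rewrite (big_ord_widen_cond (n + m) (fun k => n <= k)%N x) ?leq_addl//.
  rewrite [leLHS]big_mkcond [leRHS]big_mkcond; apply: ler_sum => k _.
  by case: (n <= k)%N => //=; case: ifP.
have := und _ _ Nn; rewrite /= in uN *; lra.
Qed.

(** Cauchy condensation: the dyadic blocks are dominated by a geometric series of ratio
    [2 ^ (1 - a) < 1]. *)
Lemma dirichlet_sum_bounded (a : R) : 1 < a -> exists M, forall n,
  \sum_(k < n) k.+1%:R `^ (- a) <= M.
Proof.
move=> a1; pose x : R := 2 `^ (1 - a).
have x0 : 0 < x by rewrite powR_gt0.
have x1 : x < 1.
  by rewrite /x /powR gt_eqF// expR_lt1 pmulr_llt0 ?subr_lt0// ln_gt0 ?ltr1n.
have pos (k : nat) : 0 <= k.+1%:R `^ (- a) :> R by exact: powR_ge0.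
have key n : \sum_(k < 2 ^ n) k.+1%:R `^ (- a) <= 1 + \sum_(i < n) x ^+ i.
  elim: n => [|n ih]; first by rewrite expn0 big_ord1 big_ord0 addr0 powR1.
  rewrite expnS mul2n -addnn big_split_ord/= [in leRHS]big_ord_recr/= addrA lerD//.
  apply: (@le_trans _ _ (\sum_(k < 2 ^ n) (2 ^ n)%:R `^ (- a))).
    apply: ler_sum => k _; rewrite !powRN lef_pV2 ?posrE ?powR_gt0 ?ltr0n ?expn_gt0//.
    rewrite ge0_ler_powR ?nnegrE// ?ler_nat ?(ltW (lt_trans ltr01 a1))//.
    by rewrite -addnS leq_addr.
  rewrite sumr_const card_ord -[X in X <= _]mulr_natl.
  have -> : (2 ^ n)%:R * (2 ^ n)%:R `^ (- a) = (2 ^ n)%:R `^ (1 - a) :> R.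
    by rewrite powRD ?powRr1// pnatr_eq0 expn_eq0 implybT.
  by rewrite -(powR_mulrn n (ltW x0)) /x -powRrM mulrC powRrM powR_mulrn// natrX.
have mono m n : (m <= n)%N -> \sum_(k < m) k.+1%:R `^ (- a) <= \sum_(k < n) k.+1%:R `^ (- a) :> R.
  move=> mn; rewrite (big_ord_widen n (fun k => k.+1%:R `^ (- a)) mn).
  by rewrite [leLHS]big_mkcond; apply: ler_sum => k _; case: ifP.
exists (1 + (1 - x)^-1) => n.
apply: le_trans (mono _ _ (ltnW (ltn_expl n (ltnSn 1)))) _.
apply: le_trans (key n) _; rewrite lerD2l.
have : (1 - x) * \sum_(i < n) x ^+ i = 1 - x ^+ n.
  elim: {key} n => [|n ih]; first by rewrite big_ord0 expr0 subrr mulr0.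
  by rewrite big_ord_recr/= mulrDr ih exprS; ring.
move=> h; rewrite -[leRHS]mulr1 mulrC ler_pdivlMr ?subr_gt0// mulrC h.
by rewrite gerBl exprn_ge0// ltW.
Qed.

End power_series_tails.

Section schatten_sums.
Context (R : realType) (H1 H2 : preHilbertType R[i]) (T : H1 -> H2).
Hypothesis s0 : forall k, 0 <= singular_value T k.

Lemma schatten_norm_le r A : 0 < r -> 0 <= A ->
  (forall n, \sum_(k < n) singular_value T k `^ r <= A `^ r) ->
  (schatten_norm r T <= A%:E)%E.
Proof.
move=> r0 A0 sA; rewrite /schatten_norm.
have h : (\sum_(0 <= k <oo) (singular_value T k `^ r)%:E <= (A `^ r)%:E)%E.
  apply: lime_le; first by apply: is_cvg_nneseries => n _ _; rewrite lee_fin powR_ge0.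
  by apply: nearW => n; rewrite sumEFin lee_fin big_mkord.
apply: (@le_trans _ _ ((A `^ r)%:E `^ r^-1)%E).
  apply: gt0_ler_poweR; rewrite ?invr_ge0 ?(ltW r0)// in_itv/= ?leey ?andbT ?lee_fin ?powR_ge0//.
  by apply: nneseries_ge0 => n _ _; rewrite lee_fin powR_ge0.
by rewrite poweR_EFin -powRrM divff ?gt_eqF// powRr1.
Qed.

Lemma schatten_norm_ge r : 0 < r -> (schatten_norm r T < +oo)%E ->
  exists A, [/\ 0 <= A, schatten_norm r T = A%:E &
    forall n, \sum_(k < n) singular_value T k `^ r <= A `^ r].
Proof.
move=> r0; rewrite /schatten_norm; set S := (\sum_(0 <= k <oo) _)%E => Sfin.
have S0 : (0 <= S)%E by apply: nneseries_ge0 => n _ _; rewrite lee_fin powR_ge0.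
have Sy : (S < +oo)%E by apply: lty_poweRy Sfin; rewrite gt_eqF// invr_gt0.
have SE : S = (fine S)%:E by rewrite fineK// ge0_fin_numE.
have fS0 : 0 <= fine S by exact: fine_ge0.
exists (fine S `^ r^-1); split; [exact: powR_ge0|by rewrite {1}SE poweR_EFin|move=> n].
rewrite -powRrM mulVf ?gt_eqF// powRr1// -lee_fin -SE -sumEFin -(big_mkord xpredT (fun k => (singular_value T k `^ r)%:E)).
by apply: nneseries_lim_ge => k _ _; rewrite lee_fin powR_ge0.
Qed.

Lemma littleo_schatten (a r : R) : 0 < r -> r^-1 < a ->
  singular_value T =o_\oo (fun k => k.+1%:R `^ (- a)) -> (schatten_norm r T < +oo)%E.
Proof.
move=> r0 ra /eqoP /(_ 1 ltr01) [N _ hN].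
have ra1 : 1 < a * r by rewrite -ltr_pdivrMr// mul1r.
have [M hM] := dirichlet_sum_bounded ra1.
have M0 : 0 <= M by have := hM 0%N; rewrite big_ord0.
pose B := \sum_(k < N) singular_value T k `^ r.
have B0 : 0 <= B by apply: sumr_ge0 => k _; exact: powR_ge0.
have sB n : \sum_(k < n) singular_value T k `^ r <= B + M.
  apply: (@le_trans _ _ (\sum_(k < N + n) singular_value T k `^ r)).
    rewrite (big_ord_widen (N + n) (fun k => singular_value T k `^ r)) ?leq_addl//.
    by rewrite [leLHS]big_mkcond; apply: ler_sum => k _; case: ifP => // _; exact: powR_ge0.
  rewrite big_split_ord/= lerD//.
  apply: le_trans (hM (N + n)%N); rewrite big_split_ord/= ler_wpDl//.
    by apply: sumr_ge0 => k _; exact: powR_ge0.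
  apply: ler_sum => k _; rewrite -mulNr powRrM ge0_ler_powR ?nnegrE ?powR_ge0 ?(ltW r0)//.
  have := hN (N + k)%N (leq_addr _ _); rewrite /= mul1r !ger0_norm ?powR_ge0//.
apply: (@le_lt_trans _ _ ((B + M) `^ r^-1)%:E); last by rewrite ltry.
apply: schatten_norm_le => //; first exact: powR_ge0.
by move=> n; rewrite -powRrM mulVf ?gt_eqF// powRr1// addr_ge0.
Qed.

End schatten_sums.

Section singular_value_decay.
Context (R : realType) (H1 H2 : preHilbertType R[i]).
Variables (T : H1 -> H2) (S : H2 -> H1) (g : nat -> H1) (f : nat -> H2).
Hypothesis TS : forall u v, inner (T u) v = inner u (S v).
Hypothesis hg : hilbert_basis g.
Hypothesis hf : hilbert_basis f.

Lemma singular_value_littleo (b : nat -> H2) (alpha beta : nat -> R) (M ca cb x y : R) :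
  (forall k, 0 <= alpha k) -> {homo alpha : i j / (i <= j)%N >-> j <= i} ->
  (forall k, 0 <= beta k) -> {homo beta : i j / (i <= j)%N >-> j <= i} ->
  (forall k j, inner (T (g k)) (f j) = (alpha k * beta j)%:C%C * inner (b k) (f j)) ->
  (forall m, \sum_(k < m) sqn (b k) <= M) ->
  0 <= ca -> 0 <= cb -> 0 <= x -> 0 <= y ->
  (forall n, alpha n <= ca * n.+1%:R `^ (- x)) ->
  (forall n, beta n <= cb * n.+1%:R `^ (- y)) ->
  singular_value T =o_\oo (fun k => k.+1%:R `^ (- (2^-1 + x + y))).
Proof.
move=> a0 ha b0 hb tE bM ca0 cb0 x0 y0 ac bc; apply/eqoP => e e0.
pose z := 2^-1 + x + y.
have z0 : 0 <= z by rewrite !addr_ge0.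
pose c := ca * cb * 3 `^ z.
have c0 : 0 <= c by rewrite !mulr_ge0 ?powR_ge0.
pose d := e / (c + 1).
have c1 : 0 < c + 1 by rewrite ltr_wpDl.
have d0 : 0 < d by rewrite divr_gt0.
have [N hN] := bounded_sum_tail (fun k => sqn_ge0 (b k)) bM (exprn_gt0 2 d0).
exists (3 * N)%N => // k /= Nk.
(* The tail estimate only controls indices [3 n]; monotonicity covers the rest, and
   [k + 1 <= 3 (n + 1)] costs the factor [3 ^ z]. *)
pose n := (k %/ 3)%N.
have Nn : (N <= n)%N by rewrite leq_divRL// mulnC.
have nk : (3 * n <= k)%N by rewrite mulnC leq_divM.
have kn : (k.+1 <= 3 * n.+1)%N by rewrite mulnC ltn_ceil.
have s0 := singular_value_ge0 TS.
rewrite !ger0_norm ?powR_ge0// -/z.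
apply: le_trans (singular_value_ninc TS nk) _.
have tail := singular_value_tail TS hg hf a0 ha b0 hb tE (fun m => hN n m Nn).
set s := singular_value T (3 * n) in tail *.
have n0 : 0 < n.+1%:R :> R by rewrite ltr0n.
have ss0 : 0 <= s := s0 _.
have sn : s <= ca * cb * d * n.+1%:R `^ (- z).
  rewrite -(@ler_pXn2r _ 2)// ?nnegrE ?ss0 ?mulr_ge0 ?powR_ge0 ?invr_ge0 ?(ltW c1) ?(ltW e0)//.
  (* The exponent [1/2] comes from the factor [n + 1] on the left of the tail estimate, the little-o
     from the small tail [d ^ 2]. *)
  have -> : n.+1%:R `^ (- z) = n.+1%:R `^ (- x) * n.+1%:R `^ (- y) * n.+1%:R `^ (- 2^-1) :> R.
    have nz : n.+1%:R != 0 :> R by rewrite gt_eqF.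
    have -> : - z = - x - y - 2^-1 by rewrite /z; ring.
    by rewrite !powRD ?nz ?implybT.
  set nx := n.+1%:R `^ (- x); set ny := n.+1%:R `^ (- y).
  have -> : (ca * cb * d * (nx * ny * n.+1%:R `^ (- 2^-1))) ^+ 2 =
      ((ca * nx) * (cb * ny)) ^+ 2 * d ^+ 2 * n.+1%:R^-1.
    have -> : n.+1%:R^-1 = (n.+1%:R `^ (- 2^-1)) ^+ 2 :> R.
      by rewrite -powR_mulrn ?powR_ge0// -powRrM mulNr mulVf// powR_inv1// ltW.
    ring.
  rewrite ler_pdivlMr// mulrC; apply: le_trans tail _.
  rewrite ler_wpM2r ?sqr_ge0// lerXn2r ?nnegrE ?mulr_ge0 ?powR_ge0//.
  by rewrite ler_pM.
apply: le_trans sn _.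
have kz : n.+1%:R `^ (- z) <= 3 `^ z * k.+1%:R `^ (- z) :> R.
  rewrite !powRN ler_pdivlMr ?powR_gt0 ?ltr0n// mulrC ler_pdivrMr ?powR_gt0//.
  rewrite -powRM// ge0_ler_powR ?nnegrE// -natrM ler_nat.
  exact: kn.
apply: (@le_trans _ _ (c * d * k.+1%:R `^ (- z))).
  rewrite /c [ca * cb * 3 `^ z * d]mulrAC -[leRHS]mulrA.
  by rewrite ler_wpM2l ?mulr_ge0 ?invr_ge0 ?(ltW c1) ?(ltW e0).
rewrite ler_wpM2r ?powR_ge0// /d mulrCA ler_piMr ?(ltW e0)//.
by rewrite ler_pdivrMr// mul1r lerDl.
Qed.

End singular_value_decay.

(** * Square integrable functions and kernels *)

Section complex_measurable.
Context d (T : measurableType d) (R : realType).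
Implicit Types f g : T -> R[i].

Lemma cmeasurable_cst (a : R[i]) : cmeasurable (cst a : T -> R[i]).
Proof. by split; exact: measurable_cst. Qed.

Lemma cmeasurableD f g : cmeasurable f -> cmeasurable g -> cmeasurable (fun x => f x + g x).
Proof.
move=> [fr fi] [gr gi]; split.
  rewrite (_ : _ \o _ = (Re \o f) \+ (Re \o g)); first exact: measurable_funD.
  by apply/funext => x /=; case: (f x) (g x) => a b [].
rewrite (_ : _ \o _ = (Im \o f) \+ (Im \o g)); first exact: measurable_funD.
by apply/funext => x /=; case: (f x) (g x) => a b [].
Qed.

Lemma cmeasurableM f g : cmeasurable f -> cmeasurable g -> cmeasurable (fun x => f x * g x).
Proof.
move=> [fr fi] [gr gi]; split.
  rewrite (_ : _ \o _ = (fun x => (Re \o f) x * (Re \o g) x - (Im \o f) x * (Im \o g) x)).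
    by apply: measurable_funB; apply: measurable_funM.
  by apply/funext => x /=; case: (f x) (g x) => a b [].
rewrite (_ : _ \o _ = (fun x => (Re \o f) x * (Im \o g) x + (Im \o f) x * (Re \o g) x)).
  by apply: measurable_funD; apply: measurable_funM.
by apply/funext => x /=; case: (f x) (g x) => a b [].
Qed.

Lemma cmeasurable_conj f : cmeasurable f -> cmeasurable (fun x => Num.conj (f x)).
Proof.
move=> [fr fi]; split.
  by rewrite (_ : _ \o _ = Re \o f)//; apply/funext => x /=; case: (f x).
rewrite (_ : _ \o _ = \- (Im \o f)); first exact: measurableT_comp.
by apply/funext => x /=; case: (f x).
Qed.

Lemma measurable_csq f : cmeasurable f -> measurable_fun setT (fun x => csq (f x)).
Proof. by case=> mr mi; apply: measurable_funD; apply: measurable_funX. Qed.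

Lemma measurable_csqE f : cmeasurable f -> measurable_fun setT (fun x => (csq (f x))%:E).
Proof. by move=> mf; apply/measurable_EFinP; exact: measurable_csq. Qed.

End complex_measurable.

Section square_integrable_classes.
Context d (T : measurableType d) (R : realType) (mu : {measure set T -> \bar R}).
Implicit Types (f g : T -> R[i]) (u v w : L2 mu).

Lemma ae_eq_cintegral f g : cmeasurable f -> cmeasurable g ->
  {ae mu, forall x, f x = g x} -> cintegral mu f = cintegral mu g.
Proof.
move=> [fr fi] [gr gi] fg.
rewrite /cintegral; congr Complex; congr fine; apply: ae_eq_integral => //;
  try (by apply/measurable_EFinP);
  by move: fg; apply: filterS => x -> _.
Qed.

Lemma sqint_le f g c : cmeasurable f -> sqint mu g -> 0 <= c ->
  {ae mu, forall x, csq (f x) <= c * csq (g x)} -> sqint mu f.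
Proof.
move=> mf [mg ig] c0 fg; split=> //.
apply: (@le_lt_trans _ _ (\int[mu]_x (c%:E * (csq (g x))%:E))%E).
  apply: ae_ge0_le_integral => //.
  - by move=> x _; rewrite lee_fin csq_ge0.
  - exact: measurable_csqE.
  - by move=> x _; rewrite -EFinM lee_fin mulr_ge0 ?csq_ge0.
  - by apply: measurable_funeM; exact: measurable_csqE.
  by move: fg; apply: filterS => x h _; rewrite -EFinM lee_fin.
rewrite ge0_integralZl//; last 2 first.
- exact: measurable_csqE.
- by move=> x _; rewrite lee_fin csq_ge0.
by rewrite lte_mul_pinfty// lee_fin.
Qed.

Lemma sqint_conj f : sqint mu f -> sqint mu (fun x => Num.conj (f x)).
Proof.
move=> sf; have [mf _] := sf; apply: (sqint_le (cmeasurable_conj mf) sf ler01).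
by apply: aeW => x; rewrite csq_conj mul1r.
Qed.

Lemma sqintZ a f : sqint mu f -> sqint mu (fun x => a * f x).
Proof.
move=> sf; have [mf _] := sf.
apply: (sqint_le (cmeasurableM (cmeasurable_cst T a) mf) sf (csq_ge0 a)).
by apply: aeW => x; rewrite csqM.
Qed.

Lemma sqint_repr u : sqint mu (repr u).
Proof. exact: sqfunP. Qed.

Lemma toL2_repr f : sqint mu f -> {ae mu, forall x, repr (toL2 mu f) x = f x}.
Proof.
move=> sf; have fP : f \in sqint_pred mu by rewrite inE.
have := L2_reprK (insubd (0 : sqfun mu) f); apply: filterS => x ->.
by rewrite -[in RHS](insubdK (0 : sqfun mu) fP).
Qed.

Lemma L2_ext u v : {ae mu, forall x, repr u x = repr v x} -> u = v.
Proof. by move=> uv; rewrite -[u]reprK -[v]reprK; exact/L2_eqP. Qed.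

Lemma toL2_eq f g : sqint mu f -> sqint mu g -> {ae mu, forall x, f x = g x} ->
  toL2 mu f = toL2 mu g.
Proof.
move=> sf sg fg; apply: L2_ext; have := toL2_repr sf; have := toL2_repr sg.
by apply: filterS3 fg => x <- -> ->.
Qed.

Lemma toL2K u : toL2 mu (repr u) = u.
Proof. by apply: L2_ext; apply: toL2_repr; exact: sqint_repr. Qed.

Lemma repr_scale a u : {ae mu, forall x, repr (a *: u) x = a * repr u x}.
Proof. by have := L2_reprK (a *: repr u); apply: filterS => x ->. Qed.

Lemma repr_add u v : {ae mu, forall x, repr (u + v) x = repr u x + repr v x}.
Proof.
have := L2_reprK (repr u + repr v); rewrite raddfD/= !reprK.
by apply: filterS => x ->.
Qed.

Lemma toL2Z a f : sqint mu f -> toL2 mu (fun x => a * f x) = a *: toL2 mu f.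
Proof.
move=> sf; apply: L2_ext; have := toL2_repr (sqintZ a sf); have := toL2_repr sf.
by apply: filterS3 (repr_scale a (toL2 mu f)) => x -> -> ->.
Qed.

Lemma L2_innerE u v : inner u v = cintegral mu (fun x => repr u x * Num.conj (repr v x)).
Proof. by []. Qed.

Lemma inner_toL2 f g : sqint mu f -> sqint mu g ->
  inner (toL2 mu f) (toL2 mu g) = cintegral mu (fun x => f x * Num.conj (g x)).
Proof.
move=> sf sg; rewrite L2_innerE; apply: ae_eq_cintegral.
- by apply: cmeasurableM; [|apply: cmeasurable_conj]; have [] := sqint_repr (toL2 mu f);
    have [] := sqint_repr (toL2 mu g).
- by apply: cmeasurableM; [|apply: cmeasurable_conj]; have [] := sf; have [] := sg.
by apply: filterS2 (toL2_repr sf) (toL2_repr sg) => x -> ->.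
Qed.

Lemma sqn_repr u : (sqn u)%:E = (\int[mu]_x (csq (repr u x))%:E)%E.
Proof.
have [mu_ fu] := sqint_repr u.
have -> : sqn u = fine (\int[mu]_x (csq (repr u x))%:E).
  rewrite /sqn L2_innerE /=; congr fine; apply: eq_integral => x _.
  by rewrite csqE.
rewrite fineK// ge0_fin_numE//; apply: integral_ge0 => x _.
by rewrite lee_fin csq_ge0.
Qed.

Lemma sqn_toL2 f : sqint mu f -> (sqn (toL2 mu f))%:E = (\int[mu]_x (csq (f x))%:E)%E.
Proof.
move=> sf; rewrite sqn_repr; apply: ae_eq_integral => //.
- by apply: measurable_csqE; have [] := sqint_repr (toL2 mu f).
- by apply: measurable_csqE; have [] := sf.
by have := toL2_repr sf; apply: filterS => x -> _.
Qed.

(** Turns the bilinear pairing of an integral operator into an inner product. *)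
Definition L2_conj u : L2 mu := toL2 mu (fun x => Num.conj (repr u x)).

Lemma repr_conj u : {ae mu, forall x, repr (L2_conj u) x = Num.conj (repr u x)}.
Proof. exact: toL2_repr (sqint_conj (sqint_repr u)). Qed.

Lemma L2_conjK u : L2_conj (L2_conj u) = u.
Proof.
apply: L2_ext; have := repr_conj (L2_conj u); have := repr_conj u.
by apply: filterS2 => x -> ->; rewrite conjCK.
Qed.

Lemma inner_L2_conj u v : inner (L2_conj u) (L2_conj v) = inner v u.
Proof.
rewrite inner_toL2; [|exact: sqint_conj (sqint_repr _)..].
rewrite L2_innerE; congr cintegral; apply/funext => x.
by rewrite conjCK mulrC.
Qed.

Lemma L2_conjZ a u : L2_conj (a *: u) = Num.conj a *: L2_conj u.
Proof.
have h : {ae mu, forall x, repr (L2_conj (a *: u)) x = Num.conj (a * repr u x)}.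
  by apply: filterS2 (repr_conj (a *: u)) (repr_scale a u) => x -> ->.
apply: L2_ext; apply: filterS3 h (repr_conj u) (repr_scale (Num.conj a) (L2_conj u)).
by move=> x -> h ->; rewrite h rmorphM.
Qed.

Lemma L2_conj_hb (e : nat -> L2 mu) : hilbert_basis e -> hilbert_basis (L2_conj \o e).
Proof.
move=> he; split=> [n i j ilt jlt|u].
  by rewrite /= inner_L2_conj (hb_orthonormal he n)// eq_sym.
have -> : sqn u = sqn (L2_conj u) by rewrite /sqn inner_L2_conj.
rewrite (_ : (fun n => _) = fun n => \sum_(k < n) csq (inner (L2_conj u) (e k))).
  exact: hb_parseval.
apply/funext => n; apply: eq_bigr => k _ /=.
by rewrite -[u in LHS]L2_conjK inner_L2_conj csq_innerC.
Qed.

End square_integrable_classes.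

Section kernels.
Context dx dy (X : measurableType dx) (Y : measurableType dy) (R : realType).
Variables (m : {sigma_finite_measure set X -> \bar R}).
Variables (n : {sigma_finite_measure set Y -> \bar R}).
Implicit Types (K G : X * Y -> R[i]) (u : L2 n) (v : L2 m).

Lemma measurable_slice_integral (k : X * Y -> R) : measurable_fun setT k ->
  measurable_fun setT (fun x => \int[n]_y k (x, y)).
Proof.
move=> mk; rewrite /Rintegral.
apply: (measurableT_comp (f := fine)) => //.
have mE : measurable_fun setT (EFin \o k) by exact/measurable_EFinP.
rewrite (_ : (fun x => _) = (fun x => \int[n]_y ((EFin \o k) ^\+ (x, y)))
    \- (fun x => \int[n]_y ((EFin \o k) ^\- (x, y))))%E.
  apply: emeasurable_funB; apply: (@measurable_fun_fubini_tonelli_F _ _ _ _ _ n).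
  - exact: measurable_funepos.
  - by move=> ?; exact: funepos_ge0.
  - exact: measurable_funeneg.
  - by move=> ?; exact: funeneg_ge0.
apply/funext => x; rewrite [LHS]integralE.
under eq_integral do rewrite (funepos_comp (EFin \o k) (pair x))/=.
by under [X in (_ - X)%E]eq_integral do rewrite (funeneg_comp (EFin \o k) (pair x))/=.
Qed.

Lemma cmeasurable_slice_integral K : cmeasurable K ->
  cmeasurable (fun x => cintegral n (fun y => K (x, y))).
Proof.
move=> [mr mi]; split.
  exact: (measurable_slice_integral mr).
exact: (measurable_slice_integral mi).
Qed.

Lemma cmeasurable_slice K x : cmeasurable K -> cmeasurable (fun y => K (x, y)).
Proof. by move=> [mr mi]; split; apply: (measurableT_comp (f := _ \o K)). Qed.

Lemma measurable_tonelli K : cmeasurable K ->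
  measurable_fun setT (fun x => \int[n]_y (csq (K (x, y)))%:E)%E.
Proof.
move=> mK; apply: (@measurable_fun_fubini_tonelli_F _ _ _ _ _ n (fun p => (csq (K p))%:E)).
  exact: measurable_csqE.
by move=> p; rewrite lee_fin csq_ge0.
Qed.

Lemma tonelli_csq K : cmeasurable K ->
  (\int[m \x n]_p (csq (K p))%:E = \int[m]_x \int[n]_y (csq (K (x, y)))%:E)%E.
Proof.
move=> mK; rewrite (@fubini_tonelli1 _ _ _ _ _ m n (fun p => (csq (K p))%:E))//.
  exact: measurable_csqE.
by move=> p; rewrite lee_fin csq_ge0.
Qed.

Lemma ae_sqint_slice K : sqint (m \x n)%E K -> {ae m, forall x, sqint n (fun y => K (x, y))}.
Proof.
move=> [mK iK]; have iE : (m \x n)%E.-integrable setT (fun p => (csq (K p))%:E).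
  apply/integrableP; split; first exact: measurable_csqE.
  by under eq_integral do rewrite gee0_abs ?lee_fin ?csq_ge0//.
have := ae_integrable1 iE; apply: filterS => x /integrableP[_].
under eq_integral do rewrite gee0_abs ?lee_fin ?csq_ge0//.
by split=> //; exact: cmeasurable_slice.
Qed.

(** The function of which [integral_op m K u] is the class; pointwise arguments in [x] need the
    function. *)
Definition slice_pairing K u (x : X) : R[i] := cintegral n (fun y => K (x, y) * repr u y).

Lemma cmeasurable_slice_pairing K u : cmeasurable K -> cmeasurable (slice_pairing K u).
Proof.
move=> mK; apply: (@cmeasurable_slice_integral (fun p => K p * repr u p.2)).
apply: cmeasurableM => //; have [[ur ui] _] := sqint_repr u.
by split; [apply: (measurableT_comp (f := Re \o repr u))|apply: (measurableT_comp (f := Im \o repr u))].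
Qed.

Lemma slice_pairingE K u x : sqint n (fun y => K (x, y)) ->
  slice_pairing K u x = inner (toL2 n (fun y => K (x, y))) (L2_conj u).
Proof.
move=> sK; rewrite inner_toL2//; last exact: sqint_conj (sqint_repr u).
by congr cintegral; apply/funext => y; rewrite conjCK.
Qed.

Lemma sqint_slice_pairing K u : sqint (m \x n)%E K -> sqint m (slice_pairing K u).
Proof.
move=> sK; have [mK iK] := sK; split; first exact: cmeasurable_slice_pairing.
apply: (@le_lt_trans _ _ (\int[m]_x ((sqn u)%:E * \int[n]_y (csq (K (x, y)))%:E))%E).
  apply: ae_ge0_le_integral => //.
  - by move=> x _; rewrite lee_fin csq_ge0.
  - by apply: measurable_csqE; exact: cmeasurable_slice_pairing.
  - move=> x _; rewrite mule_ge0 ?lee_fin ?sqn_ge0//.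
    by apply: integral_ge0 => y _; rewrite lee_fin csq_ge0.
  - by apply: measurable_funeM; exact: measurable_tonelli.
  have := ae_sqint_slice sK; apply: filterS => x sx _.
  rewrite -[sqmod _ x]/(csq _) slice_pairingE// -sqn_toL2// -EFinM lee_fin.
  apply: le_trans (cauchy_schwarz _ _) _.
  by rewrite [sqn (L2_conj u)]/sqn inner_L2_conj mulrC.
rewrite ge0_integralZl//; last 3 first.
- exact: measurable_tonelli.
- by move=> x _; apply: integral_ge0 => y _; rewrite lee_fin csq_ge0.
- by rewrite lee_fin sqn_ge0.
by rewrite -tonelli_csq// lte_mul_pinfty// lee_fin sqn_ge0.
Qed.

(** Bessel's inequality for almost every slice [K (x, -)], integrated over [x]. *)
Lemma integral_op_hilbert_schmidt K (e : nat -> L2 n) N : sqint (m \x n)%E K -> orthonormal N e ->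
  ((\sum_(k < N) sqn (integral_op m K (L2_conj (e k))))%:E <=
   \int[m \x n]_p (csq (K p))%:E)%E.
Proof.
move=> sK oe; have [mK iK] := sK.
have sT u := sqint_slice_pairing u sK.
have mT u : measurable_fun setT (fun x => (csq (slice_pairing K u x))%:E).
  by apply: measurable_csqE; exact: cmeasurable_slice_pairing.
rewrite -sumEFin; under eq_bigr do rewrite (sqn_toL2 (sT _)).
rewrite -ge0_integral_sum//; last by move=> k x _; rewrite lee_fin csq_ge0.
rewrite tonelli_csq//; apply: ae_ge0_le_integral => //.
- by move=> x _; apply: sume_ge0 => k _; rewrite lee_fin csq_ge0.
- by apply: emeasurable_sum => k.
- by move=> x _; apply: integral_ge0 => y _; rewrite lee_fin csq_ge0.
- exact: measurable_tonelli.
have := ae_sqint_slice sK; apply: filterS => x sx _.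
rewrite -sqn_toL2// sumEFin lee_fin; apply: le_trans (bessel oe _).
by apply: ler_sum => k _; rewrite slice_pairingE// L2_conjK.
Qed.

Lemma Rintegral_fubini (k : X * Y -> R) : (m \x n)%E.-integrable setT (EFin \o k) ->
  (\int[m]_x (\int[n]_y k (x, y)) =
   fine (\int[m]_x \int[n]_y (k (x, y))%:E)%E)%R.
Proof.
move=> ik; rewrite {1}/Rintegral; congr fine; apply: ae_eq_integral => //.
- apply/measurable_EFinP; apply: measurable_slice_integral.
  by apply/measurable_EFinP; have /integrableP[] := ik.
- exact: (measurable_fubini_F ik).
have := ae_integrable1 ik; apply: filterS => x ix _.
by rewrite /Rintegral fineK//; exact: integrable_fin_num ix.
Qed.

End kernels.

Section transposed_kernel.
Context dx dy (X : measurableType dx) (Y : measurableType dy) (R : realType).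

Definition kernel_tr (A : Type) (K : X * Y -> A) (p : Y * X) : A := K (p.2, p.1).

Lemma cmeasurable_tr (K : X * Y -> R[i]) : cmeasurable K -> cmeasurable (kernel_tr K).
Proof.
move=> [mr mi]; have ms := @measurable_swap _ _ Y X.
by split; [exact: measurableT_comp mr ms|exact: measurableT_comp mi ms].
Qed.

Variables (m : {sigma_finite_measure set X -> \bar R}).
Variables (n : {sigma_finite_measure set Y -> \bar R}).

Lemma sqint_tr (K : X * Y -> R[i]) : sqint (m \x n)%E K -> sqint (n \x m)%E (kernel_tr K).
Proof.
move=> [mK iK]; split; first exact: cmeasurable_tr.
rewrite tonelli_csq; last exact: cmeasurable_tr.
rewrite -(@fubini_tonelli _ _ _ _ _ m n (fun p => (csq (K p))%:E)).
- by rewrite -tonelli_csq.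
- exact: measurable_csqE.
- by move=> p; rewrite lee_fin csq_ge0.
Qed.

Lemma cintegral_fubini (h : X * Y -> R[i]) :
  (m \x n)%E.-integrable setT (EFin \o (Re \o h)) ->
  (m \x n)%E.-integrable setT (EFin \o (Im \o h)) ->
  cintegral m (fun x => cintegral n (fun y => h (x, y))) =
  cintegral n (fun y => cintegral m (fun x => h (x, y))).
Proof.
have key (k : X * Y -> R) : (m \x n)%E.-integrable setT (EFin \o k) ->
    (\int[m]_x (\int[n]_y k (x, y)) = \int[n]_y (\int[m]_x k (x, y)))%R.
  move=> ik; rewrite Rintegral_fubini// (Fubini ik).
  have itr : (n \x m)%E.-integrable setT (EFin \o kernel_tr k).
    have /integrableP[mk _] := ik.
    have mtr : measurable_fun setT (EFin \o kernel_tr k).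
      exact: measurableT_comp mk (@measurable_swap _ _ Y X).
    by apply/integrable12ltyP => //; have /integrable21ltyP := ik; apply.
  by rewrite -(Rintegral_fubini itr).
by move=> ir ii; congr Complex; [exact: key ir|exact: key ii].
Qed.

End transposed_kernel.

Section integral_operator_adjoint.
Context dx dy (X : measurableType dx) (Y : measurableType dy) (R : realType).
Variables (m : {sigma_finite_measure set X -> \bar R}).
Variables (n : {sigma_finite_measure set Y -> \bar R}).
Implicit Types (K G : X * Y -> R[i]) (u : L2 n) (v : L2 m).

(** The operator of the conjugate transposed kernel, written with conjugations outside so that facts
    on [integral_op] apply to it. *)
Definition integral_op_adj K v : L2 n :=
  L2_conj (integral_op n (kernel_tr K) (L2_conj v)).

Lemma integral_op_adjoint K : sqint (m \x n)%E K -> forall u v,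
  inner (integral_op m K u) v = inner u (integral_op_adj K v).
Proof.
move=> sK u v; have [mK iK] := sK.
have sKt := sqint_tr sK; have [mKt _] := sKt.
pose h (p : X * Y) := K p * repr u p.2 * Num.conj (repr v p.1).
have [mu_ _] := sqint_repr u; have [mv _] := sqint_repr v.
have mu2 : cmeasurable (fun p : X * Y => repr u p.2).
  have [ur ui] := mu_; split; [exact: measurableT_comp ur measurable_snd|
    exact: measurableT_comp ui measurable_snd].
have mv1 : cmeasurable (fun p : X * Y => repr v p.1).
  have [vr vi] := mv; split; [exact: measurableT_comp vr measurable_fst|
    exact: measurableT_comp vi measurable_fst].
have mh : cmeasurable h.
  by apply: cmeasurableM; [exact: cmeasurableM|exact: cmeasurable_conj].
(* An integrable majorant for Fubini: a product of two numbers is bounded by the sum of their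
   squared moduli. *)
have iD : (m \x n)%E.-integrable setT
    (fun p => (csq (K p))%:E + (csq (repr u p.2 * repr v p.1))%:E)%E.
  apply: integrableD => //.
    apply/integrableP; split; first exact: measurable_csqE.
    by under eq_integral do rewrite gee0_abs ?lee_fin ?csq_ge0//.
  have muv := cmeasurableM mu2 mv1.
  apply/integrableP; split; first exact: measurable_csqE.
  under eq_integral do rewrite gee0_abs ?lee_fin ?csq_ge0//.
  rewrite (tonelli_csq m n muv)/=.
  under eq_integral => x _.
    under eq_integral do rewrite mulrC csqM EFinM.
    rewrite ge0_integralZl//; last 3 first.
    - exact: measurable_csqE.
    - by move=> y _; rewrite lee_fin csq_ge0.
    - by rewrite lee_fin csq_ge0.
    rewrite muleC; over.
  rewrite ge0_integralZl//; last 3 first.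
  - exact: measurable_csqE.
  - by move=> x _; rewrite lee_fin csq_ge0.
  - by apply: integral_ge0 => y _; rewrite lee_fin csq_ge0.
  by rewrite -!sqn_repr -EFinM ltry.
have hle p : `|Re (h p)| <= csq (K p) + csq (repr u p.2 * repr v p.1) /\
    `|Im (h p)| <= csq (K p) + csq (repr u p.2 * repr v p.1).
  have -> : csq (repr u p.2 * repr v p.1) = csq (repr u p.2 * Num.conj (repr v p.1)).
    by rewrite !csqM csq_conj.
  rewrite /h -mulrA; case: (K p) (_ * Num.conj _) => a b [c d]; rewrite /csq/=.
  have := sqr_ge0 (a - c); have := sqr_ge0 (b - d); have := sqr_ge0 (a + c).
  have := sqr_ge0 (b + d); have := sqr_ge0 (a - d); have := sqr_ge0 (b - c).
  have := sqr_ge0 (a + d); have := sqr_ge0 (b + c).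
  by move=> *; split; rewrite ler_norml; apply/andP; split; nra.
have [mhr mhi] := mh.
have g0 q : 0 <= csq (K q) + csq (repr u q.2 * repr v q.1).
  by apply: addr_ge0; exact: csq_ge0.
have ir : (m \x n)%E.-integrable setT (EFin \o (Re \o h)).
  apply: (le_integrable measurableT _ _ iD); first by apply/measurable_EFinP.
  move=> q _; rewrite -EFinD /= lee_fin [leRHS]ger0_norm//.
  by have [] := hle q.
have ii : (m \x n)%E.-integrable setT (EFin \o (Im \o h)).
  apply: (le_integrable measurableT _ _ iD); first by apply/measurable_EFinP.
  move=> q _; rewrite -EFinD /= lee_fin [leRHS]ger0_norm//.
  by have [] := hle q.
transitivity (cintegral m (fun x => cintegral n (fun y => h (x, y)))).
  rewrite -[v in LHS]toL2K inner_toL2; [|exact: sqint_slice_pairing|exact: sqint_repr].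
  apply: ae_eq_cintegral.
  - by apply: cmeasurableM; [exact: cmeasurable_slice_pairing|exact: cmeasurable_conj].
  - exact: cmeasurable_slice_integral.
  have := ae_sqint_slice sK; apply: filterS => x sx.
  rewrite -[cintegral n _ * _]/(slice_pairing K u x * _) slice_pairingE// mulrC.
  rewrite -innerZl -toL2Z// inner_toL2; [|exact: sqintZ|exact: sqint_conj (sqint_repr u)].
  congr cintegral; apply/funext => y; rewrite conjCK /h/=; ring.
rewrite (cintegral_fubini ir ii) /integral_op_adj.
rewrite -[u in RHS]L2_conjK inner_L2_conj.
have scu := sqint_conj (sqint_repr u).
rewrite inner_toL2//; last exact: sqint_slice_pairing.
apply: ae_eq_cintegral.
- apply: (@cmeasurable_slice_integral _ _ _ _ _ m (kernel_tr h)).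
  exact: cmeasurable_tr.
- apply: cmeasurableM; first exact: cmeasurable_slice_pairing.
  by apply: cmeasurable_conj; have [] := scu.
have := ae_sqint_slice sKt; apply: filterS => y sy.
rewrite -[cintegral m _ * _]/(slice_pairing (kernel_tr K) (L2_conj v) y * _).
rewrite slice_pairingE// L2_conjK conjCK mulrC -innerZl -toL2Z// -[v in RHS]toL2K.
rewrite inner_toL2; [|exact: sqintZ|exact: sqint_repr].
congr cintegral; apply/funext => x; rewrite /h/kernel_tr/=; ring.
Qed.

(* [integral_op] pairs [K (x, -)] with [u] bilinearly, hence the conjugate of
   the eigenbasis. *)
Lemma integral_op_intertwine (E : set (L2 n * L2 n)) (e : nat -> L2 n) (lam : nat -> R) K G :
  (forall u w : L2 n, E (u, w) -> forall k, inner w (e k) = (lam k)%:C%C * inner u (e k)) ->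
  apply_y m E K G -> sqint (m \x n)%E K -> sqint (m \x n)%E G -> forall k,
  integral_op m G (L2_conj (e k)) = (lam k)%:C%C *: integral_op m K (L2_conj (e k)).
Proof.
move=> Ee [mG aE] sK sG k; rewrite -toL2Z; last exact: sqint_slice_pairing.
apply: toL2_eq; [exact: sqint_slice_pairing|by apply: sqintZ; exact: sqint_slice_pairing|].
move: aE; apply: filterS => x [sx tx Ex].
rewrite -[LHS]/(slice_pairing G _ x) -[in RHS]/(slice_pairing K _ x).
by rewrite !slice_pairingE// L2_conjK (Ee _ _ Ex k).
Qed.

(** Serves the mixed case, where only the last of the kernels [K], [(E1)_y K], [(E2)_x (E1)_y K]
    besides [K] is assumed square integrable. *)
Lemma sqint_kernel_le K G c : cmeasurable K -> sqint (m \x n)%E G -> 0 <= c ->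
  {ae m, forall x, [/\ sqint n (fun y => K (x, y)), sqint n (fun y => G (x, y)) &
    sqn (toL2 n (fun y => K (x, y))) <= c * sqn (toL2 n (fun y => G (x, y)))]} ->
  sqint (m \x n)%E K.
Proof.
move=> mK [mG iG] c0 h; split=> //; rewrite tonelli_csq//.
apply: (@le_lt_trans _ _ (\int[m]_x (c%:E * \int[n]_y (csq (G (x, y)))%:E))%E).
  apply: ae_ge0_le_integral => //.
  - by move=> x _; apply: integral_ge0 => y _; rewrite lee_fin csq_ge0.
  - exact: measurable_tonelli.
  - move=> x _; rewrite mule_ge0 ?lee_fin//.
    by apply: integral_ge0 => y _; rewrite lee_fin csq_ge0.
  - by apply: measurable_funeM; exact: measurable_tonelli.
  by move: h; apply: filterS => x [sx tx st] _; rewrite -!sqn_toL2// -EFinM lee_fin.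
rewrite ge0_integralZl//; last 2 first.
- exact: measurable_tonelli.
- by move=> x _; apply: integral_ge0 => y _; rewrite lee_fin csq_ge0.
by rewrite -tonelli_csq// lte_mul_pinfty// lee_fin.
Qed.

End integral_operator_adjoint.

Lemma eigenbasis_coercive (R : realType) (H : preHilbertType R[i]) (e : nat -> H)
    (lam : nat -> R) (u v : H) : hilbert_basis e -> (forall k, 0 < lam k) ->
  {homo lam : m n / (m <= n)%N >-> m <= n} ->
  (forall k, inner v (e k) = (lam k)%:C%C * inner u (e k)) ->
  sqn u <= (lam 0) ^- 2 * sqn v.
Proof.
move=> he l0 lh uv; apply: (hb_le he) => n.
apply: (@le_trans _ _ (lam 0 ^- 2 * \sum_(k < n) csq (inner v (e k)))).
  rewrite mulr_sumr; apply: ler_sum => k _; rewrite uv csqM csq_real mulrA.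
  rewrite -[leLHS]mul1r ler_wpM2r ?csq_ge0// mulrC ler_pdivlMr ?exprn_gt0// mul1r.
  by rewrite lerXn2r ?nnegrE ?(ltW (l0 _))// lh.
rewrite ler_wpM2l ?invr_ge0 ?exprn_ge0 ?(ltW (l0 _))//.
exact: bessel (hb_orthonormal he n) _.
Qed.

Section transposition.
Context dx dy (X : measurableType dx) (Y : measurableType dy) (R : realType).

Lemma kernel_trK (A : Type) (K : X * Y -> A) : kernel_tr (kernel_tr K) = K.
Proof. by apply/funext => -[x y]. Qed.

Lemma apply_x_tr (m : {measure set X -> \bar R}) (n : {measure set Y -> \bar R})
    (E : set (L2 m * L2 m)) (K G : X * Y -> R[i]) :
  apply_x n E K G -> apply_y n E (kernel_tr K) (kernel_tr G).
Proof. by move=> [mG aE]; split=> //; exact: cmeasurable_tr. Qed.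

End transposition.

(** * Completeness and compactness *)

Section completeness.
Context d (T : measurableType d) (R : realType) (mu : {measure set T -> \bar R}).

Lemma real_cvg_rate (x b : nat -> R) :
  (forall n m, (n <= m)%N -> (x m - x n) ^+ 2 <= b n) -> b @ \oo --> (0 : R) ->
  exists l : R, x @ \oo --> l /\ forall n, (l - x n) ^+ 2 <= b n.
Proof.
move=> xb b0; have cx : cvgn x.
  apply: cauchy_cvg; apply: cauchy_exP => e e0.
  have := b0 => /cvgr_lt /(_ _ (exprn_gt0 2 e0)) [N _ hN].
  exists (x N), N => // m /= Nm; rewrite /ball/= -(@ltr_pXn2r _ 2)// ?nnegrE ?(ltW e0)//.
  by rewrite real_normK ?num_real// -sqrrN opprB; apply: le_lt_trans (xb _ _ Nm) (hN N (leqnn N)).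
exists (limn x); split=> // n.
have c : (fun m => (x m - x n) ^+ 2) @ \oo --> (limn x - x n) ^+ 2.
  by rewrite expr2; under eq_fun do rewrite expr2; apply: cvgM; apply: cvgB => //; exact: cvg_cst.
rewrite -(cvg_lim _ c)//; apply: limr_le; first by apply/cvg_ex; eexists; exact: c.
by exists n => // m /= nm; exact: xb.
Qed.

(** The weighted Cauchy-Schwarz inequality; in the induction the parameter [g k / G] makes the
    splitting inequality fit exactly. *)
Lemma csq_sum_weighted (r : nat -> R[i]) (g : nat -> R) k : (forall i, 0 < g i) ->
  csq (\sum_(i < k) r i) <= (\sum_(i < k) g i) * \sum_(i < k) csq (r i) / g i.
Proof.
move=> g0; elim: k => [|k ih]; first by rewrite !big_ord0 csq0 mul0r.
case: k => [|k] in ih *.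
  by rewrite !big_ord1 mulrCA divff ?mulr1// gt_eqF.
rewrite big_ord_recr [in X in X * _]big_ord_recr [in X in _ * X]big_ord_recr/=.
set a := \sum_(i < k.+1) r i in ih *; set G := \sum_(i < k.+1) g i in ih *.
set A := \sum_(i < k.+1) _ in ih *.
have G0 : 0 < G by rewrite /G big_ord_recr/= ltr_wpDl// sumr_ge0// => i _; exact: ltW.
have gk := g0 k.+1; have r0 : 0 < g k.+1 / G by rewrite divr_gt0.
apply: le_trans (csqD_le_eps _ _ r0) _.
have -> : (G + g k.+1) * (A + csq (r k.+1) / g k.+1) =
    (1 + g k.+1 / G) * (G * A) + (1 + (g k.+1 / G)^-1) * csq (r k.+1).
  by field; rewrite !gt_eqF.
by rewrite lerD2r ler_wpM2l// addr_ge0// ltW.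
Qed.

Local Notation w i := ((2 : R) ^- i).

Lemma geometric_half_gt0 (i : nat) : 0 < w i.
Proof. by rewrite invr_gt0 exprn_gt0. Qed.

Lemma geometric_half_sum n k : \sum_(i < k) w (n + i) <= 2 * w n.
Proof.
have : \sum_(i < k) w (n + i) = 2 * w n - 2 * w (n + k).
  elim: k => [|k ih]; first by rewrite big_ord0 addn0 subrr.
  have n0 m : (2 : R) ^+ m != 0 by rewrite expf_neq0// pnatr_eq0.
  by rewrite big_ord_recr/= ih addnS exprS; field; rewrite !n0.
by move=> ->; rewrite gerBl mulr_ge0// ltW.
Qed.

Lemma geometric_half_cvg (c : R) : (fun n : nat => c * w n) @ \oo --> (0 : R).
Proof.
rewrite (_ : (fun n => _) = geometric c 2^-1); first apply: cvg_geometric.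
  by rewrite ger0_norm ?invr_ge0// invf_lt1// ltr1n.
by apply/funext => n; rewrite /= exprVn.
Qed.

(* Riesz-Fischer: the weights [2 ^ n] make the pointwise sum of the squared
   increments integrable and, by the Cauchy-Schwarz inequality, control the
   pointwise convergence at a geometric rate. *)
Lemma L2_complete (H : nat -> L2 mu) (B : R) : 0 <= B ->
  (forall n, sqn (H n.+1 - H n) <= B * w n ^+ 2) ->
  exists (a : L2 mu) (C : R), forall n, sqn (a - H n) <= C * w n.
Proof.
move=> B0 HB; pose r i : T -> R[i] := repr (H i.+1 - H i).
have mr i : cmeasurable (r i) by have [] := sqint_repr (H i.+1 - H i).
pose qi i x : \bar R := ((w i)^-1 * csq (r i x))%:E.
have qi0 i x : (0 <= qi i x)%E by rewrite lee_fin mulr_ge0 ?csq_ge0// invr_ge0 ltW.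
have mqi i : measurable_fun setT (qi i).
  apply/measurable_EFinP; apply: measurable_funM => //; exact: measurable_csq.
pose q x : \bar R := (\sum_(0 <= i <oo) qi i x)%E.
have mq : measurable_fun setT q.
  by apply: (@ge0_emeasurable_sum _ _ _ _ qi xpredT) => //.
have q0 x : (0 <= q x)%E by apply: nneseries_ge0.
have Iq : (\int[mu]_x q x <= (2 * B)%:E)%E.
  rewrite integral_nneseries//; apply: lime_le.
    by apply: is_cvg_nneseries => n _ _; exact: integral_ge0.
  apply: nearW => n; rewrite big_mkord.
  apply: (@le_trans _ _ (\sum_(i < n) (B * w i)%:E)%E).
    apply: lee_sum => i _; under eq_integral do rewrite /qi EFinM.
    rewrite ge0_integralZl//; last 2 first.
    - exact: measurable_csqE.
    - by move=> x _; rewrite lee_fin csq_ge0.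
    rewrite -sqn_repr -EFinM lee_fin mulrC ler_pdivrMr//.
    by apply: le_trans (HB i) _; rewrite expr2 mulrA.
  rewrite sumEFin lee_fin -mulr_sumr mulrC ler_wpM2r//.
  by have := geometric_half_sum 0 n; rewrite expr0 invr1 mulr1.
have qfin : {ae mu, forall x, (q x < +oo)%E}.
  have iq : mu.-integrable setT q.
    apply/integrableP; split=> //; under eq_integral do rewrite gee0_abs//.
    by apply: le_lt_trans Iq _; rewrite ltry.
  have := integrable_ae measurableT iq; apply: filterS => x /(_ I).
  by rewrite ge0_fin_numE.
(* Cutting off outside this conull set makes the partial sums converge everywhere, so that the limit
   is measurable. *)
pose A := ~` (q @^-1` [set +oo%E]).
have mA : measurable A.
  by apply: measurableC; rewrite -[X in measurable X]setTI; apply: mq => //; exact: emeasurable_set1.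
have AP x : A x <-> (q x < +oo)%E by rewrite ltey; split=> /eqP.
pose phi n x := \sum_(i < n) r i x.
have phiD x n m : (n <= m)%N -> (q x < +oo)%E ->
    csq (phi m x - phi n x) <= 2 * fine (q x) * w n.
  move=> nm qx; rewrite -(subnKC nm) /phi big_split_ord/=; move: (m - n)%N => k.
  rewrite addrAC subrr add0r.
  apply: le_trans (csq_sum_weighted (fun i => r (n + i) x) k (fun i => geometric_half_gt0 (n + i))) _.
  rewrite [leRHS]mulrAC; apply: ler_pM => //.
  - by apply: sumr_ge0 => i _; exact: ltW.
  - by apply: sumr_ge0 => i _; rewrite divr_ge0 ?csq_ge0// ltW.
  - exact: geometric_half_sum.
  rewrite -lee_fin fineK ?ge0_fin_numE// -sumEFin.
  apply: (@le_trans _ _ (\sum_(0 <= i < n + k) qi i x)%E); last exact: nneseries_lim_ge.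
  rewrite big_mkord big_split_ord/= -[leLHS]add0e leeD//; first exact: sume_ge0.
  by apply: lee_sum => i _; rewrite lee_fin mulrC.
have rate x : (q x < +oo)%E -> exists l : R[i], [/\ (fun n => Re (phi n x)) @ \oo --> Re l,
    (fun n => Im (phi n x)) @ \oo --> Im l &
    forall n, csq (l - phi n x) <= 4 * fine (q x) * w n].
  move=> qx; pose c := 2 * fine (q x).
  have re n m : (n <= m)%N -> (Re (phi m x) - Re (phi n x)) ^+ 2 <= c * w n.
    move=> nm; apply: le_trans (phiD x n m nm qx); rewrite /csq raddfB/= lerDl.
    exact: sqr_ge0.
  have im n m : (n <= m)%N -> (Im (phi m x) - Im (phi n x)) ^+ 2 <= c * w n.
    move=> nm; apply: le_trans (phiD x n m nm qx); rewrite /csq !raddfB/= lerDr.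
    exact: sqr_ge0.
  have [l1 [cl1 h1]] := real_cvg_rate re (geometric_half_cvg c).
  have [l2 [cl2 h2]] := real_cvg_rate im (geometric_half_cvg c).
  exists (Complex l1 l2); split=> // n.
  have := h1 n; have := h2 n; rewrite /csq !raddfB/= /c; lra.
pose psi n x : R[i] := phi n x * (\1_A x)%:C%C.
have psiP x : exists l : R[i], [/\ (fun n => Re (psi n x)) @ \oo --> Re l,
    (fun n => Im (psi n x)) @ \oo --> Im l &
    (q x < +oo)%E -> forall n, csq (l - phi n x) <= 4 * fine (q x) * w n].
  have [Ax|Ax] := pselect (A x).
    have psiE n : psi n x = phi n x by rewrite /psi indicE mem_set// mulr1.
    have [l [rl il hl]] := rate x (proj1 (AP x) Ax); exists l.
    by split=> //; under eq_fun do rewrite psiE.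
  have psiE n : psi n x = 0 by rewrite /psi indicE memNset// mulr0.
  exists 0; split; last by move/AP.
    by under eq_fun do rewrite psiE; exact: cvg_cst.
  by under eq_fun do rewrite psiE; exact: cvg_cst.
have /choice[a aP] := psiP.
have mpsi n : cmeasurable (psi n).
  apply: cmeasurableM; last first.
    split; last by rewrite (_ : _ \o _ = cst 0).
    by rewrite (_ : _ \o _ = \1_A)//; exact: measurable_indic.
  rewrite (_ : phi n = fun x => \sum_(i < n) r i x)//.
  elim: n => [|n ih].
    by under [X in cmeasurable X]eq_fun do rewrite big_ord0; exact: cmeasurable_cst.
  under [X in cmeasurable X]eq_fun do rewrite big_ord_recr/=.
  exact: cmeasurableD.
have ma : cmeasurable a.
  split.
    apply: (@measurable_fun_cvg _ _ _ _ (fun n => Re \o psi n)) => [n|x _].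
      by have [] := mpsi n.
    by have [] := aP x.
  apply: (@measurable_fun_cvg _ _ _ _ (fun n => Im \o psi n)) => [n|x _].
    by have [] := mpsi n.
  by have [] := aP x.
have phi0 x : phi 0%N x = 0 by rewrite /phi big_ord0.
have Iphi n (b : T -> R[i]) : cmeasurable b ->
    {ae mu, forall x, b x = a x - phi n x} ->
    (\int[mu]_x (csq (b x))%:E <= (4 * w n * (2 * B))%:E)%E.
  move=> mb bE; apply: (@le_trans _ _ (\int[mu]_x ((4 * w n)%:E * q x))%E).
    apply: ae_ge0_le_integral => //.
    - by move=> x _; rewrite lee_fin csq_ge0.
    - exact: measurable_csqE.
    - by move=> x _; rewrite mule_ge0.
    - exact: measurable_funeM.
    apply: filterS2 bE qfin => x -> qx _.
    rewrite -[q x]fineK ?ge0_fin_numE// -EFinM lee_fin mulrAC.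
    by have [_ _] := aP x; apply.
  rewrite ge0_integralZl//.
  by rewrite [leRHS]EFinM lee_wpmul2l.
have sa : sqint mu a.
  split=> //; apply: le_lt_trans (Iphi 0%N a ma _) _; last by rewrite ltry.
  by apply: aeW => x; rewrite phi0 subr0.
have HE n : {ae mu, forall x, repr (H n - H 0%N) x = phi n x}.
  elim: n => [|n ih].
    have := repr_scale (0 : R[i]) (H 0%N - H 0%N); apply: filterS => x.
    by rewrite scale0r -[X in repr X]subr0 -{1}(subrr (H 0%N)) subr0 mul0r phi0.
  have E : H n.+1 - H 0%N = (H n - H 0%N) + (H n.+1 - H n).
    by rewrite [RHS]addrC addrA subrK.
  rewrite E; apply: filterS2 ih (repr_add (H n - H 0%N) (H n.+1 - H n)) => x h ->.
  by rewrite h /phi big_ord_recr.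
(* The increments telescope to [H n - H 0], hence the added term. *)
exists (toL2 mu a + H 0%N), (4 * (2 * B)) => n.
set b := (_ - _); have mb : cmeasurable (repr b) by have [] := sqint_repr b.
rewrite -lee_fin sqn_repr [_ * w n]mulrAC; apply: (Iphi n (repr b) mb).
have -> : b = toL2 mu a + (-1) *: (H n - H 0%N).
  by rewrite /b scaleN1r opprB addrA addrAC.
have h := repr_add (toL2 mu a) ((-1) *: (H n - H 0%N)).
have {}h : {ae mu, forall x, repr (toL2 mu a + (-1) *: (H n - H 0%N)) x =
    a x + repr ((-1) *: (H n - H 0%N)) x}.
  by apply: filterS2 h (toL2_repr sa) => x -> ->.
apply: filterS3 h (repr_scale (-1) (H n - H 0%N)) (HE n) => x -> -> ->.
by rewrite mulN1r.
Qed.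

End completeness.
Section riesz_fischer.
Context d (T : measurableType d) (R : realType) (mu : {measure set T -> \bar R}).

Lemma sum_orthonormal_diff (H : preHilbertType R[i]) (f : nat -> H) (c : nat -> R[i]) n m :
  (forall k, orthonormal k f) -> (n <= m)%N ->
  sqn (\sum_(k < m) c k *: f k - \sum_(k < n) c k *: f k) = \sum_(k < m | (n <= k)%N) csq (c k).
Proof.
move=> of_ nm; rewrite (big_ord_widen m (fun k => c k *: f k) nm).
rewrite [X in _ - X]big_mkcond -sumrB.
pose a k := if (n <= k)%N then c k else 0.
have -> : \sum_(k < m) (c k *: f k - (if (k < n)%N then c k *: f k else 0)) =
    \sum_(k < m) a k *: f k.
  apply: eq_bigr => k _; rewrite /a; case: ltnP => _; last by rewrite subr0.
  by rewrite subrr scale0r.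
rewrite (sqn_sum_orthonormal (of_ m) a) [RHS]big_mkcond; apply: eq_bigr => k _.
by rewrite /a; case: ifP => //; rewrite csq0.
Qed.

Lemma riesz_fischer (f : nat -> L2 mu) (c : nat -> R[i]) (M : R) :
  (forall n, orthonormal n f) -> (forall n, \sum_(k < n) csq (c k) <= M) ->
  exists a : L2 mu, forall k, inner a (f k) = c k.
Proof.
move=> of_ cM; have M0 : 0 <= M by have := cM 0%N; rewrite big_ord0.
have /choice[N0 N0P] : forall i, exists N, forall n m, (N <= n)%N ->
    \sum_(k < m | (n <= k)%N) csq (c k) <= (2 ^- i) ^+ 2.
  move=> i; apply: (bounded_sum_tail (fun k => csq_ge0 (c k)) cM).
  by rewrite exprn_gt0// geometric_half_gt0.
(* A subsequence along which the increments of the partial sums decay geometrically, as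
   [L2_complete] demands; the constant [M + 1] there accounts for the first increment. *)
pose nu := nat_rect (fun=> nat) 0%N (fun i v => maxn v.+1 (N0 i.+1)).
have nuS i : nu i.+1 = maxn (nu i).+1 (N0 i.+1) by [].
have nu_ge i : (i <= nu i)%N.
  by elim: i => // i ih; rewrite nuS leq_max ltnS ih.
have nu_le i : (nu i <= nu i.+1)%N by rewrite nuS leq_max leqnSn.
pose H i := \sum_(k < nu i) c k *: f k.
have HB i : sqn (H i.+1 - H i) <= (M + 1) * (2 ^- i) ^+ 2.
  rewrite sum_orthonormal_diff//; case: i => [|i].
    rewrite expr0 invr1 expr1n mulr1.
    apply: (@le_trans _ _ M); last by rewrite lerDl.
    by rewrite (eq_bigl xpredT)//; exact: cM.
  apply: (@le_trans _ _ (((2 : R) ^- i.+1) ^+ 2)).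
    by apply: N0P; rewrite nuS leq_maxr.
  by rewrite ler_peMl ?sqr_ge0// lerDr.
have M10 : 0 <= M + 1 by rewrite addr_ge0.
have [a [C aC]] := L2_complete M10 HB; exists a => k.
apply/eqP; rewrite -subr_eq0; apply/eqP/csq_eq0/eqP.
rewrite eq_le csq_ge0 andbT.
apply: (ler_cvg_to (cvg_cst _) (geometric_half_cvg C)).
exists k.+1 => // n /= kn; apply: le_trans (aC n).
have nk : (k < nu n)%N by apply: leq_trans (nu_ge n).
have -> : c k = inner (H n) (f k) by rewrite (inner_sum_orthonormal (of_ (nu n)) c).
rewrite -innerBl; apply: le_trans (cauchy_schwarz _ _) _.
by rewrite (sqn_orthonormal (of_ k.+1))// mulr1.
Qed.

End riesz_fischer.

Lemma ultra_fmap (T U : Type) (h : T -> U) (F : set_system T) :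
  UltraFilter F -> UltraFilter (h @ F).
Proof.
move=> FU; split=> [|G GP FG]; first exact: fmap_proper_filter.
apply/seteqP; split=> [B GB|B FB]; last exact: FG.
have [//|FnB] := in_ultra_setVsetC (h @^-1` B) FU.
have GnB : G (~` B) by apply: FG.
by have [x []] := filter_ex (filterI GB GnB).
Qed.

Section compactness.
Context d (T : measurableType d) (R : realType) (mu : {measure set T -> \bar R}).
Context (H1 : preHilbertType R[i]).
Variables (A : H1 -> L2 mu) (S : L2 mu -> H1) (g : nat -> H1) (f : nat -> L2 mu).
Hypothesis AS : forall u v, inner (A u) v = inner u (S v).
Hypothesis hg : hilbert_basis g.
Hypothesis hf : hilbert_basis f.

(* The closure of the image of the unit ball lies in the Hilbert cube
   [csq (inner v (f j)) <= 2 * sqn (S (f j))], whose sides are square summable. *)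
Lemma hilbert_schmidt_compact M : (forall N, \sum_(l < N) sqn (A (g l)) <= M) ->
  compact_op A.
Proof.
move=> AM; split; first exact: adjoint_linear AS.
set B := A @` _.
pose t j := sqn (S (f j)).
have t0 j : 0 <= t j by exact: sqn_ge0.
have tM J : \sum_(j < J) t j <= M.
  apply: (hb_sum_le hg (x := fun j => S (f j))) => N; rewrite exchange_big/=.
  apply: le_trans (AM N); apply: ler_sum => l _.
  apply: le_trans (bessel (hb_orthonormal hf J) _).
  by apply: ler_sum => j _; rewrite csq_innerC AS.
have M0 : 0 <= M by have := tM 0%N; rewrite big_ord0.
have f1 j : sqn (f j) = 1 by apply: (sqn_orthonormal (hb_orthonormal hf j.+1)).
have Bt v j : closure B v -> csq (inner v (f j)) <= 2 * t j.
  move=> Bv; apply/ler_addgt0Pr => e e0.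
  have e2 : 0 < e / 2 by rewrite divr_gt0.
  have : nbhs v [set v' | sqn (v - v') < e / 2].
    by have /cvg_sqnP := @cvg_refl _ (nbhs v) : nbhs v --> v; apply.
  move=> /Bv[_ [[u u1 <-] vu]].
  rewrite -(subrK (A u) v) innerDl; apply: le_trans (csqD_le _ _) _.
  have h1 : csq (inner (v - A u) (f j)) <= e / 2.
    by apply: le_trans (cauchy_schwarz _ _) _; rewrite f1 mulr1 ltW.
  have h2 : csq (inner (A u) (f j)) <= t j.
    rewrite AS; apply: le_trans (cauchy_schwarz _ _) _.
    rewrite -[leRHS]mul1r ler_wpM2r ?sqn_ge0//.
    by move: u1; rewrite /= (normr_le_sqn u ler01) expr1n.
  lra.
rewrite compact_ultra => F FU FB.
(* Along the ultrafilter each bounded coordinate converges, by compactness of a real segment applied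
   to its real and imaginary parts. *)
have coord j : exists c : R[i], forall e, 0 < e -> F [set v | csq (inner v (f j) - c) < e].
  pose b := Num.sqrt (2 * t j).
  have lim (p : R[i] -> R) : (forall z, p z ^+ 2 <= csq z) ->
      exists l : R, (fun v => p (inner v (f j))) @ F --> l.
    move=> pz; have GU := ultra_fmap (fun v => p (inner v (f j))) FU.
    have := @segment_compact R (- b) b; rewrite compact_ultra => /(_ _ GU)[|l [_ pl]].
      have : F ((fun v => p (inner v (f j))) @^-1` `[- b, b]); last exact.
      apply: filterS FB => v Bv; rewrite /= in_itv/= -ler_norml -sqrtr_sqr.
      by apply: ler_wsqrtr; apply: le_trans (pz _) (Bt v j Bv).
    by exists l.
  have [l1 cl1] : exists l : R, (fun v => Re (inner v (f j))) @ F --> l.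
    by apply: lim => z; rewrite lerDl sqr_ge0.
  have [l2 cl2] : exists l : R, (fun v => Im (inner v (f j))) @ F --> l.
    by apply: lim => z; rewrite lerDr sqr_ge0.
  exists (Complex l1 l2) => e e0.
  have c : (fun v => (Re (inner v (f j)) - l1) ^+ 2 + (Im (inner v (f j)) - l2) ^+ 2) @ F --> (0 : R).
    rewrite -[X in _ --> X](_ : (l1 - l1) ^+ 2 + (l2 - l2) ^+ 2 = 0); last first.
      by rewrite !subrr expr0n addr0.
    by apply: cvgD; rewrite expr2; under eq_fun do rewrite expr2; apply: cvgM;
      apply: cvgB => //; exact: cvg_cst.
  have := c => /cvgr_lt /(_ _ e0); apply: filterS => v /=.
  by rewrite /csq !raddfB/=.
have /choice[c cP] := coord.
have ct j : csq (c j) <= 4 * t j.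
  apply/ler_addgt0Pr => e e0.
  have e2 : 0 < e / 2 by rewrite divr_gt0.
  have [v [h1 h2]] := filter_ex (filterI (cP j _ e2) FB).
  have := Bt v j h2; have := csqD_le (- (inner v (f j) - c j)) (inner v (f j)).
  rewrite csqN addrC opprB addrC subrK /=; move: h1 => /=; lra.
have cM n : \sum_(k < n) csq (c k) <= 4 * M.
  apply: (@le_trans _ _ (4 * \sum_(k < n) t k)); last by rewrite ler_wpM2l.
  by rewrite mulr_sumr; apply: ler_sum.
have [a aP] := riesz_fischer (hb_orthonormal hf) cM.
have Fa : F --> a.
  apply/cvg_sqnP => e e0.
  (* The bounds [2 t] for [v] and [4 t] for the limit give [12 t] for their difference, so this tail
     contributes at most [e / 4]; the first [N] coordinates contribute as much. *)
  have e12 : 0 < e / 48 by rewrite divr_gt0.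
  have [N hN] := bounded_sum_tail t0 tM e12.
  pose r := e / (4 * N.+1%:R).
  have r0 : 0 < r by rewrite divr_gt0// mulr_gt0// ltr0n.
  have FN : F [set v | forall j, (j < N)%N -> csq (inner v (f j) - c j) < r].
    elim: {hN} N r r0 => [|n ih] r r0; first by apply: filterS FB.
    apply: filterS2 (ih r r0) (cP n _ r0) => v h1 h2 j; rewrite ltnS leq_eqVlt.
    by move=> /predU1P[->//|]; exact: h1.
  apply: filterS2 FN FB => v /= vN Bv.
  apply: (@le_lt_trans _ _ (e / 2)); last by rewrite ltr_pdivrMr// ltr_pMr// ltr1n.
  apply: (hb_le hf) => n.
  apply: (@le_trans _ _ (\sum_(k < n) ((if (k < N)%N then r else 0) +
      (if (N <= k)%N then 12 * t k else 0)))).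
    apply: ler_sum => k _; rewrite innerBl aP; case: ltnP => kN.
      by rewrite addr0 ltW// -csqN opprB vN.
    rewrite add0r; apply: le_trans (csqD_le _ _) _; rewrite csqN.
    by have := Bt v k Bv; have := ct k; lra.
  have h1 : \sum_(k < n) (if (k < N)%N then r else 0) <= e / 4.
    have -> : \sum_(k < n) (if (k < N)%N then r else 0) = (minn n N)%:R * r.
      elim: n => [|n ih]; first by rewrite big_ord0 min0n mul0r.
      rewrite big_ord_recr/= ih; case: ltnP => nN.
        by rewrite (minn_idPl nN) -natr1 mulrDl mul1r.
      by rewrite addr0 (minn_idPr (leqW nN)).
    have -> : e / 4 = N.+1%:R * r.
      have : N.+1%:R != 0 :> R by rewrite pnatr_eq0.
      by rewrite /r; move: (N.+1%:R) => x x0; field.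
    by rewrite ler_wpM2r ?(ltW r0)// ler_nat (leq_trans (geq_minr _ _)).
  have h2 : \sum_(k < n) (if (N <= k)%N then 12 * t k else 0) <= e / 2 / 2.
    rewrite -big_mkcond -mulr_sumr; have := hN N n (leqnn N); lra.
  by rewrite big_split/=; lra.
exists a; split=> //.
rewrite (proj1 (closure_id _) (@closed_closure _ B)) => U /Fa FU'.
by have [v [vU vB]] := filter_ex (filterI FU' FB); exists v.
Qed.

End compactness.

(** * Integral operators with smooth kernels *)

Section weighted_columns.
Context (R : realType) (H2 : preHilbertType R[i]).

(** The exponent satisfies [1 / (2 k) = 1/2 + 1/p]: Hölder's inequality between the square summable
    [b] and the [p]-summable [alpha]. *)
Lemma weighted_column_sum (b : nat -> H2) (alpha : nat -> R) p k M B N : 0 < p ->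
  k = (1 + 2 * p^-1)^-1 -> 0 <= M -> 0 <= B -> (forall l, 0 <= alpha l) ->
  \sum_(l < N) sqn (b l) <= M -> \sum_(l < N) alpha l `^ p <= B `^ p ->
  \sum_(l < N) sqn ((alpha l)%:C%C *: b l) `^ k <= (M * B ^+ 2) `^ k.
Proof.
move=> p0 kE M0 B0 a0 bM aB.
have pi0 : 0 < p^-1 by rewrite invr_gt0.
have d0 : 0 < 1 + 2 * p^-1 by rewrite addr_gt0// mulr_gt0.
have k0 : 0 < k by rewrite kE invr_gt0.
have k1 : k <= 1 by rewrite kE invf_le1// lerDl mulr_ge0// ltW.
have kp : p * (1 - k) = 2 * k by rewrite kE; field; rewrite !gt_eqF// addr_gt0.
have ak c : 0 <= c -> (c `^ p) `^ (1 - k) = (c ^+ 2) `^ k.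
  by move=> c0; rewrite -powRrM kp powRrM powR_mulrn.
have := @hoelder_sum R 'I_N k (fun l => sqn (b l)) (fun l => alpha l `^ p) (ltW k0) k1
  (fun l => sqn_ge0 _) (fun l => powR_ge0 _ _).
under eq_bigr do rewrite ak// -powRM ?sqn_ge0 ?sqr_ge0// mulrC -csq_real -sqnZ.
move=> /le_trans; apply; rewrite powRM ?sqr_ge0// -ak//.
rewrite ler_pM ?powR_ge0//.
  rewrite ge0_ler_powR ?nnegrE ?(ltW k0)//; apply: sumr_ge0 => l _; exact: sqn_ge0.
rewrite ge0_ler_powR ?nnegrE ?subr_ge0 ?powR_ge0//.
by apply: sumr_ge0 => l _; exact: powR_ge0.
Qed.

End weighted_columns.

Section factored_operator.
Context (R : realType) (H1 H2 : preHilbertType R[i]).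
Variables (T : H1 -> H2) (S : H2 -> H1) (g : nat -> H1) (f : nat -> H2).
Hypothesis TS : forall u v, inner (T u) v = inner u (S v).
Hypothesis hg : hilbert_basis g.
Hypothesis hf : hilbert_basis f.
Variable MT : R.
Hypothesis TM : forall N, \sum_(l < N) sqn (T (g l)) <= MT.

(** Power sums are taken over squared norms, so [k] corresponds to the Schatten exponent [2 k] and
    [A] to the square of the norm. *)
Lemma schatten_norm_estimate k r A : 0 < k -> k <= 1 -> 2 * k <= r -> 0 <= A ->
  (forall J N, exists V : 'M[R[i]]_N, V \is unitarymx /\
    \sum_i sqn (mix V (fun l => diag_op f J (fun=> 1) (T (g l))) i) `^ k <= A `^ k) ->
  (schatten_norm r T <= (Num.sqrt A)%:E)%E.
Proof.
move=> k0 k1 kr A0 TA.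
have k2 : 0 < 2 * k by rewrite mulr_gt0.
have s0 := singular_value_ge0 TS.
apply: schatten_norm_le => //; [exact: lt_le_trans k2 kr|move=> n].
apply: (power_sum_le n k2 kr (sqrtr_ge0 _) s0) => {}n.
have -> : Num.sqrt A `^ (2 * k) = A `^ k by rewrite powRrM powR_mulrn ?sqrtr_ge0// sqr_sqrtr.
have := schatten_estimate TS hg hf n TM k0 k1 TA.
by under eq_bigr do rewrite -powR_mulrn// -powRrM.
Qed.

Lemma schatten_norm_right k r A : 0 < k -> k <= 1 -> 2 * k <= r -> 0 <= A ->
  (forall N, \sum_(l < N) sqn (T (g l)) `^ k <= A `^ k) ->
  (schatten_norm r T <= (Num.sqrt A)%:E)%E.
Proof.
move=> k0 k1 kr A0 TA; apply: (schatten_norm_estimate k0) => // J N.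
exists 1%:M; split; first by apply/unitarymxP; rewrite trmx1 map_mx1 mulmx1.
apply: le_trans (TA N); apply: ler_sum => l _; rewrite mix1.
rewrite ge0_ler_powR ?nnegrE ?sqn_ge0 ?(ltW k0)//.
rewrite (sqn_diag_op (hb_orthonormal hf J)); apply: le_trans (bessel (hb_orthonormal hf J) _).
by apply: ler_sum => j _; rewrite expr1n mul1r.
Qed.

Lemma schatten_norm_left (a : nat -> H2) (beta : nat -> R) k p r A B :
  0 < k -> k <= 1 -> 0 < p -> r^-1 <= 2^-1 * k^-1 + p^-1 -> 0 < r -> 0 <= A -> 0 <= B ->
  (forall j, 0 <= beta j) ->
  (forall l j, inner (T (g l)) (f j) = (beta j)%:C%C * inner (a l) (f j)) ->
  (forall N, \sum_(l < N) sqn (a l) `^ k <= A `^ k) ->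
  (forall J, \sum_(j < J) beta j `^ p <= B `^ p) ->
  (schatten_norm r T <= (Num.sqrt A * B)%:E)%E.
Proof.
move=> k0 k1 p0 rk r0 A0 B0 b0 TE aA bB.
(* [diag_op_schatten] measures squares of [beta], which halves the exponent. *)
have p2 : 0 < p / 2 by rewrite divr_gt0.
pose k' := (k^-1 + (p / 2)^-1)^-1.
have ki : 0 < k^-1 + (p / 2)^-1 by rewrite addr_gt0 ?invr_gt0.
have k'0 : 0 < k' by rewrite invr_gt0.
have k'k : k' <= k.
  by rewrite -[leRHS]invrK lef_pV2 ?posrE ?invr_gt0// lerDl invr_ge0 ltW.
have kr : 2 * k' <= r.
  rewrite -[leRHS]invrK -[2]invrK -invfM lef_pV2 ?posrE ?invr_gt0//; last first.
    by rewrite mulr_gt0// invr_gt0.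
  apply: le_trans rk _; rewrite mulrDr lerD2l le_eqVlt; apply/orP; left; apply/eqP.
  by field; rewrite gt_eqF.
have -> : Num.sqrt A * B = Num.sqrt (A * B ^+ 2).
  by rewrite sqrtrM// sqrtr_sqr ger0_norm.
apply: (schatten_norm_estimate k'0) => //.
- exact: le_trans k'k k1.
- by rewrite mulr_ge0// sqr_ge0.
move=> J N.
have bB' : \sum_(j < J) (beta j ^+ 2) `^ (p / 2) <= (B ^+ 2) `^ (p / 2).
  have E (c : R) : 0 <= c -> (c ^+ 2) `^ (p / 2) = c `^ p.
    by move=> c0; rewrite -powR_mulrn// -powRrM mulrC divfK.
  by rewrite E//; under eq_bigr do rewrite E//.
have kE : k'^-1 = k^-1 + (p / 2)^-1 by rewrite invrK.
have [W [uW WA]] := diag_op_schatten (hb_orthonormal hf J) (a := fun l : 'I_N => a l)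
  k0 k1 p2 k'0 kE A0 (sqr_ge0 B) b0 (aA N) bB'.
exists W; split=> //; rewrite (_ : (fun l : 'I_N => _) = diag_op f J beta \o (fun l : 'I_N => a l))//.
by apply/funext => l /=; apply: eq_bigr => j _; rewrite mul1r TE.
Qed.

Variables (b : nat -> H2) (M r : R).
Hypothesis bM : forall N, \sum_(l < N) sqn (b l) <= M.
Hypothesis r0 : 0 < r.

Let M0 : 0 <= M.
Proof. by have := bM 0%N; rewrite big_ord0. Qed.

Let exponent (p k : R) : 0 < p -> k = (1 + 2 * p^-1)^-1 ->
  [/\ 0 < k, k <= 1 & (2 * k)^-1 = 2^-1 + p^-1].
Proof.
move=> p0 kE; have q0 : 0 < 2 * p^-1 by rewrite mulr_gt0// invr_gt0.
have d0 : 0 < 1 + 2 * p^-1 by rewrite addr_gt0.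
rewrite kE; split; [by rewrite invr_gt0|by rewrite invf_le1// lerDl ltW|].
by rewrite invfM invrK mulrDr mulr1 mulrA mulVf ?mul1r// pnatr_eq0.
Qed.

Let sqrtMB (B : R) : 0 <= B -> Num.sqrt (M * B ^+ 2) = B * Num.sqrt M.
Proof. by move=> B0; rewrite sqrtrM// sqrtr_sqr ger0_norm// mulrC. Qed.

Lemma schatten_norm_right_factor (alpha : nat -> R) p A : 0 < p -> 0 <= A ->
  (forall l, 0 <= alpha l) ->
  (forall l, T (g l) = (alpha l)%:C%C *: b l) ->
  (forall N, \sum_(l < N) alpha l `^ p <= A `^ p) -> r^-1 <= 2^-1 + p^-1 ->
  (schatten_norm r T <= A%:E * (Num.sqrt M)%:E)%E.
Proof.
move=> p0 A0 a0 TE aA rp; have [k0 k1 kE] := exponent p0 erefl.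
rewrite -EFinM -sqrtMB//; apply: (schatten_norm_right k0 k1).
- by rewrite -lef_pV2 ?posrE ?mulr_gt0// kE.
- by rewrite mulr_ge0// sqr_ge0.
- move=> N; under eq_bigr do rewrite TE.
  exact: (weighted_column_sum p0 erefl).
Qed.

Lemma schatten_norm_left_factor (beta : nat -> R) p B : 0 < p -> 0 <= B ->
  (forall j, 0 <= beta j) ->
  (forall l j, inner (T (g l)) (f j) = (beta j)%:C%C * inner (b l) (f j)) ->
  (forall J, \sum_(j < J) beta j `^ p <= B `^ p) -> r^-1 <= 2^-1 + p^-1 ->
  (schatten_norm r T <= B%:E * (Num.sqrt M)%:E)%E.
Proof.
move=> p0 B0 b0 TE bB rp; rewrite -EFinM mulrC.
apply: (schatten_norm_left ltr01 (lexx 1) p0) TE _ bB => //.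
  by rewrite invr1 mulr1.
move=> N; rewrite powRr1//; under eq_bigr do rewrite powRr1 ?sqn_ge0//.
exact: bM.
Qed.

Lemma schatten_norm_two_factors (alpha beta : nat -> R) p q A B :
  0 < p -> 0 < q -> 0 <= A -> 0 <= B ->
  (forall l, 0 <= alpha l) -> (forall j, 0 <= beta j) ->
  (forall l j, inner (T (g l)) (f j) = (alpha l * beta j)%:C%C * inner (b l) (f j)) ->
  (forall N, \sum_(l < N) alpha l `^ p <= A `^ p) ->
  (forall J, \sum_(j < J) beta j `^ q <= B `^ q) -> r^-1 <= 2^-1 + p^-1 + q^-1 ->
  (schatten_norm r T <= A%:E * B%:E * (Num.sqrt M)%:E)%E.
Proof.
move=> p0 q0 A0 B0 a0 b0 TE aA bB rpq; have [k0 k1 kE] := exponent p0 erefl.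
rewrite -!EFinM mulrAC -sqrtMB//.
apply: (schatten_norm_left (a := fun l => (alpha l)%:C%C *: b l) k0 k1 q0 _ r0 _ B0 b0 _ _ bB).
- by rewrite -invfM kE.
- by rewrite mulr_ge0// sqr_ge0.
- by move=> l j; rewrite TE innerZl mulrA -rmorphM/= mulrC [beta j * _]mulrC mulrC.
- by move=> N; apply: weighted_column_sum p0 _ _ _ _ _ _.
Qed.

End factored_operator.

Section eigenvalue_factors.
Context (R : realType) (H : preHilbertType R[i]).

Lemma mul_factor (l : R) (z w : R[i]) : 0 < l -> w = l%:C%C * z -> z = (l^-1)%:C%C * w.
Proof. by move=> l0 ->; rewrite mulrA -rmorphM/= mulVf ?mul1r// gt_eqF. Qed.

Lemma scale_factor (l : R) (u v : H) : 0 < l -> v = l%:C%C *: u -> u = (l^-1)%:C%C *: v.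
Proof. by move=> l0 ->; rewrite scalerA -rmorphM/= mulVf ?scale1r// gt_eqF. Qed.

Lemma inner_factor (a b : R) (t v w : H) (z : R[i]) : t = a%:C%C *: v ->
  inner v w = b%:C%C * z -> inner t w = (a * b)%:C%C * z.
Proof. by move=> -> vw; rewrite innerZl vw mulrA -rmorphM. Qed.

End eigenvalue_factors.

Section factored_kernels.
Context dx dy (X : measurableType dx) (Y : measurableType dy) (R : realType).
Variables (m : {sigma_finite_measure set X -> \bar R}).
Variables (n : {sigma_finite_measure set Y -> \bar R}).
Implicit Types K G : X * Y -> R[i].

Definition hs_norm2 K : R := fine (\int[m \x n]_p (csq (K p))%:E)%E.

Lemma hs_norm2_ge0 K : 0 <= hs_norm2 K.
Proof. by apply: fine_ge0; apply: integral_ge0 => p _; rewrite lee_fin csq_ge0. Qed.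

Lemma hs_norm2E K : sqint (m \x n)%E K ->
  (hs_norm2 K)%:E = (\int[m \x n]_p (csq (K p))%:E)%E.
Proof.
move=> [_ iK]; rewrite fineK// ge0_fin_numE//.
by apply: integral_ge0 => p _; rewrite lee_fin csq_ge0.
Qed.

Lemma L2norm_hs_norm2 K : sqint (m \x n)%E K ->
  L2norm (m \x n)%E K = (Num.sqrt (hs_norm2 K))%:E.
Proof.
by move=> sK; rewrite -powR12_sqrt ?hs_norm2_ge0// -poweR_EFin hs_norm2E.
Qed.

Lemma sum_sqn_integral_op K (e : nat -> L2 n) N : sqint (m \x n)%E K -> hilbert_basis e ->
  \sum_(l < N) sqn (integral_op m K (L2_conj (e l))) <= hs_norm2 K.
Proof.
move=> sK he; rewrite -lee_fin hs_norm2E//.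
by apply: integral_op_hilbert_schmidt => //; exact: hb_orthonormal.
Qed.

(** Passing to the adjoint transposes the kernel, which turns the [x] variable into the one treated
    by [integral_op_intertwine]. *)
Lemma integral_op_intertwine_left (E : set (L2 m * L2 m)) (f : nat -> L2 m)
    (lam : nat -> R) K G :
  (forall u v : L2 m, E (u, v) -> forall k, inner v (f k) = (lam k)%:C%C * inner u (f k)) ->
  apply_x n E K G -> sqint (m \x n)%E K -> sqint (m \x n)%E G -> forall (u : L2 n) k,
  inner (integral_op m G u) (f k) = (lam k)%:C%C * inner (integral_op m K u) (f k).
Proof.
move=> Ef aE sK sG u k.
rewrite [LHS](integral_op_adjoint sG) [X in _ * X](integral_op_adjoint sK) /integral_op_adj.
have -> := integral_op_intertwine Ef (apply_x_tr aE) (sqint_tr sK) (sqint_tr sG) k.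
by rewrite L2_conjZ innerZr !conj_real.
Qed.

(** A factor constantly 1, with decay exponent 0, covers the parts with one operator. *)
Lemma integral_op_class K G (e : nat -> L2 n) (f : nat -> L2 m) (alpha beta : nat -> R)
    (ca cb x y : R) :
  sqint (m \x n)%E K -> sqint (m \x n)%E G -> hilbert_basis e -> hilbert_basis f ->
  (forall k, 0 <= alpha k) -> {homo alpha : i j / (i <= j)%N >-> j <= i} ->
  (forall k, 0 <= beta k) -> {homo beta : i j / (i <= j)%N >-> j <= i} ->
  (forall k j, inner (integral_op m K (L2_conj (e k))) (f j) =
     (alpha k * beta j)%:C%C * inner (integral_op m G (L2_conj (e k))) (f j)) ->
  0 <= ca -> 0 <= cb -> 0 <= x -> 0 <= y ->
  (forall n, alpha n <= ca * n.+1%:R `^ (- x)) ->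
  (forall n, beta n <= cb * n.+1%:R `^ (- y)) ->
  let T : L2 n -> L2 m := integral_op m K in
  (forall r, 0 < r -> r^-1 < 2^-1 + x + y -> schatten_class r T) /\
  singular_value T =o_\oo (fun k => k.+1%:R `^ (- (2^-1 + x + y))).
Proof.
move=> sK sG he hf a0 ha b0 hb tE ca0 cb0 x0 y0 ac bc T.
have TS := integral_op_adjoint sK; have hg := L2_conj_hb he.
have lo : singular_value T =o_\oo (fun k => k.+1%:R `^ (- (2^-1 + x + y))).
  apply: (singular_value_littleo TS hg hf a0 ha b0 hb tE _ ca0 cb0 x0 y0 ac bc) => N.
  exact: sum_sqn_integral_op.
split=> // r r0 rxy; split.
  by apply: (hilbert_schmidt_compact TS hg hf) => N; exact: sum_sqn_integral_op.
exact: (littleo_schatten (singular_value_ge0 TS) r0 rxy lo).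
Qed.

End factored_kernels.

Lemma inverse_eigendata (R : realType) (H : preHilbertType R[i]) (E : set (H * H))
    (lam : nat -> R) (C p : R) :
  essentially_self_adjoint E -> positive_eigenvalues (closure E) lam ->
  0 < C -> 0 < p -> counting_bound lam C p ->
  exists (e : nat -> H) (c : R), let s := fun k => (lam k)^-1 in
  [/\ hilbert_basis e,
    forall u v, E (u, v) -> forall k, inner v (e k) = (lam k)%:C%C * inner u (e k),
    (forall k, 0 <= s k) /\ {homo s : i j / (i <= j)%N >-> j <= i},
    0 <= c /\ forall k, s k <= c * k.+1%:R `^ (- p^-1) &
    schatten_class p (op_inv (closure E)) -> exists A, [/\ 0 <= A,
      schatten_norm p (op_inv (closure E)) = A%:E &
      forall N, \sum_(k < N) s k `^ p <= A `^ p]].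
Proof.
move=> sE pE C0 p0 cb.
have [[l0 lh] _ _ _] := pE.
have [e [he Ee sv]] := eigenbasis_inverse sE pE (counting_bound_finite cb).
have [c [c0 hc]] := counting_bound_decay C0 p0 l0 lh cb.
exists e, c; split=> //.
  split=> [k|i j ij]; first by rewrite invr_ge0 ltW.
  by rewrite lef_pV2 ?posrE// lh.
by move=> [_ sfin]; have := schatten_norm_ge p0 sfin; rewrite sv.
Qed.

Theorem theorem4p1 (R : realType) (d1 d2 : measure_display)
    (X1 : measurableType d1) (X2 : measurableType d2)
    (mu1 : {sigma_finite_measure set X1 -> \bar R})
    (mu2 : {sigma_finite_measure set X2 -> \bar R})
    (E1 : set (L2 mu1 * L2 mu1)) (E2 : set (L2 mu2 * L2 mu2))
    (lam1 lam2 : nat -> R) (C1 C2 p1 p2 : R) (K : X2 * X1 -> R[i]) :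
  essentially_self_adjoint E1 -> positive_eigenvalues (closure E1) lam1 ->
  essentially_self_adjoint E2 -> positive_eigenvalues (closure E2) lam2 ->
  0 < C1 -> 0 < p1 -> counting_bound lam1 C1 p1 ->
  0 < C2 -> 0 < p2 -> counting_bound lam2 C2 p2 ->
  sqint (mu2 \x mu1)%E K ->
  let T : L2 mu1 -> L2 mu2 := integral_op mu2 K in
  (forall F G : X2 * X1 -> R[i],
    apply_y mu2 E1 K F -> apply_x mu1 E2 F G -> sqint (mu2 \x mu1)%E G ->
    (forall r : R, 0 < r -> r^-1 < 2^-1 + p1^-1 + p2^-1 ->
      schatten_class r T /\
      (schatten_class p1 (op_inv (closure E1)) -> schatten_class p2 (op_inv (closure E2)) ->
       (schatten_norm r T <= schatten_norm p1 (op_inv (closure E1)) *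
          schatten_norm p2 (op_inv (closure E2)) * L2norm (mu2 \x mu1) G)%E)) /\
    singular_value T =o_\oo (fun k => k.+1%:R `^ (- (2^-1 + p1^-1 + p2^-1)))) /\
  (forall (E : set (L2 mu1 * L2 mu1)) (lam : nat -> R) (C p : R),
    essentially_self_adjoint E -> positive_eigenvalues (closure E) lam ->
    0 < C -> 0 < p -> counting_bound lam C p ->
    forall G : X2 * X1 -> R[i],
    apply_y mu2 E K G -> sqint (mu2 \x mu1)%E G ->
    (forall r : R, 0 < r -> r^-1 < 2^-1 + p^-1 ->
      schatten_class r T /\
      (schatten_class p (op_inv (closure E)) ->
       (schatten_norm r T <=
          schatten_norm p (op_inv (closure E)) * L2norm (mu2 \x mu1) G)%E)) /\
    singular_value T =o_\oo (fun k => k.+1%:R `^ (- (2^-1 + p^-1)))) /\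
  (forall (E : set (L2 mu2 * L2 mu2)) (lam : nat -> R) (C p : R),
    essentially_self_adjoint E -> positive_eigenvalues (closure E) lam ->
    0 < C -> 0 < p -> counting_bound lam C p ->
    forall G : X2 * X1 -> R[i],
    apply_x mu1 E K G -> sqint (mu2 \x mu1)%E G ->
    (forall r : R, 0 < r -> r^-1 < 2^-1 + p^-1 ->
      schatten_class r T /\
      (schatten_class p (op_inv (closure E)) ->
       (schatten_norm r T <=
          schatten_norm p (op_inv (closure E)) * L2norm (mu2 \x mu1) G)%E)) /\
    singular_value T =o_\oo (fun k => k.+1%:R `^ (- (2^-1 + p^-1)))).
Proof.
move=> sE1 pE1 sE2 pE2 C10 p10 cb1 C20 p20 cb2 sK T.
have TS := integral_op_adjoint sK.
have [e1 [c1 [he1 Ee1 [s10 s1h] [c10 sc1] A1P]]] := inverse_eigendata sE1 pE1 C10 p10 cb1.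
have [e2 [c2 [he2 Ee2 [s20 s2h] [c20 sc2] A2P]]] := inverse_eigendata sE2 pE2 C20 p20 cb2.
have [[l10 l1h] _ _ _] := pE1; have [[l20 l2h] _ _ _] := pE2.
have pos (p : R) : 0 < p -> 0 <= p^-1 by move=> p0; rewrite invr_ge0 ltW.
have one_decay k : (1 : R) <= 1 * k.+1%:R `^ (- 0) by rewrite oppr0 powRr0 mulr1.
split; [|split].
- move=> F G aF aG sG.
  have [mF _] := aF.
  (* On almost every slice the intermediate kernel is controlled by [G], since the eigenvalues of
     [E2] are bounded below by [lam2 0 > 0]. *)
  have sF : sqint (mu2 \x mu1)%E F.
    rewrite -(kernel_trK F); apply: sqint_tr.
    apply: (sqint_kernel_le (G := kernel_tr G) (c := lam2 0%N ^- 2)).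
    - exact: cmeasurable_tr.
    - exact: sqint_tr.
    - by rewrite invr_ge0 sqr_ge0.
    have [_] := aG; apply: filterS => y [sx tx Exy]; split=> //.
    by apply: eigenbasis_coercive he2 l20 l2h _; exact: Ee2 Exy.
  have tE k j := inner_factor (scale_factor (l10 k) (integral_op_intertwine Ee1 aF sK sF k))
    (mul_factor (l20 j) (integral_op_intertwine_left Ee2 aG sF sG (L2_conj (e1 k)) j)).
  have [cls lo] := integral_op_class sK sG he1 he2 s10 s1h s20 s2h tE c10 c20
    (pos _ p10) (pos _ p20) sc1 sc2.
  split; last exact: lo.
  move=> r r0 rp; split; first exact: cls.
  move=> /A1P[A1 [A10 -> A1s]] /A2P[A2 [A20 -> A2s]].
  rewrite (L2norm_hs_norm2 sG).
  exact: (schatten_norm_two_factors TS (L2_conj_hb he1) he2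
    (fun N => sum_sqn_integral_op N sK he1) (fun N => sum_sqn_integral_op N sG he1)
    r0 p10 p20 A10 A20 s10 s20 tE A1s A2s (ltW rp)).
- move=> E lam C p sE pE C0 p0 cb G aG sG.
  have [e [c [he Ee [s0 sh] [c0 sc] AP]]] := inverse_eigendata sE pE C0 p0 cb.
  have [[l0 _] _ _ _] := pE.
  have tE1 k := scale_factor (l0 k) (integral_op_intertwine Ee aG sK sG k).
  (* Here [e2] serves only as a basis of [L2 mu2]. *)
  have tE k j := inner_factor (tE1 k) (esym (mul1r (inner (integral_op mu2 G (L2_conj (e k))) (e2 j)))).
  have [cls lo] := integral_op_class (beta := fun=> 1) sK sG he he2 s0 sh (fun=> ler01)
    (fun _ _ _ => lexx 1) tE c0 ler01 (pos _ p0) (lexx 0) sc one_decay.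
  rewrite addr0 in cls lo; split; last exact: lo.
  move=> r r0 rp; split; first exact: cls.
  move=> /AP[A [A0 -> As]]; rewrite (L2norm_hs_norm2 sG).
  exact: (schatten_norm_right_factor TS (L2_conj_hb he) he2
    (fun N => sum_sqn_integral_op N sK he) (fun N => sum_sqn_integral_op N sG he)
    r0 p0 A0 s0 tE1 As (ltW rp)).
- move=> E lam C p sE pE C0 p0 cb G aG sG.
  have [e [c [he Ee [s0 sh] [c0 sc] AP]]] := inverse_eigendata sE pE C0 p0 cb.
  have [[l0 _] _ _ _] := pE.
  have tE2 k j := mul_factor (l0 j) (integral_op_intertwine_left Ee aG sK sG (L2_conj (e1 k)) j).
  have tE k j := inner_factor (esym (scale1r (integral_op mu2 K (L2_conj (e1 k))))) (tE2 k j).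
  have [cls lo] := integral_op_class (alpha := fun=> 1) sK sG he1 he (fun=> ler01)
    (fun _ _ _ => lexx 1) s0 sh tE ler01 c0 (lexx 0) (pos _ p0) one_decay sc.
  rewrite addr0 in cls lo; split; last exact: lo.
  move=> r r0 rp; split; first exact: cls.
  move=> /AP[A [A0 -> As]]; rewrite (L2norm_hs_norm2 sG).
  exact: (schatten_norm_left_factor TS (L2_conj_hb he1) he
    (fun N => sum_sqn_integral_op N sK he1) (fun N => sum_sqn_integral_op N sG he1)
    r0 p0 A0 s0 tE2 As (ltW rp)).
Qed.
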